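(* Let $\Gamma$ be a Zariski dense subgroup of $\mathrm{Sp}(2g,\mathbb{Z})$ with a finite symmetric generating set $S$. Then the probability that the first Betti number of a random $(\Gamma,n)$ manifold $M$ is greater than $1$ decreases exponentially as a function of $n$; that is, there are constants $C,c>0$ such that for all $n$ $$\mathbb{P}\big(b_1(M)>1\big)\le C e^{-cn}.$$
   Context: $X$ is a closed connected orientable surface of genus $g$, and for an orientation-preserving homeomorphism $\phi:X\to X$, $M_\phi$ denotes the mapping torus, a closed 3-manifold fibering over the circle with fiber $X$. The symplectic monodromy is the induced map $\phi_*\in\mathrm{Sp}(2g,\mathbb{Z})$ on $H_1(X,\mathbb{Z})$. Given a Zariski dense subgroup $\Gamma$ of $\mathrm{Sp}(2g,\mathbb{Z})$ (dense in the algebraic group $\mathrm{Sp}(2g)$) with a finite symmetric generating set $S$, a random $(\Gamma,n)$ manifold is a mapping torus $M_\phi$ whose symplectic monodromy $\phi_*$ is a product of $n$ independent uniformly chosen elements of $S$. (The first homology of $M_\phi$ depends only on $\phi_*$.) *)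

(* Defs.v *)
From HB Require Import structures.
From mathcomp Require Import freeg.
From mathcomp Require Import all_boot all_order all_algebra.
From mathcomp Require Import complex finmap.
From mathcomp Require Import all_classical all_reals all_analysis.
From mathcomp Require mpoly.
From Stdlib Require Relation_Operators.

Set Implicit Arguments.
Unset Strict Implicit.
Unset Printing Implicit Defensive.

Import Order.TTheory GRing.Theory Num.Theory.
Import numFieldNormedType.Exports.

Local Open Scope classical_set_scope.
Local Open Scope ring_scope.
Local Open Scope quotient_scope.

(* The vertices of the k-simplex are the k + 1 unit vectors of R^(k+1). *)
Definition std_simplex (R : realType) (k : nat) : set 'rV[R]_k.+1 :=
  [set x | (forall i, 0 <= x ord0 i) /\ \sum_i x ord0 i = 1].
Arguments std_simplex : clear implicits.

(* The linear map R^(k+1) -> R^(k+2) sending the a-th unit vector to the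
   (lift i a)-th one, i.e. omitting the i-th vertex. *)
Definition face_lin (R : realType) (k : nat) (i : 'I_k.+2) (x : 'rV[R]_k.+1) :
    'rV[R]_k.+2 :=
  x *m rowsub (lift i) 1%:M.

Lemma face_lin_row (R : realType) k (i : 'I_k.+2) (x : 'rV[R]_k.+1) :
  face_lin i x = \row_j oapp (x ord0) 0 (unlift i j).
Proof.
apply/rowP => j; rewrite !mxE; case: unliftP => [j' ->|->] /=.
  rewrite (bigD1 j') //= !mxE eqxx mulr1 big1 ?addr0 // => a aj.
  by rewrite !mxE (inj_eq lift_inj) (negbTE aj) mulr0.
by rewrite big1 // => a _; rewrite !mxE eq_sym (negbTE (neq_lift _ _)) mulr0.
Qed.

Lemma face_lin_simplex (R : realType) k (i : 'I_k.+2) (x : std_simplex R k) :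
  face_lin i (set_val x) \in std_simplex R k.+1.
Proof.
have [x0 x1] : std_simplex R k (set_val x) := set_valP x.
rewrite inE face_lin_row; split=> [j|].
  by rewrite mxE; case: unliftP => //= j' _; exact: x0.
rewrite (bigD1_ord i) //= mxE unlift_none /= add0r -[RHS]x1.
by apply: eq_bigr => j _; rewrite mxE liftK.
Qed.

Definition face_map (R : realType) (k : nat) (i : 'I_k.+2)
    (x : std_simplex R k) : std_simplex R k.+1 :=
  exist _ (face_lin i (set_val x)) (face_lin_simplex i x).
Arguments face_map : clear implicits.

Lemma face_lin_continuous (R : realType) k (i : 'I_k.+2) :
  continuous (@face_lin R k i).
Proof.
move=> x B [P Pn sPB].
suff : \forall y \near x, forall a b, P a b (face_lin i y a b).
  by apply: filterS => y Py; apply: sPB => a b; exact: Py.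
have FF : Filter (nbhs x) by exact: nbhs_filter.
apply: (@filter_forall _ _ (fun a y => forall b, P a b (face_lin i y a b)) _ FF)
  => a.
apply: (@filter_forall _ _ (fun b y => P a b (face_lin i y a b)) _ FF) => b.
have cb : continuous (fun y : 'rV[R]_k.+1 => face_lin i y a b).
  rewrite (_ : (fun y => _) =
      fun y : 'rV[R]_k.+1 => oapp (y ord0) 0 (unlift i b)).
    by case: unlift => [b'|] /=; [exact: coord_continuous|exact: cst_continuous].
  by apply/funext => y; rewrite face_lin_row mxE ord1.
exact: (cb x _ (Pn a b)).
Qed.

Lemma face_map_continuous (R : realType) k (i : 'I_k.+2) :
  continuous (face_map R k i).
Proof.
apply: continuous_comp_initial => x.
rewrite (_ : _ \o _ = @face_lin R k i \o set_val) //.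
by apply: continuous_comp; [exact: initial_continuous|exact: face_lin_continuous].
Qed.

HB.instance Definition _ (R : realType) k i :=
  @isContinuous.Build _ _ (face_map R k i) (@face_map_continuous R k i).

Definition singular (R : realType) (k : nat) (X : topologicalType) :=
  continuousType (std_simplex R k) X.
Arguments singular : clear implicits.
HB.instance Definition _ R k X := Choice.on (singular R k X).

Definition chain (R : realType) (k : nat) (X : topologicalType) :=
  {freeg (singular R k X) / int}.
Arguments chain : clear implicits.
HB.instance Definition _ R k X := GRing.Lmodule.on (chain R k X).

Section Chains.
Variables (R : realType) (X : topologicalType).

Definition simplex_chain k (s : singular R k X) : chain R k X :=
  [freeg [:: (1, s)]].

Definition simplex_face k (i : 'I_k.+2) (s : singular R k.+1 X) :
    singular R k X :=
  s \o face_map R k i.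

Definition boundary k (c : chain R k.+1 X) : chain R k X :=
  fglift (fun s => \sum_(i < k.+2) (-1) ^+ i *: simplex_chain (simplex_face i s))
    c.

Definition is_cycle k (c : chain R k.+1 X) : Prop := boundary c = 0.

Definition homologous k (c c' : chain R k X) : Prop :=
  exists d : chain R k.+1 X, boundary d = c - c'.

(* The supremum of the sizes of families of 1-cycles whose classes are linearly
   independent over Z, i.e. the rank of H_1(X; Z). *)
Definition betti1 : \bar R :=
  ereal_sup [set m%:R%:E | m in [set m : nat |
    exists z : 'I_m -> chain R 1 X,
      (forall i, is_cycle (z i)) /\
      (forall a : 'I_m -> int,
        homologous (\sum_i a i *: z i) 0 -> forall i, a i = 0)]].

(* [z] is a family of cycles whose classes form a Z-basis of H_1(X; Z). *)
Definition homology1_basis m (z : 'I_m -> chain R 1 X) : Prop :=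
  (forall i, is_cycle (z i)) /\
  (forall c : chain R 1 X, is_cycle c ->
    exists! a : {ffun 'I_m -> int}, homologous c (\sum_i a i *: z i)).

Definition cochain_eval k (a : singular R k X -> int) (c : chain R k X) : int :=
  fglift (a : _ -> int^o) c.

Definition is_cocycle k (a : singular R k X -> int) : Prop :=
  forall c : chain R k.+1 X, cochain_eval a (boundary c) = 0.

(* In a 2-simplex, the front edge [v0, v1] omits v2 and the back edge [v1, v2]
   omits v0. *)
Definition front_edge (s : singular R 2 X) : singular R 1 X :=
  simplex_face ord_max s.

Definition back_edge (s : singular R 2 X) : singular R 1 X :=
  simplex_face ord0 s.

Definition cup11 (a b : singular R 1 X -> int) : singular R 2 X -> int :=
  fun s => a (front_edge s) * b (back_edge s).

Definition cap21 (c : chain R 2 X) (a : singular R 1 X -> int) : chain R 1 X :=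
  fglift (fun s => a (front_edge s) *: simplex_chain (back_edge s)) c.

(* Local homology: H_2(X, X \ {x}) consists of the relative cycles, the
   2-chains with boundary in X \ {x}, up to boundaries and chains in X \ {x}. *)

Definition avoids k (x : X) (c : chain R k X) : Prop :=
  forall s, s \in dom c -> forall t, s t <> x.

Definition generates_local_H2 (x : X) (c : chain R 2 X) : Prop :=
  forall z : chain R 2 X, avoids x (boundary z) ->
  exists (m : int) (d : chain R 3 X) (e : chain R 2 X),
    avoids x e /\ z = m *: c + boundary d + e.

Definition locally_euclidean2 : Prop :=
  forall x : X, exists (U : set X) (f : X -> 'rV[R]_2) (h : 'rV[R]_2 -> X),
    [/\ open U /\ U x, open (f @` U), {in U, cancel f h},
        {within U, continuous f} & {within f @` U, continuous h}].

Definition closed_connected_surface : Prop :=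
  [/\ [set: X] !=set0, hausdorff_space X, compact [set: X], connected [set: X]
    & locally_euclidean2].

(* A cycle restricting at every point to a generator of the local homology,
   which is infinite cyclic for a surface; X is orientable when there is one,
   and choosing one orients it. *)
Definition fundamental_cycle (mu : chain R 2 X) : Prop :=
  is_cycle mu /\ forall x, generates_local_H2 x mu.

(* The intersection number of two 1-cycles is the cup product of the cocycles
   Poincare dual to them, evaluated on the fundamental class. *)
Definition intersection_number (mu : chain R 2 X) (c c' : chain R 1 X)
    (m : int) : Prop :=
  exists a b : singular R 1 X -> int,
    [/\ is_cocycle a, is_cocycle b, homologous (cap21 mu a) c,
        homologous (cap21 mu b) c' & cochain_eval (cup11 a b) mu = m].

End Chains.
Arguments betti1 : clear implicits.
Arguments closed_connected_surface : clear implicits.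

Definition push_chain (R : realType) (X Y : topologicalType) k
    (f : continuousType X Y) (c : chain R k X) : chain R k Y :=
  fglift (fun s : singular R k X =>
    simplex_chain ((f \o s : continuousType _ _) : singular R k Y)) c.

Definition homeomorphism (X Y : topologicalType) (f : continuousType X Y) :
    Prop :=
  exists h : continuousType Y X, cancel f h /\ cancel h f.

Definition orientation_preserving (R : realType) (X : topologicalType)
    (mu : chain R 2 X) (f : continuousType X X) : Prop :=
  homologous (push_chain f mu) mu.

Section MappingTorus.
Variables (R : realType) (X : topologicalType) (phi : X -> X).

Definition cylinder : topologicalType := (X * (`[0, 1]%classic : set R))%type.

(* (x, 1) is glued to (phi x, 0). *)
Definition glued (p q : cylinder) : Prop :=
  [/\ set_val p.2 = 1, set_val q.2 = 0 & q.1 = phi p.1].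

Definition torus_eq (p q : cylinder) : bool :=
  `[< Relation_Operators.clos_refl_sym_trans _ glued p q >].

Lemma torus_eq_refl : reflexive torus_eq.
Proof. by move=> p; apply/asboolP; exact: Relation_Operators.rst_refl. Qed.

Lemma torus_eq_sym : symmetric torus_eq.
Proof. by move=> p q; apply/asboolP/asboolP => h; exact: Relation_Operators.rst_sym. Qed.

Lemma torus_eq_trans : transitive torus_eq.
Proof.
by move=> q p r /asboolP pq /asboolP qr; apply/asboolP; exact: Relation_Operators.rst_trans pq qr.
Qed.

Definition torus_equiv :=
  EquivRel torus_eq torus_eq_refl torus_eq_sym torus_eq_trans.

Definition mapping_torus : topologicalType :=
  quotient_topology {eq_quot torus_equiv}.

End MappingTorus.
Arguments mapping_torus : clear implicits.

Definition symplectic_form (K : pzRingType) (g : nat) : 'M[K]_(g + g) :=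
  block_mx 0 1%:M (- 1%:M) 0.

Definition Sp (K : pzRingType) (g : nat) : set 'M[K]_(g + g) :=
  [set A | A^T *m symplectic_form K g *m A = symplectic_form K g].
Arguments Sp : clear implicits.

Definition subgroup_of_SpZ (g : nat) (G : set 'M[int]_(g + g)) : Prop :=
  [/\ G `<=` Sp int g, G 1%:M, forall A B, G A -> G B -> G (A *m B)
    & forall A, G A -> G (invmx A)].

Definition generated_by (g : nat) (G : set 'M[int]_(g + g))
    (S : {fset 'M[int]_(g + g)}) : Prop :=
  (forall A, A \in S -> G A) /\
  (forall H, subgroup_of_SpZ H -> (forall A, A \in S -> H A) -> G `<=` H).

Definition symmetric_set (g : nat) (S : {fset 'M[int]_(g + g)}) : Prop :=
  forall A, A \in S -> invmx A \in S.

(* Polynomials in the (g + g)^2 matrix entries, listed by [mxvec]. *)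
Definition zariski_dense_in_Sp (R : realType) (g : nat)
    (G : set 'M[int]_(g + g)) : Prop :=
  forall p : mpoly.mpoly ((g + g) * (g + g)) (complex R),
    (forall A, G A ->
      mpoly.meval (mxvec (map_mx (fun m : int => m%:~R) A) ord0) p = 0) ->
    forall B, Sp (complex R) g B -> mpoly.meval (mxvec B ord0) p = 0.

Definition symplectic_basis (R : realType) (X : topologicalType) (g : nat)
    (mu : chain R 2 X) (e : 'I_(g + g) -> chain R 1 X) : Prop :=
  homology1_basis e /\
  forall i j, intersection_number mu (e i) (e j) (symplectic_form int g i j).

(* [A] is the matrix, in the basis [e], of the map induced by [f] on
   H_1(X; Z). *)
Definition has_monodromy (R : realType) (X : topologicalType) (g : nat)
    (e : 'I_(g + g) -> chain R 1 X) (f : continuousType X X)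
    (A : 'M[int]_(g + g)) : Prop :=
  forall j, homologous (push_chain f (e j)) (\sum_i A i j *: e i).

(* For the uniform probability on words, the n letters are independent and
   uniform in S. *)
Definition words (g : nat) (S : {fset 'M[int]_(g + g)}) (n : nat) : finType :=
  {ffun 'I_n -> S}.

Definition word_prod (g : nat) (S : {fset 'M[int]_(g + g)}) (n : nat)
    (w : words S n) : 'M[int]_(g + g) :=
  \big[mulmx/1%:M]_(i < n) val (w i).

Definition counting_prob (R : realType) (T : finType) (E : set T) : R :=
  #|[set t | `[< E t >]]%SET|%:R / #|T|%:R.
Arguments counting_prob R {T} E.

(* Each mapping_torus (phi w) has the product of the word w as monodromy. *)
Definition random_gluing (R : realType) (X : topologicalType) (g : nat)
    (mu : chain R 2 X) (e : 'I_(g + g) -> chain R 1 X)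
    (S : {fset 'M[int]_(g + g)}) (n : nat)
    (phi : words S n -> continuousType X X) : Prop :=
  forall w, [/\ homeomorphism (phi w), orientation_preserving mu (phi w)
              & has_monodromy e (phi w) (word_prod w)].

(* Main.v *)
(* Topology. Cutting the mapping torus along fibers, every path in it slides
   along the suspension flow to a path in a fiber, up to finitely many turns of
   one flow loop. So a cycle is homologous to a fiber cycle plus a multiple of
   that loop, and as c and phi_* c are homologous in the torus, fiber cycles
   are torsion as soon as det(phi_* - 1) <> 0. Hence b_1 > 1 forces
   det(phi_* - 1) = 0.

   Random walk. det(A - 1) is a linear form in v rho(A), for a polynomial
   representation rho of Sp and a vector v, so the walk w must bring v into a
   fixed subspace U. By induction on the rank of U this is exponentially
   unlikely: by Cauchy-Schwarz, the square of the probability that w_1 w_2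
   does so is at most the probability that two independent copies of w_2 move
   U to the same subspace plus the probability that w_1 brings v into a
   subspace of smaller rank. Such collisions decay exponentially if the walk
   has a spectral gap on l^2 of the non-invariant subspaces of a given rank.
   Without a gap, almost invariant functions converge along an ultrafilter to
   a finitely additive invariant probability on these subspaces, hence, through
   Pluecker coordinates, on the lines of a polynomial representation without
   nonzero fixed vectors. Furstenberg's argument then yields a subspace of
   minimal dimension carrying mass; by irreducibility of Sp it is invariant,
   and the walk acts on it by bounded matrices. By Zariski density Sp itself
   preserves a positive definite form there; transvections being unipotent,
   the action is trivial, a contradiction. *)
Require Import Defs.
From mathcomp Require Import freeg fingroup perm.
From mathcomp Require Import all_boot all_order all_algebra complex finmap.
From mathcomp Require Import all_classical all_reals all_analysis.
From mathcomp Require Import ring lra zify.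
From mathcomp Require mpoly.

Set Implicit Arguments.
Unset Strict Implicit.
Unset Printing Implicit Defensive.

Import Order.TTheory GRing.Theory Num.Theory.
Import numFieldNormedType.Exports.
Local Open Scope classical_set_scope.
Local Open Scope ring_scope.
Local Open Scope quotient_scope.

(** * Singular chains *)

(** Without a gap, the translates of almost extremal functions by different generators are close to
    one another, but perhaps not to the functions themselves (as for eigenvalue -1). So the limiting
    mean is known to be invariant only under words of even length; these are still Zariski dense
    because Sp is irreducible. The mean is merely finitely additive: a subspace can be null although
    all its neighborhoods have mass. Mass is therefore measured on small neighborhoods, and
    projective space appears only through cones of vectors. Invariant subspaces are excluded since
    they correspond to fixed Pluecker vectors; after division by the fixed vectors no new ones
    appear, because a transvection is conjugate to its fourth power. All structural input on Sp
    comes from transvections: they generate, they join points by polynomial curves, which gives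
    irreducibility, and bounded polynomial curves are constant. The form preserved by a bounded
    group is the unique minimiser of a convex functional, so no averaging over a compact group
    occurs. *)

Lemma fgliftD (K : choiceType) (M : lmodType int) (f : K -> M)
  (c d : {freeg K / int}) : fglift f (c + d) = fglift f c + fglift f d.
Proof.
have h := @lift_is_additive int K M f.
have h0 : fglift f (0 : {freeg K / int}) = 0 by rewrite -(subrr 0) h subrr.
have hN : fglift f (- d) = - fglift f d by rewrite -[- d]sub0r h h0 sub0r.
by rewrite -{1}[d]opprK h hN opprK.
Qed.

Lemma fglift0 (K : choiceType) (M : lmodType int) (f : K -> M) :
  fglift f (0 : {freeg K / int}) = 0.
Proof. by have := fgliftD f 0 0; rewrite addr0 => /esym/eqP; rewrite -subr_eq0 addrK => /eqP. Qed.

Lemma fgliftZ (K : choiceType) (M : lmodType int) (f : K -> M) (a : int)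
  (c : {freeg K / int}) : fglift f (a *: c) = a *: fglift f c.
Proof.
pose F := fglift f.
have FN x : F (- x) = - F x.
  by apply/eqP; rewrite -addr_eq0 /F -fgliftD addrC subrr fglift0.
have Fn n x : F (x *+ n) = F x *+ n.
  elim: n => [|n ih]; first by rewrite !mulr0n /F fglift0.
  by rewrite !mulrS /F fgliftD -/F ih.
rewrite -[a]intz !scaler_int -/F; case: a => n.
  by rewrite -!pmulrn Fn.
by rewrite !NegzE !mulrNz FN -!pmulrn Fn.
Qed.

Lemma fgliftB (K : choiceType) (M : lmodType int) (f : K -> M)
  (c d : {freeg K / int}) : fglift f (c - d) = fglift f c - fglift f d.
Proof. exact: lift_is_additive. Qed.

Lemma fglift_sum (K : choiceType) (M : lmodType int) (f : K -> M)
  (I : Type) (r : seq I) (P : pred I) (F : I -> {freeg K / int}) :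
  fglift f (\sum_(i <- r | P i) F i) = \sum_(i <- r | P i) fglift f (F i).
Proof.
by elim/big_rec2: _ => [|i x y _ <-]; [rewrite fglift0|rewrite fgliftD].
Qed.

Lemma freeg_ind_add (K : choiceType) (P : {freeg K / int} -> Prop) :
  P 0 -> (forall a s c, P c -> P (a *: << s >> + c)) -> forall c, P c.
Proof.
move=> P0 PS c; rewrite -[c]freeg_sumE; elim: (dom c) => [|s r ih].
  by rewrite big_nil.
rewrite big_cons; have -> : << coeff s c *g s >> = coeff s c *: << s >> :> {freeg K / int}.
  by apply/eqP/freeg_eqP => x; rewrite coeffZ !coeffU mul1r.
exact: PS.
Qed.

Lemma eq_fglift_lin (K : choiceType) (M : lmodType int) (F G : {freeg K / int} -> M) :
  (forall c d, F (c + d) = F c + F d) -> (forall c d, G (c + d) = G c + G d) ->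
  (forall a c, F (a *: c) = a *: F c) -> (forall a c, G (a *: c) = a *: G c) ->
  (forall s, F << s >> = G << s >>) -> F =1 G.
Proof.
move=> FD GD FZ GZ FG; apply: freeg_ind_add => [|a s c ih].
  by rewrite -(scale0r 0) FZ GZ !scale0r.
by rewrite FD GD FZ GZ FG ih.
Qed.

Section ChainBasics.
Variables (R : realType).
Implicit Types X Y : topologicalType.

Lemma fglift_simplex X k (M : lmodType int) (f : singular R k X -> M) s :
  fglift f (simplex_chain s) = f s.
Proof. by rewrite /simplex_chain liftU scale1r. Qed.

Lemma boundaryD X k (c d : chain R k.+1 X) :
  boundary (c + d) = boundary c + boundary d.
Proof. exact: fgliftD. Qed.

Lemma boundaryZ X k a (c : chain R k.+1 X) : boundary (a *: c) = a *: boundary c.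
Proof. exact: fgliftZ. Qed.

Lemma boundary0 X k : boundary (0 : chain R k.+1 X) = 0.
Proof. exact: fglift0. Qed.

Lemma boundaryB X k (c d : chain R k.+1 X) :
  boundary (c - d) = boundary c - boundary d.
Proof. by rewrite -scaleN1r boundaryD boundaryZ scaleN1r. Qed.

Lemma boundary_simplex X k (s : singular R k.+1 X) :
  boundary (simplex_chain s) =
  \sum_(i < k.+2) (-1) ^+ i *: simplex_chain (simplex_face i s).
Proof. by rewrite /boundary fglift_simplex. Qed.

Lemma push_chainD X Y k (f : continuousType X Y) (c d : chain R k X) :
  push_chain f (c + d) = push_chain f c + push_chain f d.
Proof. exact: fgliftD. Qed.

Lemma push_chainZ X Y k (f : continuousType X Y) a (c : chain R k X) :
  push_chain f (a *: c) = a *: push_chain f c.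
Proof. exact: fgliftZ. Qed.

Lemma push_chainB X Y k (f : continuousType X Y) (c d : chain R k X) :
  push_chain f (c - d) = push_chain f c - push_chain f d.
Proof. by rewrite -scaleN1r push_chainD push_chainZ scaleN1r. Qed.

Lemma push_simplex X Y k (f : continuousType X Y) (s : singular R k X) :
  push_chain f (simplex_chain s) =
  simplex_chain ((f \o s : continuousType _ _) : singular R k Y).
Proof. by rewrite /push_chain fglift_simplex. Qed.

Lemma boundary_push X Y k (f : continuousType X Y) (c : chain R k.+1 X) :
  boundary (push_chain f c) = push_chain f (boundary c).
Proof.
move: c; apply: eq_fglift_lin => [c d|c d|a c|a c|s].
- by rewrite push_chainD boundaryD.
- by rewrite boundaryD push_chainD.
- by rewrite push_chainZ boundaryZ.
- by rewrite boundaryZ push_chainZ.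
rewrite -/(simplex_chain s) push_simplex !boundary_simplex /push_chain fglift_sum.
apply: eq_bigr => i _; rewrite fgliftZ fglift_simplex; congr (_ *: simplex_chain _).
exact/continuousEP.
Qed.

Definition bounds X k (c : chain R k X) := exists d, boundary d = c.

Lemma bounds0 X k : bounds (0 : chain R k X).
Proof. by exists 0; rewrite -(scale0r 0) boundaryZ scale0r. Qed.

Lemma boundsD X k (c d : chain R k X) : bounds c -> bounds d -> bounds (c + d).
Proof. by move=> [c' <-] [d' <-]; exists (c' + d'); rewrite boundaryD. Qed.

Lemma boundsZ X k a (c : chain R k X) : bounds c -> bounds (a *: c).
Proof. by move=> [c' <-]; exists (a *: c'); rewrite boundaryZ. Qed.

Lemma boundsB X k (c d : chain R k X) : bounds c -> bounds d -> bounds (c - d).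
Proof. by rewrite -scaleN1r => ? ?; apply: boundsD => //; exact: boundsZ. Qed.

Lemma bounds_push X Y k (f : continuousType X Y) (c : chain R k X) :
  bounds c -> bounds (push_chain f c).
Proof. by move=> [d <-]; exists (push_chain f d); rewrite boundary_push. Qed.

(** Simplices are built from maps on the whole coordinate space, so that continuity is checked there
    and not on the subtype. *)
Definition coord_simplex X k (h : 'rV[R]_k.+1 -> X) (ch : continuous h) :
    singular R k X :=
  mkcts (fun x : std_simplex R k =>
    continuous_comp (@initial_continuous _ _ set_val x) (ch (set_val x))).

End ChainBasics.

(** * Paths as 1-chains *)

Lemma cont_pair (X Y Z : topologicalType) (f : X -> Y) (g : X -> Z) :
  continuous f -> continuous g -> continuous (fun x => (f x, g x)).
Proof. by move=> cf cg x; apply: cvg_pair; [exact: cf|exact: cg]. Qed.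

Lemma cont_comp (X Y Z : topologicalType) (f : X -> Y) (g : Y -> Z) :
  continuous f -> continuous g -> continuous (fun x => g (f x)).
Proof. by move=> cf cg x; apply: continuous_comp; [exact: cf|exact: cg]. Qed.

Lemma cont_comp2 (T X Y Z : topologicalType) (g : X * Y -> Z) (a : T -> X)
    (b : T -> Y) :
  continuous a -> continuous b -> continuous g -> continuous (fun t => g (a t, b t)).
Proof. by move=> ca cb cg; apply: (cont_comp (cont_pair ca cb)). Qed.

Section Paths.
Variable (R : realType).
Implicit Types (X Y : topologicalType) (T : topologicalType).

Lemma cont_cst X Y (y : Y) : continuous (fun _ : X => y).
Proof. exact: cst_continuous. Qed.

Lemma cont_id X : continuous (fun x : X => x).
Proof. by move=> x. Qed.

Lemma cont_add T (f g : T -> R) : continuous f -> continuous g ->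
  continuous (fun t => f t + g t).
Proof. by move=> cf cg t; apply: continuousD; [exact: cf|exact: cg]. Qed.

Lemma cont_mul T (f g : T -> R) : continuous f -> continuous g ->
  continuous (fun t => f t * g t).
Proof. by move=> cf cg t; apply: continuousM; [exact: cf|exact: cg]. Qed.

Lemma cont_fst X Y : continuous (fun p : X * Y => p.1).
Proof. by move=> p; exact: cvg_fst. Qed.

Lemma cont_snd X Y : continuous (fun p : X * Y => p.2).
Proof. by move=> p; exact: cvg_snd. Qed.

(** Retraction of the line onto [0, 1]; composing with it extends to all of [R] what makes sense
    only on the interval. *)
Definition clamp (t : R) : R := Num.max 0 (Num.min t 1).

Lemma clamp_continuous : continuous clamp.
Proof.
move=> t; apply: (@continuous_max R R (fun=> 0) (fun t => Num.min t 1)).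
  exact: cst_continuous.
by apply: (@continuous_min R R (fun t => t) (fun=> 1)) => //; exact: cst_continuous.
Qed.

Lemma clamp_itv t : 0 <= clamp t <= 1.
Proof. by rewrite /clamp le_max lexx /= ge_max ler01 ge_min lexx orbT. Qed.

Lemma clamp_id t : 0 <= t <= 1 -> clamp t = t.
Proof. by move=> /andP[t0 t1]; rewrite /clamp (min_idPl t1) (max_idPr t0). Qed.

Definition seg X (f : R -> X) (cf : continuous f) : singular R 1 X :=
  coord_simplex (cont_comp (@coord_continuous R 1 2 ord0 (lift ord0 ord0)) cf).

Lemma segE X (f : R -> X) (cf : continuous f) x :
  seg cf x = f (set_val x ord0 (lift ord0 ord0)).
Proof. by []. Qed.

Lemma simplex1P (x : std_simplex R 1) :
  0 <= set_val x ord0 (lift ord0 ord0) <= 1 /\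
  set_val x ord0 ord0 = 1 - set_val x ord0 (lift ord0 ord0).
Proof.
have [x0 x1] : std_simplex R 1 (set_val x) := set_valP x.
move: x1; rewrite !big_ord_recl big_ord0 addr0.
have := x0 ord0; have := x0 (lift ord0 ord0) => h1 h0 e.
by split; [apply/andP; split=> //|]; lra.
Qed.

Lemma eq_seg X (f g : R -> X) (cf : continuous f) (cg : continuous g) :
  (forall t, 0 <= t <= 1 -> f t = g t) -> seg cf = seg cg.
Proof. by move=> fg; apply/continuousEP => x; rewrite !segE fg //; case: (simplex1P x). Qed.

Definition edge_row (t : R) : 'rV[R]_2 :=
  \row_j (if j == ord0 then 1 - clamp t else clamp t).

Lemma edge_rowP t : edge_row t \in std_simplex R 1.
Proof.
have /andP[h0 h1] := clamp_itv t.
rewrite inE; split=> [i|]; first by rewrite mxE; case: ifP => _; rewrite ?subr_ge0.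
by rewrite !big_ord_recl big_ord0 !mxE /= addr0 subrK.
Qed.

Definition edge_pt (t : R) : std_simplex R 1 := exist _ (edge_row t) (edge_rowP t).

Lemma edge_pt_continuous : continuous edge_pt.
Proof.
apply: continuous_comp_initial => t.
rewrite (_ : _ \o _ = edge_row) //.
move=> B [P Pn sPB].
suff : \forall y \near t, forall a b, P a b (edge_row y a b).
  by apply: filterS => y Py; apply: sPB => a b; exact: Py.
have FF : Filter (nbhs t) by exact: nbhs_filter.
apply: (@filter_forall _ _ (fun a y => forall b, P a b (edge_row y a b)) _ FF) => a.
apply: (@filter_forall _ _ (fun b y => P a b (edge_row y a b)) _ FF) => b.
have cb : continuous (fun y => edge_row y a b).
  have -> : (fun y => edge_row y a b) = fun y => if b == ord0 then 1 - clamp y else clamp y.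
    by apply/funext => y; rewrite mxE.
  case: (b == ord0); last exact: clamp_continuous.
  by move=> y; apply: continuousB; [exact: cst_continuous|exact: clamp_continuous].
exact: (cb t _ (Pn a b)).
Qed.

Definition path_fun X (s : singular R 1 X) (t : R) : X := s (edge_pt t).

Lemma path_fun_continuous X (s : singular R 1 X) : continuous (path_fun s).
Proof. exact: (cont_comp edge_pt_continuous (@cts_fun _ _ s)). Qed.

Lemma seg_path_fun X (s : singular R 1 X) : seg (@path_fun_continuous X s) = s.
Proof.
apply/continuousEP => x; rewrite segE /path_fun; congr (s _).
apply: val_inj => /=; apply/rowP => j; rewrite mxE.
have [h e] := simplex1P x; rewrite clamp_id //.
case: ifP => [/eqP ->|]; first by rewrite -e.
by case: (unliftP ord0 j) => [j'|] -> //; rewrite (ord1 j').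
Qed.

Lemma simplex0P (x : std_simplex R 0) : set_val x = const_mx 1.
Proof.
have [x0 x1] : std_simplex R 0 (set_val x) := set_valP x.
by move: x1; rewrite big_ord_recl big_ord0 addr0 => e; apply/rowP => i; rewrite mxE ord1.
Qed.


Lemma pt0_subproof : (const_mx 1 : 'rV[R]_1) \in std_simplex R 0.
Proof.
by rewrite inE; split=> [i|]; rewrite ?big_ord_recl ?big_ord0 ?addr0 mxE ?ler01.
Qed.

Definition pt0 : std_simplex R 0 :=
  exist (fun x => x \in std_simplex R 0) (const_mx 1) pt0_subproof.

Lemma simplex0_unique (x : std_simplex R 0) : x = pt0.
Proof. by apply: val_inj; rewrite [LHS]simplex0P. Qed.

Definition point_simplex X (p : X) : singular R 0 X := cst p.

Lemma singular0E X (s : singular R 0 X) : s = point_simplex (s pt0).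
Proof. by apply/continuousEP => x; rewrite /= (simplex0_unique x). Qed.

Lemma face_mapE k (i : 'I_k.+2) (x : std_simplex R k) j :
  set_val (face_map R k i x) ord0 j = oapp (set_val x ord0) 0 (unlift i j).
Proof. by rewrite -[set_val _]/(face_lin i (set_val x)) face_lin_row mxE. Qed.

Lemma face_map_lift k (i : 'I_k.+2) (x : std_simplex R k) j j' : j = lift i j' ->
  set_val (face_map R k i x) ord0 j = set_val x ord0 j'.
Proof. by move=> ->; rewrite face_mapE liftK. Qed.

Lemma face_map_omit k (i : 'I_k.+2) (x : std_simplex R k) :
  set_val (face_map R k i x) ord0 i = 0.
Proof. by rewrite face_mapE unlift_none. Qed.

Lemma boundary_seg X (f : R -> X) (cf : continuous f) :
  boundary (simplex_chain (seg cf)) =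
  simplex_chain (point_simplex (f 1)) - simplex_chain (point_simplex (f 0)).
Proof.
rewrite boundary_simplex !big_ord_recl big_ord0 addr0 expr0 expr1 scale1r scaleN1r.
congr (simplex_chain _ - simplex_chain _); rewrite [LHS]singular0E; congr point_simplex;
  rewrite /= segE; congr f.
  by rewrite (@face_map_lift _ _ _ _ ord0) ?mxE //; exact: val_inj.
exact: face_map_omit.
Qed.

Lemma bounds_square X (h : R * R -> X) (ch : continuous h)
  (b r t l : R -> X) (cb : continuous b) (cr : continuous r) (ct : continuous t)
  (cl : continuous l) :
  (forall u, 0 <= u <= 1 -> b u = h (u, 0)) ->
  (forall u, 0 <= u <= 1 -> r u = h (1, u)) ->
  (forall u, 0 <= u <= 1 -> t u = h (u, 1)) ->
  (forall u, 0 <= u <= 1 -> l u = h (0, u)) ->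
  bounds (simplex_chain (seg cb) + simplex_chain (seg cr)
          - simplex_chain (seg ct) - simplex_chain (seg cl)).
Proof.
move=> eb er et el.
pose i1 : 'I_3 := lift ord0 ord0; pose i2 : 'I_3 := lift ord0 (lift ord0 ord0).
have c1 := @coord_continuous R 1 3 ord0 i1.
have c2 := @coord_continuous R 1 3 ord0 i2.
(* The triangles (0,0), (1,0), (1,1) and (0,0), (0,1), (1,1); their common diagonal cancels. *)
pose T1 := coord_simplex (cont_comp2 (cont_add c1 c2) c2 ch).
pose T2 := coord_simplex (cont_comp2 c2 (cont_add c1 c2) ch).
have cd : continuous (fun u : R => h (u, u)).
  exact: (cont_comp2 (@cont_id _) (@cont_id _) ch).
exists (simplex_chain T1 - simplex_chain T2).
rewrite boundaryB !boundary_simplex !big_ord_recl !big_ord0 !addr0.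
rewrite !expr0 !expr1 expr2 mulrNN mulr1 !scale1r !scaleN1r.
have F (s : singular R 1 X) (f : R -> X) (cf : continuous f) :
  (forall x : std_simplex R 1, s x = f (set_val x ord0 (lift ord0 ord0))) ->
  s = seg cf by move=> e; apply/continuousEP => x; rewrite e segE.
pose j1 : 'I_2 := lift ord0 ord0.
have E1 i x : simplex_face i T1 x = h (set_val (face_map R 1 i x) ord0 i1 +
    set_val (face_map R 1 i x) ord0 i2, set_val (face_map R 1 i x) ord0 i2) by [].
have E2 i x : simplex_face i T2 x = h (set_val (face_map R 1 i x) ord0 i2,
    set_val (face_map R 1 i x) ord0 i1 + set_val (face_map R 1 i x) ord0 i2) by [].
have V0 x : set_val (face_map R 1 ord0 x) ord0 i1 = set_val x ord0 ord0 /\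
    set_val (face_map R 1 ord0 x) ord0 i2 = set_val x ord0 j1.
  by split; apply: face_map_lift; exact: val_inj.
have V1 x : set_val (face_map R 1 i1 x) ord0 i1 = 0 /\
    set_val (face_map R 1 i1 x) ord0 i2 = set_val x ord0 j1.
  by split; [exact: face_map_omit|apply: face_map_lift; exact: val_inj].
have V2 x : set_val (face_map R 1 i2 x) ord0 i1 = set_val x ord0 j1 /\
    set_val (face_map R 1 i2 x) ord0 i2 = 0.
  by split; [apply: face_map_lift; exact: val_inj|exact: face_map_omit].
rewrite -/i1 -/i2 (F (simplex_face ord0 T1) _ cr) => [|x]; last first.
  by have [xi xe] := simplex1P x; rewrite E1 (V0 x).1 (V0 x).2 xe subrK er.
rewrite (F (simplex_face i1 T1) _ cd) => [|x]; last by rewrite E1 (V1 x).1 (V1 x).2 add0r.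
rewrite (F (simplex_face i2 T1) _ cb) => [|x]; last first.
  by have [xi xe] := simplex1P x; rewrite E1 (V2 x).1 (V2 x).2 addr0 eb.
rewrite (F (simplex_face ord0 T2) _ ct) => [|x]; last first.
  by have [xi xe] := simplex1P x; rewrite E2 (V0 x).1 (V0 x).2 xe subrK et.
rewrite (F (simplex_face i1 T2) _ cd) => [|x]; last by rewrite E2 (V1 x).1 (V1 x).2 add0r.
rewrite (F (simplex_face i2 T2) _ cl) => [|x]; last first.
  by have [xi xe] := simplex1P x; rewrite E2 (V2 x).1 (V2 x).2 addr0 el.
set D := simplex_chain (seg cd).
by rewrite addrCA (addrCA (simplex_chain (seg ct))) (addrC (- D)) addrKA opprD
  addrA (addrC (simplex_chain (seg cr))).
Qed.

(** The three faces of a constant 2-simplex coincide, and their alternating sum is one copy. *)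
Lemma bounds_cst X (x : X) (cx : continuous (fun _ : R => x)) :
  bounds (simplex_chain (seg cx)).
Proof.
exists (simplex_chain (cst x : singular R 2 X)).
rewrite boundary_simplex !big_ord_recl !big_ord0 !addr0.
have F i : simplex_face i (cst x : singular R 2 X) = seg cx by exact/continuousEP.
by rewrite !F expr0 expr1 expr2 mulrNN mulr1 scaleN1r scale1r addNr addr0.
Qed.

(* Paths are given by functions defined on all of [R], of which only the values
   on [[0, 1]] matter; the junk value 0 of a discontinuous function is never
   used. *)
Definition path_chain X (f : R -> X) : chain R 1 X :=
  if pselect (continuous f) is left cf then simplex_chain (seg cf) else 0.

Lemma path_chainE X (f : R -> X) (cf : continuous f) :
  path_chain f = simplex_chain (seg cf).
Proof.
rewrite /path_chain; case: pselect => // cf'; congr simplex_chain.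
exact: eq_seg.
Qed.

Lemma eq_path_chain X (f g : R -> X) : continuous f -> continuous g ->
  (forall t, 0 <= t <= 1 -> f t = g t) -> path_chain f = path_chain g.
Proof.
by move=> cf cg fg; rewrite (path_chainE cf) (path_chainE cg) (eq_seg cf cg).
Qed.

Lemma simplex_path_chain X (s : singular R 1 X) :
  simplex_chain s = path_chain (path_fun s).
Proof. by rewrite (path_chainE (@path_fun_continuous X s)) seg_path_fun. Qed.

Lemma boundary_path_chain X (f : R -> X) : continuous f ->
  boundary (path_chain f) =
  simplex_chain (point_simplex (f 1)) - simplex_chain (point_simplex (f 0)).
Proof. by move=> cf; rewrite (path_chainE cf) boundary_seg. Qed.

Lemma push_path_chain X Y (f : continuousType X Y) (g : R -> X) :
  continuous g -> push_chain f (path_chain g) = path_chain (fun t => f (g t)).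
Proof.
move=> cg; have cfg := cont_comp cg (@cts_fun _ _ f).
rewrite (path_chainE cg) (path_chainE cfg) push_simplex; congr simplex_chain.
exact/continuousEP.
Qed.

Lemma path_chain_square X (h : R * R -> X) : continuous h ->
  bounds (path_chain (fun u => h (u, 0)) + path_chain (fun u => h (1, u))
          - path_chain (fun u => h (u, 1)) - path_chain (fun u => h (0, u))).
Proof.
move=> ch.
have cl (x : R) : continuous (fun u => h (u, x)).
  exact: (cont_comp2 (@cont_id _) (@cont_cst _ _ x) ch).
have cr (x : R) : continuous (fun u => h (x, u)).
  exact: (cont_comp2 (@cont_cst _ _ x) (@cont_id _) ch).
rewrite (path_chainE (cl 0)) (path_chainE (cr 1)) (path_chainE (cl 1)) (path_chainE (cr 0)).
exact: (bounds_square ch).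
Qed.

Lemma path_chain_cst X (x : X) : bounds (path_chain (fun=> x)).
Proof. by rewrite (path_chainE (@cont_cst _ _ x)); exact: bounds_cst. Qed.

Definition segment_fun (a b u : R) : R := a + (b - a) * u.

Lemma segment_fun_continuous a b : continuous (segment_fun a b).
Proof.
by apply: cont_add; [exact: cont_cst|apply: cont_mul; [exact: cont_cst|exact: cont_id]].
Qed.

Lemma path_chain_concat X (f : R -> X) a b c : continuous f ->
  bounds (path_chain (f \o segment_fun a b) + path_chain (f \o segment_fun b c)
          - path_chain (f \o segment_fun a c)).
Proof.
move=> cf.
have cs x y : continuous (f \o segment_fun x y).
  exact: (cont_comp (@segment_fun_continuous x y) cf).
(* The left side of this square is constant; the bottom, right and top sides run along f from a to
   b, from b to c and from a to c. *)
pose h (p : R * R) := f (a + p.1 * ((b - a) + (c - b) * p.2)).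
have ch : continuous h.
  apply: cont_comp cf; apply: cont_add; first exact: cont_cst.
  apply: cont_mul; first exact: cont_fst.
  apply: cont_add; first exact: cont_cst.
  by apply: cont_mul; [exact: cont_cst|exact: cont_snd].
have := boundsD (path_chain_square ch) (path_chain_cst (f a)).
have -> : (fun u => h (u, 0)) = f \o segment_fun a b.
  by apply/funext => u; rewrite /h /segment_fun /=; congr f; ring.
have -> : (fun u => h (1, u)) = f \o segment_fun b c.
  by apply/funext => u; rewrite /h /segment_fun /=; congr f; ring.
have -> : (fun u => h (u, 1)) = f \o segment_fun a c.
  by apply/funext => u; rewrite /h /segment_fun /=; congr f; ring.
have -> : (fun u => h (0, u)) = fun=> f a.
  by apply/funext => u; rewrite /h /=; congr f; ring.
by rewrite subrK.
Qed.

End Paths.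

(** Each class is open, and so is its complement, a union of classes. Applied to the parameter line
    of a path, this replaces subdivision by a Lebesgue number. *)
Lemma connected_rel (T : topologicalType) (E : T -> T -> Prop) :
  connected [set: T] -> (forall x, E x x) -> (forall x y, E x y -> E y x) ->
  (forall x y z, E x y -> E y z -> E x z) ->
  (forall x, \forall y \near x, E x y) -> forall x y, E x y.
Proof.
move=> cT Er Es Et En x y.
have O z : open [set y | E z y].
  rewrite openE => w /= zw; apply: filterS (En w) => v wv.
  exact: Et wv.
suff e : [set y | E x y] = setT by rewrite -[E x y]/([set y | E x y] y) e.
apply: cT; first by exists x; exact: Er.
  by exists [set y | E x y]; rewrite ?setTI.
exists [set y | E x y]; rewrite ?setTI //.
rewrite -openC openE => w /= xw; apply: filterS (En w) => v wv xv.
by apply: xw; apply: Et xv _; exact: Es.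
Qed.

(** * Charts of the mapping torus *)

Lemma continuous_near_eq (X Y : topologicalType) (f g : X -> Y) (x : X) :
  (\forall y \near x, f y = g y) -> {for x, continuous g} -> {for x, continuous f}.
Proof.
move=> fg cg W; rewrite (nbhs_singleton fg) => nW.
have h : nbhs x (g @^-1` W) := cg W nW.
have FF : Filter (nbhs x) by exact: nbhs_filter.
by apply: (filterS2 _ _ fg h) => y e; rewrite /= e.
Qed.

Section Torus.
Variables (R : realType) (X : topologicalType) (phi psi : continuousType X X).
Hypotheses (phiK : cancel phi psi) (psiK : cancel psi phi).

Local Notation M := (mapping_torus R X phi).
Local Notation cyl := (cylinder R X).

Definition unit_itv (t : R) : set_type (`[0, 1]%classic : set R) :=
  exist (fun x => x \in (`[0, 1]%classic : set R)) (clamp t)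
    (mem_set (clamp_itv t : `[0, 1]%classic (clamp t))).

Lemma unit_itv_continuous : continuous unit_itv.
Proof. by apply: continuous_comp_initial; exact: clamp_continuous. Qed.

Lemma set_val_itv (t : set_type (`[0, 1]%classic : set R)) : 0 <= set_val t <= 1.
Proof. by have := set_valP t; rewrite /= in_itv. Qed.

Lemma unit_itvK (t : set_type (`[0, 1]%classic : set R)) : unit_itv (set_val t) = t.
Proof. by apply: val_inj => /=; rewrite clamp_id // set_val_itv. Qed.

Lemma set_val_unit_itv t : set_val (unit_itv t) = clamp t.
Proof. by []. Qed.

Lemma set_val_itv_continuous :
  continuous (fun p : cyl => set_val p.2 : R).
Proof. exact: (cont_comp (@cont_snd _ _) (@initial_continuous _ _ set_val)). Qed.

Definition torus_pi (p : cyl) : M := \pi_M p.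

Lemma torus_pi_continuous : continuous torus_pi.
Proof. exact: pi_continuous. Qed.

Lemma torus_pi_surj (m : M) : torus_pi (repr m) = m.
Proof. by rewrite /torus_pi reprK. Qed.

Lemma torus_pi_glued (p q : cyl) : glued phi p q -> torus_pi p = torus_pi q.
Proof.
move=> pq; apply/eqmodP/asboolP; exact: Relation_Operators.rst_step.
Qed.

(** Allows functions on the torus to be defined through the arbitrary representative [repr]:
    compatibility with one gluing step propagates to the generated equivalence. *)
Lemma torus_descend (Z : Type) (F : cyl -> Z) :
  (forall p q, glued phi p q -> F p = F q) ->
  forall p, F (repr (torus_pi p)) = F p.
Proof.
move=> Fg p; have : torus_pi (repr (torus_pi p)) = torus_pi p by rewrite torus_pi_surj.
move: (repr _) => r /eqmodP/asboolP; elim=> // x y z _ h1 _ h2.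
by rewrite h1.
Qed.

Definition level (x : X) (t : R) : M := torus_pi (x, unit_itv t).

Lemma level_continuous2 : continuous (fun p : X * R => level p.1 p.2).
Proof.
apply: cont_comp torus_pi_continuous.
by apply: cont_pair; [exact: cont_fst|exact: (cont_comp (@cont_snd _ _) unit_itv_continuous)].
Qed.

Lemma level1 x : level x 1 = level (phi x) 0.
Proof.
by apply: torus_pi_glued; split=> //; rewrite set_val_unit_itv clamp_id // ?lexx ler01.
Qed.

Lemma torus_pi_level p : torus_pi p = level p.1 (set_val p.2).
Proof. by case: p => x t; rewrite /level /= unit_itvK. Qed.

(* The cyclic cover of [M] restricted to heights in [-1, 1]. *)
Definition unroll (p : X * R) : M :=
  if 0 <= p.2 then level p.1 p.2 else level (psi p.1) (1 + p.2).

Lemma unroll_continuous : continuous unroll.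
Proof.
have c1 := level_continuous2.
have c2 : continuous (fun p : X * R => level (psi p.1) (1 + p.2)).
  have cp : continuous (fun p : X * R => psi p.1).
    by move=> p; apply: (@cont_comp _ _ _ _ _ (@cont_fst X R) (@cts_fun _ _ psi)).
  have ca : continuous (fun p : X * R => 1 + p.2).
    by apply: cont_add; [exact: cont_cst|exact: cont_snd].
  exact: (cont_comp2 cp ca c1).
move=> [x t]; have [t0|t0|t0] := ltgtP t 0.
- apply: continuous_near_eq (c2 (x, t)).
  have := @cont_snd X R (x, t) [set u | u < 0] (open_nbhs_nbhs (conj (@open_lt R 0) t0)).
  by move=> h; apply: (@filterS _ (nbhs (x, t)) _ _ _ _ h) => p /= p0; rewrite /unroll leNgt p0.
- apply: continuous_near_eq (c1 (x, t)).
  have := @cont_snd X R (x, t) [set u | 0 < u] (open_nbhs_nbhs (conj (@open_gt R 0) t0)).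
  by move=> h; apply: (@filterS _ (nbhs (x, t)) _ _ _ _ h) => p /= p0; rewrite /unroll ltW.
(* At height 0 both formulas give the same point, as height 1 over [psi x] is glued to height 0 over
   x; hence W pulls back to a neighborhood under each. *)
move=> W; rewrite {1}/unroll /= t0 lexx /= => nW.
have h1 : nbhs (x, 0 : R) [set p : X * R | W (level p.1 p.2)] := c1 (x, 0) W nW.
have h2 : nbhs (x, 0 : R) [set p : X * R | W (level (psi p.1) (1 + p.2))].
  by apply: (c2 (x, 0) W); rewrite /= addr0 level1 psiK.
have FF : Filter (nbhs (x, 0 : R)) by exact: nbhs_filter.
by apply: (filterS2 _ _ h1 h2) => p p1 p2; rewrite /= /unroll; case: ifP.
Qed.

Section Charts.
Variable a : R.
Hypotheses (a0 : 0 < a) (a1 : a <= 1).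

(* The representative of a point whose height lies in [[a - 1, a[]. *)
Definition chart_cyl (p : cyl) : X * R :=
  if set_val p.2 < a then (p.1, set_val p.2) else (phi p.1, set_val p.2 - 1).

Definition chart (m : M) : X * R := chart_cyl (repr m).

Lemma chartE p : chart (torus_pi p) = chart_cyl p.
Proof.
apply: torus_descend => {p} p q [p1 q0 e].
by rewrite /chart_cyl p1 q0 a0 ltNge a1 /= e subrr.
Qed.

Lemma unroll_chart m : unroll (chart m) = m.
Proof.
rewrite -(torus_pi_surj m) chartE; move: (repr m) => p.
rewrite torus_pi_level /chart_cyl.
have /andP[p0 p1] := set_val_itv p.2.
case: ifP => pa; rewrite /unroll /= ?p0 //.
have [->|pn1] := eqVneq (set_val p.2) 1; first by rewrite subrr lexx level1.
rewrite leNgt ltrBlDr add0r lt_neqAle pn1 p1 /= phiK.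
by rewrite addrC subrK.
Qed.

(** The chart jumps at height a. The value a - 1 is a height only for a = 1, where it removes height
    0, which is glued to height 1. *)
Definition chart_dom (m : M) : Prop :=
  set_val (repr m).2 <> a /\ set_val (repr m).2 <> a - 1.

Lemma chart_dom_pi p :
  chart_dom (torus_pi p) = (set_val p.2 <> a /\ set_val p.2 <> a - 1).
Proof.
apply: (torus_descend (F := fun p => set_val p.2 <> a /\ set_val p.2 <> a - 1)).
move=> {}p q [-> -> _]; apply/propext; split => -[h1 h2]; split=> e.
- by move: a0; rewrite -e ltxx.
- by apply: h1; lra.
- by apply: h2; lra.
- by move: a1; rewrite (_ : a = 2) ?ler_nat //; lra.
Qed.

Lemma near_level_neq (p : cyl) b : set_val p.2 <> b -> \forall q \near p, set_val q.2 <> b.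
Proof.
move=> pn; have := @set_val_itv_continuous p [set u | u != b].
have oo : open [set u : R | u != b] by exact: open_neq.
move=> /(_ (open_nbhs_nbhs (conj oo (introN eqP pn)))) h.
by apply: (@filterS _ (nbhs p) _ _ _ _ h) => q /= /eqP.
Qed.

Lemma chart_dom_open m : chart_dom m -> nbhs m chart_dom.
Proof.
move=> mD; rewrite nbhsE; exists chart_dom => //; split=> //.
rewrite /open /= /quotient_open.
have -> : \pi_M @^-1` chart_dom =
  [set p : cyl | set_val p.2 <> a /\ set_val p.2 <> a - 1].
  by apply/seteqP; split=> p /=; rewrite -[\pi_M p]/(torus_pi p) chart_dom_pi.
rewrite openE => p /= [pa pb].
by apply: (filterS2 _ _ (near_level_neq pa) (near_level_neq pb)).
Qed.

Lemma chart_continuous m : chart_dom m -> {for m, continuous chart}.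
Proof.
have C p : set_val p.2 <> a -> {for p, continuous chart_cyl}.
  move=> pa; have [lt|gt|] // := ltgtP (set_val p.2) a.
    have c2 : continuous (fun p : cyl => (p.1, set_val p.2 : R)).
      by apply: cont_pair; [exact: cont_fst|exact: set_val_itv_continuous].
    apply: (continuous_near_eq _ (c2 p)).
    have := @set_val_itv_continuous p [set u | u < a] (open_nbhs_nbhs (conj (@open_lt R a) lt)).
    by move=> h; apply: (@filterS _ (nbhs p) _ _ _ _ h) => q /= ql; rewrite /chart_cyl ql.
  have c2 : continuous (fun p : cyl => (phi p.1, set_val p.2 - 1)).
    have cp : continuous (fun p : cyl => phi p.1).
      exact: (cont_comp (@cont_fst _ _) (@cts_fun _ _ phi)).
    apply: cont_pair => //.
    by apply: cont_add; [exact: set_val_itv_continuous|exact: cont_cst].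
  apply: (continuous_near_eq _ (c2 p)).
  have := @set_val_itv_continuous p [set u | a < u] (open_nbhs_nbhs (conj (@open_gt R a) gt)).
  by move=> h; apply: (@filterS _ (nbhs p) _ _ _ _ h) => q /= ql; rewrite /chart_cyl ltNge ltW.
move=> mD W; rewrite nbhsE => -[B [oB Bm] BW].
suff : nbhs m (chart @^-1` W) by [].
rewrite nbhsE.
exists [set m' | chart_dom m' /\ B (chart m')]; last by move=> m' [_ /BW].
split=> //.
rewrite /open /= /quotient_open.
have -> : \pi_M @^-1` [set m' | chart_dom m' /\ B (chart m')] =
  [set p : cyl | (set_val p.2 <> a /\ set_val p.2 <> a - 1) /\ B (chart_cyl p)].
  by apply/seteqP; split=> p /=; rewrite -[\pi_M p]/(torus_pi p) chart_dom_pi chartE.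
rewrite openE => p /= [[pa pb] Bp].
have h := C p pa B (open_nbhs_nbhs (conj oB Bp)).
by apply: (filterS3 _ _ (near_level_neq pa) (near_level_neq pb) h) => q qa qb qB; split.
Qed.

End Charts.

End Torus.

(** * First homology of the mapping torus *)

Section BoundarySquared.
Variables (R : realType) (X : topologicalType).

Lemma face_lin_delta k (i : 'I_k.+2) (j : 'I_k.+1) :
  face_lin i (delta_mx ord0 j : 'rV[R]_k.+1) = delta_mx ord0 (lift i j).
Proof.
rewrite face_lin_row; apply/rowP => l; rewrite !mxE eqxx /=.
case: unliftP => [l' ->|->] /=; first by rewrite mxE eqxx /= (inj_eq lift_inj).
by rewrite (negbTE (neq_lift _ _)).
Qed.

Lemma pt0_delta : set_val (pt0 R) = delta_mx ord0 ord0.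
Proof. by rewrite simplex0P; apply/rowP => i; rewrite !mxE (ord1 i) !eqxx. Qed.

Lemma boundary_boundary (c : chain R 2 X) : boundary (boundary c) = 0.
Proof.
move: c; apply: freeg_ind_add => [|a s c ih].
  by rewrite -(scale0r 0) !boundaryZ !scale0r.
rewrite !boundaryD !boundaryZ ih addr0 -/(simplex_chain s).
rewrite boundary_simplex !big_ord_recl !big_ord0 !addr0.
rewrite !expr0 !expr1 expr2 mulrNN mulr1 scaleN1r !scale1r.
rewrite boundaryD addrC -scaleN1r boundaryD boundaryZ !boundary_simplex.
rewrite !big_ord_recl !big_ord0 !addr0 !expr0 !expr1 !scaleN1r !scale1r.
have V (i : 'I_3) (j : 'I_2) : simplex_face j (simplex_face i s) =
    point_simplex R (s (face_map R 1 i (face_map R 0 j (pt0 R)))).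
  by rewrite [LHS]singular0E.
(* The vertex that survives two omissions is [lift i (lift j ord0)], so the six terms match in
   pairs. *)
have E (i i' : 'I_3) (j j' : 'I_2) : lift i (lift j ord0) = lift i' (lift j' ord0) ->
    face_map R 1 i (face_map R 0 j (pt0 R)) = face_map R 1 i' (face_map R 0 j' (pt0 R)).
  move=> e; apply: val_inj.
  rewrite -[LHS]/(face_lin i (face_lin j (set_val (pt0 R)))).
  rewrite -[RHS]/(face_lin i' (face_lin j' (set_val (pt0 R)))).
  by rewrite pt0_delta !face_lin_delta e.
rewrite !V (E (lift ord0 ord0) ord0 ord0 ord0); last exact: val_inj.
rewrite (E (lift ord0 (lift ord0 ord0)) ord0 ord0 (lift ord0 ord0)); last exact: val_inj.
rewrite (E (lift ord0 (lift ord0 ord0)) (lift ord0 ord0) (lift ord0 ord0) (lift ord0 ord0)); last exact: val_inj.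
set p := simplex_chain _; set q := simplex_chain _; set r := simplex_chain _.
by rewrite opprB (addrC (q - p)) subrKA subrKA subrr scaler0.
Qed.

End BoundarySquared.

Section MappingTorusHomology.
Variables (R : realType) (X : topologicalType) (phi psi : continuousType X X).
Hypotheses (phiK : cancel phi psi) (psiK : cancel psi phi).
Variable x0 : X.

Local Notation M := (mapping_torus R X phi).
Local Notation level := (@level R X phi).
Local Notation unroll := (@unroll R X phi psi).
Local Notation chart := (@chart R X phi).


Lemma level0_continuous : continuous (fun x : X => level x 0).
Proof.
exact: (cont_comp2 (@cont_id _) (@cont_cst _ _ (0 : R)) (@level_continuous2 R X phi)).
Qed.

Definition fiber_incl : continuousType X M := mkcts level0_continuous.

Lemma level_path_continuous x : continuous (fun u : R => level x u).
Proof.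
exact: (cont_comp2 (@cont_cst _ _ x) (@cont_id _) (@level_continuous2 R X phi)).
Qed.

Definition flow_path (x : X) : chain R 1 M := path_chain (fun u => level x u).

(** Neither c nor b has to be a cycle, so that the notion applies to single paths; [fiber_cycle]
    recovers the cycle condition on b. *)
Definition fiber_class (c : chain R 1 M) :=
  exists b : chain R 1 X, bounds (c - push_chain fiber_incl b).

Definition fiber_flow_class (c : chain R 1 M) :=
  exists n : int, fiber_class (c - n *: flow_path x0).

Lemma push_chain0 (Y : topologicalType) k (f : continuousType X Y) : push_chain f (0 : chain R k X) = 0.
Proof. exact: fglift0. Qed.

Lemma fiber_class_bounds c : bounds c -> fiber_class c.
Proof. by exists 0; rewrite push_chain0 subr0. Qed.

Lemma fiber_class_push b : fiber_class (push_chain fiber_incl b).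
Proof. by exists b; rewrite subrr; exact: bounds0. Qed.

Lemma fiber_classZ a c : fiber_class c -> fiber_class (a *: c).
Proof.
move=> [b h]; exists (a *: b); rewrite push_chainZ -scalerBr; exact: boundsZ.
Qed.

Lemma fiber_classD c d : fiber_class c -> fiber_class d -> fiber_class (c + d).
Proof.
move=> [b h] [b' h']; exists (b + b'); rewrite push_chainD opprD addrACA.
exact: boundsD.
Qed.

Lemma fiber_classN c : fiber_class c -> fiber_class (- c).
Proof. by rewrite -scaleN1r; exact: fiber_classZ. Qed.

Lemma fiber_classB c d : fiber_class c -> fiber_class d -> fiber_class (c - d).
Proof. by move=> ? ?; apply: fiber_classD => //; exact: fiber_classN. Qed.

Lemma fiber_flowZ a c : fiber_flow_class c -> fiber_flow_class (a *: c).
Proof.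
by move=> [n h]; exists (a * n); rewrite -scalerA -scalerBr; exact: fiber_classZ.
Qed.

Lemma fiber_flowD c d :
  fiber_flow_class c -> fiber_flow_class d -> fiber_flow_class (c + d).
Proof.
move=> [n h] [n' h']; exists (n + n'); rewrite scalerDl opprD addrACA.
exact: fiber_classD.
Qed.

Lemma fiber_flowB c d :
  fiber_flow_class c -> fiber_flow_class d -> fiber_flow_class (c - d).
Proof.
by rewrite -(scaleN1r d) => ? ?; apply: fiber_flowD => //; exact: fiber_flowZ.
Qed.

Lemma fiber_flow_fiber c : fiber_class c -> fiber_flow_class c.
Proof. by exists 0; rewrite scale0r subr0. Qed.

(** The square swept by f during one turn of the flow: f at the bottom, [phi] composed with f on top
    by the gluing, and flow lines as sides. *)
Lemma flow_path_square (f : R -> X) : continuous f ->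
  bounds (push_chain fiber_incl (path_chain f) + flow_path (f 1)
    - push_chain fiber_incl (path_chain (fun t => phi (f t))) - flow_path (f 0)).
Proof.
move=> cf.
have cpf : continuous (fun t => phi (f t)) := cont_comp cf (@cts_fun _ _ phi).
pose h (p : R * R) := level (f p.1) p.2.
have ch : continuous h.
  exact: (cont_comp2 (cont_comp (@cont_fst _ _) cf) (@cont_snd _ _) (@level_continuous2 R X phi)).
have := path_chain_square ch; rewrite !push_path_chain //.
have -> // : (fun u => h (u, 1)) = (fun t => fiber_incl (phi (f t))).
by apply/funext => u; rewrite /h level1.
Qed.

Lemma flow_path_continuous_path (f : R -> X) : continuous f ->
  fiber_class (flow_path (f 1) - flow_path (f 0)).
Proof.
move=> cf; exists (path_chain (fun t => phi (f t)) - path_chain f).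
rewrite push_chainB.
have := flow_path_square cf; congr bounds.
by rewrite opprB [RHS]addrC addrACA addrA.
Qed.

Hypothesis X_connected : connected [set: X].
Hypothesis X_euclidean : locally_euclidean2 R X.

Lemma flow_path_connected x y : fiber_class (flow_path y - flow_path x).
Proof.
move: x y; apply: connected_rel => //.
- by move=> x; rewrite subrr; apply: fiber_class_bounds; exact: bounds0.
- by move=> x y h; rewrite -opprB; exact: fiber_classN.
- move=> x y z h1 h2; have := fiber_classD h2 h1; congr fiber_class.
  by rewrite subrKA.
move=> x; have [U [f [h [[oU Ux] oV fK cf ch]]]] := X_euclidean x.
have cfx : {for x, continuous f}.
  by move: cf; rewrite continuous_open_subspace // => /(_ x (mem_set Ux)).
have nV : nbhs (f x) (f @` U) by apply: open_nbhs_nbhs; split=> //; exists x.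
have /nbhs_ballP [r r0 rV] := nV.
have nB : nbhs x (f @^-1` ball (f x) r) by apply: cfx; exact: nbhsx_ballx.
have nU : nbhs x U by exact: open_nbhs_nbhs.
near=> y.
have yU : U y by near: y.
have yB : ball (f x) r (f y) by near: y.
(* A straight segment in the chart; clamping keeps it in the ball for every t. *)
pose p (t : R) := h (f x + clamp t *: (f y - f x)).
have pB t : (f @` U) (f x + clamp t *: (f y - f x)).
  apply: rV; move: yB; rewrite -!ball_normE /= opprD addNKr normrN normrZ => yB.
  have /andP[c0 c1] := clamp_itv t.
  rewrite ger0_norm // -normrN opprB in yB *.
  by apply: le_lt_trans yB; apply: ler_piMl.
have cp : continuous p.
  move=> t; apply: (@continuous_comp _ _ _ (fun t => f x + clamp t *: (f y - f x)) h).
    apply: continuousD; first exact: cst_continuous.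
    by apply: continuousZr_tmp; exact: clamp_continuous.
  by move: ch; rewrite continuous_open_subspace // => /(_ _ (mem_set (pB t))).
have := flow_path_continuous_path cp.
rewrite /p !clamp_id ?lexx ?ler01 // scale1r scale0r addr0 (addrC (f x)) subrK !fK //; exact: mem_set.
Unshelve. all: by end_near.
Qed.


Lemma fiber_flow_flow x : fiber_flow_class (flow_path x).
Proof. by exists 1; rewrite scale1r; exact: flow_path_connected. Qed.

Lemma unroll_path_continuous (y : X) (t : R) :
  continuous (fun u : R => unroll (y, u * t)).
Proof.
have c2 : continuous (fun u : R => u * t).
  by apply: cont_mul; [exact: cont_id|exact: cont_cst].
exact: (cont_comp2 (@cont_cst _ _ y) c2 (unroll_continuous psiK)).
Qed.

(* Slides a point of [M] along the flow to the fiber at height 0. *)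
Definition drop_path (a : R) (m : M) : chain R 1 M :=
  path_chain (fun u => unroll ((chart a m).1, u * (chart a m).2)).

(** The two charts differ only at heights in [a, 1[. There one path reaches the point from height 1,
    the other from height 0, and the difference is a full flow line. *)
Lemma drop_path_change a m : 0 < a -> a <= 1 ->
  fiber_flow_class (drop_path a m - drop_path 1 m).
Proof.
move=> a0 a1; rewrite -(torus_pi_surj m); move: (repr m) => p.
have /andP[p0 p1] := set_val_itv p.2.
have sub0 : fiber_flow_class 0.
  by apply: fiber_flow_fiber; apply: fiber_class_bounds; exact: bounds0.
rewrite /drop_path !chartE // /chart_cyl.
have [pa|pa] := ltP (set_val p.2) a.
  by rewrite (lt_le_trans pa a1) subrr.
have [pl|pl] := ltP (set_val p.2) 1; last by rewrite subrr.
set t := set_val p.2 in p0 p1 pa pl *; set x := p.1.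
have cl : continuous (fun u : R => level x u) by exact: level_path_continuous.
have -> : path_chain (fun u => unroll (x, u * t)) = path_chain ((fun u => level x u) \o segment_fun 0 t).
  apply: eq_path_chain; first exact: unroll_path_continuous.
    exact: (cont_comp (@segment_fun_continuous _ 0 t) cl).
  move=> u /andP[u0 u1]; rewrite /unroll /= mulr_ge0 // /segment_fun; congr level; ring.
have -> : path_chain (fun u => unroll (phi x, u * (t - 1))) = path_chain ((fun u => level x u) \o segment_fun 1 t).
  apply: eq_path_chain; first exact: unroll_path_continuous.
    exact: (cont_comp (@segment_fun_continuous _ 1 t) cl).
  move=> u /andP[u0 u1]; rewrite /unroll /segment_fun /= phiK mulrC.
  case: ifP => // h; have -> : (t - 1) * u = 0 by nra.
  by rewrite addr0 level1.
have := path_chain_concat 0 1 t cl.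
have -> : path_chain ((fun u => level x u) \o segment_fun 0 1) = flow_path x.
  apply: eq_path_chain => //; first exact: (cont_comp (@segment_fun_continuous _ 0 1) cl).
  by move=> u _; rewrite /= /segment_fun; congr level; ring.
rewrite -addrA => h; rewrite -[_ - _](addKr (flow_path x)) addrC.
apply: fiber_flowB; last exact: fiber_flow_flow.
by apply: fiber_flow_fiber; exact: fiber_class_bounds.
Qed.

(** The piece of f from b to c, extended by the drop paths of its ends so that it starts and ends in
    the fiber at height 0. *)
Definition path_defect (f : R -> M) (b c : R) : chain R 1 M :=
  path_chain (f \o segment_fun b c) - (drop_path 1 (f c) - drop_path 1 (f b)).

Lemma path_defect_local (f : R -> M) b : continuous f ->
  \forall c \near b, fiber_flow_class (path_defect f b c).
Proof.
move=> cf.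
have [a a0 [a1 fa]] : exists2 a : R, 0 < a & a <= 1 /\ chart_dom a (f b).
  (* The value a = 1 fails only when f b has height 0 or 1, and such heights are in the domain for a
     = 1/2. *)
  case: (pselect (chart_dom 1 (f b))) => [h|h]; first by exists 1.
  exists (2^-1); first by lra.
  split; first by lra.
  move: h; rewrite /chart_dom subrr => h.
  have /andP[h0 h1] := set_val_itv (repr (f b)).2.
  by split=> e; [apply: h; rewrite e; split; lra|lra].
have nD : \forall c \near b, chart_dom a (f c).
  exact: (cf b) (chart_dom_open a0 a1 fa).
have /nbhs_ballP [r r0 rD] := nD.
have : \forall c \near b, ball b r c by exact: nbhsx_ballx.
apply: filterS => c cB.
have sB u : ball b r (segment_fun b c (clamp u)).
  move: cB; rewrite -!ball_normE /= /segment_fun opprD addNKr normrN normrM => cB.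
  have /andP[c0 c1] := clamp_itv u; rewrite (ger0_norm c0) distrC.
  by apply: le_lt_trans cB; apply: ler_piMr.
have cg : continuous (fun u => chart a (f (segment_fun b c (clamp u)))).
  move=> u; apply: (@continuous_comp _ _ _ (fun u => f (segment_fun b c (clamp u))) (chart a)).
    exact: (cont_comp (cont_comp (@clamp_continuous R) (@segment_fun_continuous _ b c)) cf).
  by apply: chart_continuous => //; exact: rD.
(* The short path slides down inside one chart: its top side is f, its bottom side lies in the
   fiber, and its vertical sides are drop paths. *)
pose h (p : R * R) := unroll ((chart a (f (segment_fun b c (clamp p.1)))).1,
   p.2 * (chart a (f (segment_fun b c (clamp p.1)))).2).
have ch : continuous h.
  have c1 := cont_comp (@cont_fst R R) cg.
  have c2 := cont_comp c1 (@cont_fst _ _).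
  have c3 := cont_mul (@cont_snd R R) (cont_comp c1 (@cont_snd _ _)).
  exact: (cont_comp2 c2 c3 (unroll_continuous psiK)).
have := path_chain_square ch.
have cf' := cont_comp (@segment_fun_continuous R b c) cf.
have cc x : continuous (fun u : R => h (u, x)).
  exact: (cont_comp2 (@cont_id _) (@cont_cst _ _ x) ch).
have -> : path_chain (fun u => h (u, 1)) = path_chain (f \o segment_fun b c).
  apply: eq_path_chain => // u u01.
  by rewrite /h /= mul1r -surjective_pairing unroll_chart // clamp_id.
have cb : continuous (fun u => (chart a (f (segment_fun b c (clamp u)))).1).
  exact: (cont_comp cg (@cont_fst _ _)).
have -> : path_chain (fun u => h (u, 0)) =
    push_chain fiber_incl (path_chain (fun u => (chart a (f (segment_fun b c (clamp u)))).1)).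
  rewrite push_path_chain //; congr path_chain; apply/funext => u.
  by rewrite /h /= mul0r /unroll /= lexx.
have -> : path_chain (fun u => h (1, u)) = drop_path a (f c).
  rewrite /h /= clamp_id ?lexx ?ler01 // /segment_fun mulr1 addrC subrK //.
have -> : path_chain (fun u => h (0, u)) = drop_path a (f b).
  by rewrite /h /= clamp_id ?lexx ?ler01 // /segment_fun mulr0 addr0.
set S := push_chain _ _; set P := path_chain (f \o _) => B.
have h1 := fiber_flow_fiber (fiber_classB (fiber_class_push (path_chain
  (fun u => (chart a (f (segment_fun b c (clamp u)))).1))) (fiber_class_bounds B)).
have h2 := fiber_flowB (drop_path_change (f c) a0 a1) (drop_path_change (f b) a0 a1).
have := fiber_flowD h1 h2; rewrite -/S; congr fiber_flow_class.
rewrite /path_defect -/P.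
set Dc := drop_path a (f c); set Db := drop_path a (f b).
have -> : S + Dc - P - Db = S + (Dc - (P + Db)) by rewrite opprD !addrA.
rewrite (opprD S) (addrA S) subrr sub0r (opprB Dc) (opprB Db) (opprB (drop_path 1 _)).
by rewrite -(addrA Dc) subrKA -(addrA P); congr (P + _); rewrite addrA addrC subrKA.
Qed.

Lemma path_defect_concat (f : R -> M) b c d : continuous f ->
  fiber_flow_class (path_defect f b c + path_defect f c d - path_defect f b d).
Proof.
move=> cf; apply: fiber_flow_fiber; apply: fiber_class_bounds.
have := path_chain_concat b c d cf; congr bounds; rewrite /path_defect.
rewrite addrACA -opprD (addrC (drop_path 1 (f c) - _)) subrKA.
by rewrite (opprB (path_chain (f \o segment_fun b d))) subrKA.
Qed.

(** Having a defect of this class is an equivalence relation on parameters, with open classes by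
    [path_defect_local], so connectedness of the line relates 0 to 1. *)
Lemma path_flow_class (f : R -> M) : continuous f ->
  fiber_flow_class (path_chain f - (drop_path 1 (f 1) - drop_path 1 (f 0))).
Proof.
move=> cf.
have E0 b : fiber_flow_class (path_defect f b b).
  apply: fiber_flow_fiber; apply: fiber_class_bounds; rewrite /path_defect subrr subr0.
  have -> : f \o segment_fun b b = fun=> f b.
    by apply/funext => u; rewrite /= /segment_fun subrr mul0r addr0.
  exact: path_chain_cst.
have Et b c d : fiber_flow_class (path_defect f b c) ->
    fiber_flow_class (path_defect f c d) -> fiber_flow_class (path_defect f b d).
  move=> h1 h2; have := fiber_flowB (fiber_flowD h1 h2) (path_defect_concat b c d cf).
  by rewrite opprB addrC subrK.
have cR : connected [set: R] by apply/connected_intervalP => x y _ _ z.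
have := connected_rel cR E0 _ Et (fun b => path_defect_local b cf) 0 1.
rewrite /path_defect (_ : f \o segment_fun 0 1 = f); last first.
  by apply/funext => u; rewrite /= /segment_fun subr0 mul1r add0r.
apply => b c h.
have := fiber_flowB (fiber_flowB (path_defect_concat b c b cf) h) (fiber_flowZ (-1) (E0 b)).
rewrite scaleN1r opprK (addrAC _ (- path_defect f b b)) subrK.
by rewrite addrAC subrr add0r.
Qed.

Definition drop_points (c : chain R 0 M) : chain R 1 M :=
  fglift (fun s : singular R 0 M => drop_path 1 (s (pt0 R))) c.

Lemma chain_flow_class (c : chain R 1 M) :
  fiber_flow_class (c - drop_points (boundary c)).
Proof.
move: c; apply: freeg_ind_add => [|a s c ih].
  rewrite boundary0 /drop_points [fglift _ _]fglift0 subr0.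
  by apply: fiber_flow_fiber; apply: fiber_class_bounds; exact: bounds0.
rewrite boundaryD boundaryZ /drop_points fgliftD fgliftZ opprD addrACA -scalerBr.
apply: fiber_flowD ih; apply: fiber_flowZ.
rewrite -/(simplex_chain s) simplex_path_chain.
have cs := @path_fun_continuous _ _ s.
have := path_flow_class cs; congr (fiber_flow_class (_ - _)).
by rewrite boundary_path_chain // fgliftB !fglift_simplex.
Qed.

(** Projection of points to the fiber. Its discontinuity is harmless on 0-chains, where it inverts
    the inclusion of the fiber. *)
Definition fiber_points (c : chain R 0 M) : chain R 0 X :=
  fglift (fun s : singular R 0 M => simplex_chain (point_simplex R (chart 1 (s (pt0 R))).1)) c.

Lemma fiber_points_incl (c : chain R 0 X) :
  fiber_points (push_chain fiber_incl c) = c.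
Proof.
move: c; apply: freeg_ind_add => [|a s c ih].
  by rewrite push_chain0; exact: fglift0.
have L b d d' : fiber_points (b *: d + d') = b *: fiber_points d + fiber_points d'.
  by rewrite /fiber_points fgliftD fgliftZ.
rewrite push_chainD push_chainZ L ih.
rewrite -/(simplex_chain s) push_simplex /fiber_points fglift_simplex.
congr (_ *: simplex_chain _ + _); rewrite [RHS]singular0E; congr point_simplex.
have e : chart 1 (level (s (pt0 R)) 0) = (s (pt0 R), 0).
  rewrite chartE // /chart_cyl.
  by rewrite set_val_unit_itv clamp_id ?lexx ?ler01 // ltr01.
exact: (congr1 fst e).
Qed.

Lemma cycle_fiber_class (z : chain R 1 M) : is_cycle z ->
  exists (n : int) (b : chain R 1 X),
    bounds (z - n *: flow_path x0 - push_chain fiber_incl b).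
Proof.
move=> zc; have [n [b h]] := chain_flow_class z; exists n, b.
by move: h; rewrite zc /drop_points fglift0 subr0.
Qed.

(** The boundary of b vanishes once included in the torus, and the inclusion is injective on
    0-chains. *)
Lemma fiber_cycle (z : chain R 1 M) (b : chain R 1 X) : is_cycle z ->
  bounds (z - push_chain fiber_incl b) -> is_cycle b.
Proof.
move=> zc [d /(congr1 (@boundary R M 0))]; rewrite boundary_boundary boundaryB zc sub0r.
move=> /eqP; rewrite eq_sym oppr_eq0 boundary_push => /eqP/(congr1 fiber_points).
by rewrite fiber_points_incl /is_cycle => ->; exact: fglift0.
Qed.

Definition flow_points (c : chain R 0 X) : chain R 1 M :=
  fglift (fun s : singular R 0 X => flow_path (s (pt0 R))) c.

Lemma fiber_incl_flow (c : chain R 1 X) :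
  bounds (push_chain fiber_incl c - push_chain fiber_incl (push_chain phi c)
          + flow_points (boundary c)).
Proof.
move: c; apply: freeg_ind_add => [|a s c ih].
  rewrite !push_chain0 boundary0 /flow_points [fglift _ _]fglift0 subr0 addr0.
  exact: bounds0.
rewrite !push_chainD !push_chainZ boundaryD boundaryZ /flow_points fgliftD fgliftZ.
rewrite opprD [X in X + _]addrACA -scalerBr addrACA -scalerDr; apply: boundsD ih; apply: boundsZ.
have cs := @path_fun_continuous _ _ s.
have := flow_path_square cs; congr bounds.
rewrite -/(simplex_chain s) simplex_path_chain boundary_path_chain // fgliftB !fglift_simplex.
by rewrite [push_chain phi _]push_path_chain // addrACA addrA.
Qed.

Variables (m : nat) (e : 'I_m -> chain R 1 X) (A : 'M[int]_m).
Hypothesis e_basis : homology1_basis e.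
Hypothesis phiA : forall j, homologous (push_chain phi (e j)) (\sum_i A i j *: e i).

(** In the torus the classes of the e i solve a homogeneous linear system with matrix A - 1;
    multiplying by the adjugate isolates each of them. *)
Lemma monodromy_relation k :
  bounds (\det (A - 1%:M) *: push_chain fiber_incl (e k)).
Proof.
have [ec _] := e_basis.
pose E j := push_chain fiber_incl (e j).
have rel j : bounds (\sum_i (A - 1%:M) i j *: E i).
  have h1 := bounds_push fiber_incl (phiA j).
  have h2 := fiber_incl_flow (e j).
  rewrite (ec j) /flow_points fglift0 addr0 in h2.
  have := boundsZ (-1) (boundsD h1 h2); congr bounds.
  rewrite push_chainB addrC subrKA scaleN1r opprB.
  rewrite [push_chain fiber_incl (\sum_i _)]fglift_sum.
  rewrite [in LHS](eq_bigr (fun i => A i j *: E i)) => [|i _]; last exact: fgliftZ.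
  rewrite [RHS](eq_bigr (fun i => A i j *: E i - (i == j)%:R *: E i)) => [|i _]; last first.
    by rewrite !mxE scalerDl scaleNr.
  rewrite big_split /= sumrN; congr (_ - _).
  rewrite (bigD1 j) //= eqxx scale1r big1 ?addr0 // => i /negbTE ->.
  by rewrite scale0r.
have : bounds (\sum_j (\adj (A - 1%:M)) j k *: \sum_i (A - 1%:M) i j *: E i).
  by elim/big_ind: _ => [|? ? ? ?|j _]; [exact: bounds0|exact: boundsD|exact: boundsZ].
congr bounds.
under eq_bigr do rewrite scaler_sumr.
rewrite exchange_big /= (bigD1 k) //= [X in _ + X]big1 ?addr0 => [|i ik].
  rewrite -/(E k); under eq_bigr do rewrite scalerA mulrC.
  rewrite -scaler_suml; congr (_ *: _).
  by have := congr1 (fun B : 'M[int]_m => B k k) (mul_mx_adj (A - 1%:M)); rewrite !mxE eqxx mulr1n.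
under eq_bigr do rewrite scalerA mulrC.
rewrite -scaler_suml.
have := congr1 (fun B : 'M[int]_m => B i k) (mul_mx_adj (A - 1%:M)).
by rewrite !mxE (negbTE ik) mulr0n => ->; rewrite scale0r.
Qed.

Lemma fiber_cycle_torsion (z : chain R 1 M) (b : chain R 1 X) : is_cycle z ->
  bounds (z - push_chain fiber_incl b) -> bounds (\det (A - 1%:M) *: z).
Proof.
move=> zc zb; have bc := fiber_cycle zc zb.
have [_ /(_ b bc) [a [ab _]]] := e_basis.
have h1 := boundsZ (\det (A - 1%:M)) zb.
have h2 := boundsZ (\det (A - 1%:M)) (bounds_push fiber_incl ab).
have h3 : bounds (\det (A - 1%:M) *: push_chain fiber_incl (\sum_i a i *: e i)).
  rewrite [push_chain _ _]fglift_sum scaler_sumr.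
  elim/big_ind: _ => [|? ? ? ?|j _]; [exact: bounds0|exact: boundsD|].
  rewrite fgliftZ scalerA mulrC -scalerA; apply: boundsZ; exact: monodromy_relation.
have := boundsD (boundsD h1 h2) h3; congr bounds.
by rewrite push_chainB -!scalerDr subrKA subrK.
Qed.

Lemma betti1_mapping_torus_le1 :
  \det (A - 1%:M) != 0 -> (betti1 R M <= 1)%E.
Proof.
move=> D0; apply: ub_ereal_sup => _ [n [z [zc zfree]] <-].
rewrite lee_fin (ler_nat R n 1) leqNgt; apply/negP => n1.
pose i0 := Ordinal (ltn_trans (ltn0Sn 0) n1); pose i1 := Ordinal n1.
have i01 : i1 != i0 by [].
have [n0 [b0 h0]] := cycle_fiber_class (zc i0).
have [m1 [b1 h1]] := cycle_fiber_class (zc i1).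
set D := \det (A - 1%:M) in D0.
have cyZ a c : is_cycle c -> is_cycle (a *: c : chain R 1 M).
  by rewrite /is_cycle boundaryZ => ->; rewrite scaler0.
(* The combination m1 z0 - n0 z1 no longer contains the flow line, hence is killed by D; when n0 =
   0, already z0 is. *)
have [a a0 B] : exists2 a : int * int, (a != 0) & bounds (a.1 *: z i0 + a.2 *: z i1).
  have [n00|n00] := eqVneq n0 0.
    exists (D, 0); first by rewrite xpair_eqE negb_and D0.
    rewrite /= scale0r addr0; apply: (@fiber_cycle_torsion _ b0); first exact: zc.
    by move: h0; rewrite n00 scale0r subr0.
  exists (D * m1, - (D * n0)).
    by rewrite xpair_eqE negb_and oppr_eq0 (mulf_neq0 D0 n00) orbT.
  rewrite /= -mulrN -!scalerA -scalerDr.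
  apply: (@fiber_cycle_torsion _ (m1 *: b0 - n0 *: b1)).
    have zc' i : boundary (z i) = 0 := zc i.
    by rewrite /is_cycle boundaryD !boundaryZ !zc' !scaler0 addr0.
  have := boundsB (boundsZ m1 h0) (boundsZ n0 h1); congr bounds.
  rewrite push_chainB !push_chainZ !scalerBr !scalerA (mulrC n0) scaleNr.
  rewrite [X in X - _](addrAC (m1 *: z i0)).
  rewrite [X in _ - X](addrAC (n0 *: z i1)).
  set P0 := push_chain _ _; set P1 := push_chain _ _.
  rewrite (opprB (n0 *: z i1 - n0 *: P1)) subrKA (opprB (n0 *: z i1)) (opprB (m1 *: P0)).
  by rewrite (addrC (n0 *: P1) (- (m1 *: P0))) [RHS]addrACA (addrC (- (n0 *: z i1))).
pose c i : int := if i == i0 then a.1 else if i == i1 then a.2 else 0.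
have := zfree c; have -> : \sum_i c i *: z i = a.1 *: z i0 + a.2 *: z i1.
  rewrite (bigD1 i0) //= (bigD1 i1) //= [X in _ + (_ + X)]big1 ?addr0 => [|i].
    by rewrite /c eqxx (negbTE i01) eqxx.
  by rewrite /c => /andP[/negbTE -> /negbTE ->]; rewrite scale0r.
rewrite /homologous subr0 => /(_ B) c0.
move: a0; rewrite [a]surjective_pairing xpair_eqE negb_and.
have := c0 i0; rewrite /c eqxx => ->.
by have := c0 i1; rewrite /c (negbTE i01) eqxx => ->; rewrite eqxx.
Qed.

End MappingTorusHomology.

(** * Transvections *)

Lemma Sp_unit (K : comUnitRingType) (g : nat) (A : 'M[K]_(g + g)) :
  Sp K g A -> A \in unitmx.
Proof.
move=> hA; have JJ : symplectic_form K g *m symplectic_form K g = - 1%:M.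
  rewrite /symplectic_form mulmx_block !mulmx0 !mul0mx !mulmx1 !mul1mx.
  by rewrite !addr0 !add0r (scalar_mx_block g g 1) opp_block_mx !oppr0.
have : (- symplectic_form K g *m A^T *m symplectic_form K g) *m A = 1%:M.
  by rewrite -!mulmxA (mulmxA A^T) hA mulNmx JJ opprK.
by case/mulmx1_unit.
Qed.

Section Transvections.
Variables (K : fieldType) (g : nat).
Local Notation n := (g + g)%N.
Local Notation J := (symplectic_form K g).

Lemma symplectic_form_tr : J^T = - J.
Proof.
rewrite /symplectic_form tr_block_mx !trmx0 linearN /= !trmx1.
by rewrite opp_block_mx !oppr0 opprK.
Qed.

Definition omega (x y : 'cV[K]_n) : K := (x^T *m J *m y) ord0 ord0.

Lemma omegaE x y : x^T *m J *m y = (omega x y)%:M.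
Proof. by apply/matrixP => i j; rewrite !ord1 [RHS]mxE eqxx mulr1n. Qed.

Lemma omegaDl x y z : omega (x + y) z = omega x z + omega y z.
Proof. by rewrite /omega linearD /= !mulmxDl mxE. Qed.

Lemma omegaDr x y z : omega z (x + y) = omega z x + omega z y.
Proof. by rewrite /omega mulmxDr mxE. Qed.

Lemma omegaZr a x y : omega x (a *: y) = a * omega x y.
Proof. by rewrite /omega -scalemxAr mxE. Qed.

Lemma omegaC x y : omega x y = - omega y x.
Proof.
have e : (y^T *m J *m x)^T = - (x^T *m J *m y).
  by rewrite !trmx_mul trmxK symplectic_form_tr mulNmx mulmxN mulmxA.
have := congr1 (fun M : 'M[K]_1 => M ord0 ord0) e; rewrite mxE => e'.
by rewrite /omega e' [in RHS]mxE opprK.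
Qed.

Hypothesis char2 : 2%:R != 0 :> K.

Lemma omegaxx x : omega x x = 0.
Proof.
have /eqP := omegaC x x; rewrite -subr_eq0 opprK -mulr2n -mulr_natr mulf_eq0 (negbTE char2) orbF.
by move/eqP.
Qed.

Lemma omegaNl x y : omega (- x) y = - omega x y.
Proof. by rewrite /omega linearN /= !mulNmx mxE. Qed.

Lemma omega_Sp A x y : Sp K g A -> omega (A *m x) (A *m y) = omega x y.
Proof.
by move=> hA; rewrite /omega trmx_mul !mulmxA -(mulmxA x^T) -(mulmxA x^T) hA.
Qed.

Definition transv (v : 'cV[K]_n) (t : K) : 'M[K]_n := 1%:M + t *: (v *m v^T *m J).

Lemma transvE v t x : transv v t *m x = x + (t * omega v x) *: v.
Proof.
rewrite /transv mulmxDl mul1mx -scalemxAl -!mulmxA (mulmxA v^T) omegaE.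
by rewrite mul_mx_scalar scalerA.
Qed.

Lemma mulmx_eq_cV (A B : 'M[K]_n) : (forall x : 'cV_n, A *m x = B *m x) -> A = B.
Proof.
move=> h; apply/trmx_inj/row_matrixP => i; apply: trmx_inj; rewrite -!tr_col !trmxK.
by have := h (delta_mx i ord0); rewrite -!colE.
Qed.

Lemma transvD v s t : transv v s *m transv v t = transv v (s + t).
Proof.
apply: mulmx_eq_cV => x; rewrite -mulmxA !transvE omegaDr omegaZr omegaxx mulr0 addr0.
by rewrite -addrA -scalerDl (addrC (t * _)) -mulrDl.
Qed.

Lemma transv0 v : transv v 0 = 1%:M.
Proof. by rewrite /transv scale0r addr0. Qed.

Lemma SpP A : (forall x y, omega (A *m x) (A *m y) = omega x y) -> Sp K g A.
Proof.
move=> h; rewrite /Sp /=; apply: mulmx_eq_cV => y; apply/colP => i.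
have := h (delta_mx i ord0) y; rewrite /omega trmx_mul -!mulmxA.
by rewrite !trmx_delta -!rowE [LHS]mxE [RHS]mxE !mulmxA.
Qed.

Lemma transv_Sp v t : Sp K g (transv v t).
Proof.
apply: SpP => x y; rewrite !transvE !omegaDl !omegaDr !omegaZr.
have Zl a z w : omega (a *: z) w = a * omega z w.
  by rewrite omegaC omegaZr -mulrN -omegaC.
rewrite !Zl ?omegaZr omegaxx !mulr0 addr0 (omegaC x v).
by ring.
Qed.

Lemma Sp1 : Sp K g 1%:M.
Proof. by rewrite /Sp /= trmx1 mul1mx mulmx1. Qed.

Lemma SpM A B : Sp K g A -> Sp K g B -> Sp K g (A *m B).
Proof. by move=> hA hB; apply: SpP => x y; rewrite -!mulmxA !omega_Sp. Qed.

Lemma SpV A : Sp K g A -> Sp K g (invmx A).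
Proof.
move=> hA; apply: SpP => x y.
by rewrite -(omega_Sp _ _ hA) !mulKVmx ?Sp_unit.
Qed.

Lemma transv_conj A v t : Sp K g A -> A *m transv v t *m invmx A = transv (A *m v) t.
Proof.
move=> hA; apply: mulmx_eq_cV => x; rewrite -!mulmxA !transvE mulmxDr mulKVmx ?Sp_unit //.
by rewrite -scalemxAr -(omega_Sp v _ hA) mulKVmx ?Sp_unit.
Qed.

Inductive transv_prod : 'M[K]_n -> Prop :=
| TransvProd1 : transv_prod 1%:M
| TransvProdM v t A : transv_prod A -> transv_prod (transv v t *m A).

Lemma transv_prodM A B : transv_prod A -> transv_prod B -> transv_prod (A *m B).
Proof.
by move=> + hB; elim=> [|v t A' _ ih]; rewrite ?mul1mx // -mulmxA; exact: TransvProdM.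
Qed.

Lemma transv_prodT v t : transv_prod (transv v t).
Proof. by rewrite -[transv v t]mulmx1; do 2!constructor. Qed.

Lemma transv_prod_Sp A : transv_prod A -> Sp K g A.
Proof. by elim=> [|v t B _ hB]; [exact: Sp1|apply: SpM => //; exact: transv_Sp]. Qed.

Lemma transv_prodV A : transv_prod A -> transv_prod (invmx A).
Proof.
elim=> [|v t B hB ih]; first by rewrite invmx1; constructor.
have -> : invmx (transv v t *m B) = invmx B *m transv v (- t).
  have U : transv v t *m B \in unitmx by apply: Sp_unit; apply: transv_prod_Sp; constructor.
  apply: (can_inj (mulKmx U)); rewrite mulmxV // -!mulmxA mulKVmx ?transvD ?subrr ?transv0 //.
  exact/Sp_unit/transv_prod_Sp.
by apply: transv_prodM => //; exact: transv_prodT.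
Qed.

(* A product of transvections along vectors orthogonal to [P] fixes [P]. *)
Lemma transv_move (P : 'cV[K]_n -> Prop) x y :
  (forall p, P p -> omega x p = omega y p) ->
  omega x y != 0 ->
  exists2 B, transv_prod B & B *m x = y /\ (forall p, P p -> B *m p = p).
Proof.
move=> hP xy; exists (transv (x - y) (- (omega x y)^-1)); first exact: transv_prodT.
split=> [|p Pp].
  rewrite transvE omegaDl omegaxx add0r omegaNl -(omegaC x y) mulNr mulVf //.
  by rewrite scaleN1r opprB addrC subrK.
by rewrite transvE omegaDl omegaNl (hP p Pp) subrr mulr0 scale0r addr0.
Qed.

(** The detour through z serves when x and y are orthogonal, where no single transvection of
    [transv_move] is available. *)
Lemma transv_move2 (P : 'cV[K]_n -> Prop) x y z :
  (forall p, P p -> omega x p = omega z p) ->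
  (forall p, P p -> omega z p = omega y p) ->
  omega x z != 0 -> omega z y != 0 ->
  exists2 B, transv_prod B & B *m x = y /\ (forall p, P p -> B *m p = p).
Proof.
move=> xP yP xz zy.
have [B hB [Bx BP]] := transv_move xP xz.
have [C hC [Cz CP]] := transv_move yP zy.
exists (C *m B); first exact: transv_prodM.
split=> [|p Pp]; first by rewrite -mulmxA Bx.
by rewrite -mulmxA BP // CP.
Qed.

Definition evec (i : 'I_g) : 'cV[K]_n := delta_mx (lshift g i) ord0.
Definition fvec (i : 'I_g) : 'cV[K]_n := delta_mx (rshift g i) ord0.

Lemma omega_delta (i : 'I_n) (x : 'cV[K]_n) :
  omega (delta_mx i ord0) x = (J *m x) i ord0.
Proof. by rewrite /omega trmx_delta -mulmxA -rowE mxE. Qed.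

Lemma omega_evec i x : omega (evec i) x = x (rshift g i) ord0.
Proof.
rewrite omega_delta -{1}[x]vsubmxK /symplectic_form mul_block_col mul0mx mul1mx add0r.
by rewrite col_mxEu mxE.
Qed.

Lemma omega_fvec i x : omega (fvec i) x = - x (lshift g i) ord0.
Proof.
rewrite omega_delta -{1}[x]vsubmxK /symplectic_form mul_block_col !mul0mx addr0 mulNmx !mul1mx.
by rewrite col_mxEd !mxE.
Qed.

Lemma omega_ef i j : omega (evec i) (fvec j) = (i == j)%:R.
Proof. by rewrite omega_evec mxE eqxx andbT (inj_eq (@rshift_inj _ _)). Qed.

Lemma omega_ee i j : omega (evec i) (evec j) = 0.
Proof. by rewrite omega_evec mxE eqxx andbT eq_rlshift. Qed.

Lemma omega_ff i j : omega (fvec i) (fvec j) = 0.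
Proof. by rewrite omega_fvec mxE eqxx andbT eq_lrshift oppr0. Qed.

Definition pairs (k : nat) (p : 'cV[K]_n) : Prop :=
  exists2 i : 'I_g, (i < k)%N & p = evec i \/ p = fvec i.

Lemma orth_nonzero k x : x != 0 -> (forall p, pairs k p -> omega x p = 0) ->
  exists2 z, (forall p, pairs k p -> omega z p = 0) & omega x z != 0.
Proof.
move=> x0 xP.
have [i xi] : exists i, x i ord0 != 0.
  by apply/existsP; apply: contraNT x0; rewrite negb_exists => /forallP h;
     apply/eqP/colP => i; rewrite mxE; apply/eqP; have := h i; rewrite negbK.
case: (split_ordP i) xi => j -> xj.
  have jk : (k <= j)%N.
    rewrite leqNgt; apply/negP => jk; move: xj.
    have : omega x (fvec j) = 0 by apply: xP; exists j => //; right.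
    by rewrite omegaC omega_fvec opprK => ->; rewrite eqxx.
  exists (fvec j); last by rewrite omegaC omega_fvec opprK.
  move=> p [i' i'k [] ->]; last exact: omega_ff.
  rewrite omegaC omega_ef; case: eqP => [e|]; last by rewrite oppr0.
  by move: i'k; rewrite e ltnNge jk.
have jk : (k <= j)%N.
  rewrite leqNgt; apply/negP => jk; move: xj.
  have : omega x (evec j) = 0 by apply: xP; exists j => //; left.
  by rewrite omegaC omega_evec => /eqP; rewrite oppr_eq0 => ->.
exists (evec j); last by rewrite omegaC omega_evec oppr_eq0.
move=> p [i' i'k [] ->]; first exact: omega_ee.
rewrite omega_ef; case: eqP => [e|//].
by move: i'k; rewrite -e ltnNge jk.
Qed.

Lemma transv_transitive k x y : x != 0 -> y != 0 ->
  (forall p, pairs k p -> omega x p = 0) -> (forall p, pairs k p -> omega y p = 0) ->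
  exists2 B, transv_prod B & B *m x = y /\ (forall p, pairs k p -> B *m p = p).
Proof.
move=> x0 y0 xP yP.
have [z1 z1P xz1] := orth_nonzero x0 xP.
have [z2 z2P yz2] := orth_nonzero y0 yP.
(* Two nonzero linear forms have a common non-zero among z1, z2 and z1 + z2. *)
have [z zP [xz yz]] : exists2 z, (forall p, pairs k p -> omega z p = 0) &
    omega x z != 0 /\ omega y z != 0.
  have [yz1|yz1] := eqVneq (omega y z1) 0; last by exists z1.
  have [xz2|xz2] := eqVneq (omega x z2) 0; last by exists z2.
  exists (z1 + z2); first by move=> p Pp; rewrite omegaDl z1P // z2P // addr0.
  by rewrite !omegaDr yz1 xz2 addr0 add0r.
apply: (@transv_move2 _ x y z) => //.
- by move=> p Pp; rewrite xP // zP.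
- by move=> p Pp; rewrite yP // zP.
- by rewrite omegaC oppr_eq0.
Qed.

(** Induction on the number of hyperbolic pairs not yet fixed: B brings A e_i back to e_i, then C
    brings the image y of f_i to f_i while fixing e_i, and both respect the pairs already fixed. *)
Theorem Sp_transv_prod A : Sp K g A -> transv_prod A.
Proof.
suff H k : (k <= g)%N -> forall A, Sp K g A -> (forall p, pairs (g - k) p -> A *m p = p) ->
    transv_prod A.
  by move=> hA; apply: (H g (leqnn _)) => // p []; rewrite subnn.
elim: k => [|k ih] kg {}A hA AP.
  rewrite subn0 in AP.
  suff -> : A = 1%:M by constructor.
  apply: trmx_inj; apply/row_matrixP => i; apply: trmx_inj; rewrite -!tr_col !trmxK !colE mul1mx.
  by apply: AP; case: (split_ordP i) => j ->; exists j => //; [left|right].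
pose l := (g - k.+1)%N.
have lg : (l < g)%N by rewrite /l; lia.
pose i := Ordinal lg.
have lS : (g - k = l.+1)%N by rewrite /l; lia.
have P0 v : (v = evec i \/ v = fvec i) -> forall p, pairs l p -> omega v p = 0.
  move=> hv p [j jl hp]; have ji : j == i = false.
    by apply/eqP => e; move: jl; rewrite e ltnn.
  case: hv hp => -> [] ->; rewrite ?omega_ee ?omega_ff ?omega_ef //.
    by rewrite eq_sym ji.
  by rewrite omegaC omega_ef ji oppr0.
have A0 v : (forall p, pairs l p -> omega v p = 0) -> forall p, pairs l p -> omega (A *m v) p = 0.
  by move=> h p Pp; rewrite -{1}(AP p Pp) omega_Sp // h.
have ei0 : evec i != 0.
  apply/eqP => e; have := omega_ef i i; rewrite e eqxx /omega trmx0 !mul0mx mxE => /eqP.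
  by rewrite eq_sym oner_eq0.
have Aei0 : A *m evec i != 0.
  by apply: contraNneq ei0 => /(congr1 (mulmx (invmx A))); rewrite mulKmx ?Sp_unit // mulmx0 => ->.
have [B hB [Be BP]] := transv_transitive Aei0 ei0 (A0 _ (P0 _ (or_introl erefl))) (P0 _ (or_introl erefl)).
have BSp := transv_prod_Sp hB.
pose y := B *m (A *m fvec i).
have ey : omega (evec i) y = 1 by rewrite /y -Be !omega_Sp // omega_ef eqxx.
have ef : omega (evec i) (fvec i) = 1 by rewrite omega_ef eqxx.
have yP p : pairs l p -> omega y p = 0.
  by move=> Pp; rewrite /y -{1}(BP p Pp) omega_Sp // A0 //; apply: P0; right.
have fP := P0 _ (or_intror erefl).
pose Q p := pairs l p \/ p = evec i.
have [C hC [Cy CQ]] : exists2 C, transv_prod C & C *m y = fvec i /\ (forall p, Q p -> C *m p = p).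
  have [yf|yf] := eqVneq (omega y (fvec i)) 0; last first.
    apply: transv_move => // p [Pp|->]; first by rewrite yP // fP.
    by rewrite omegaC ey [RHS]omegaC ef.
  (* When y and f_i are orthogonal, e_i + y has the same pairing with e_i as they do and is
     orthogonal to neither. *)
  apply: (@transv_move2 _ y (fvec i) (evec i + y)).
  - move=> p [Pp|->]; first by rewrite omegaDl yP // (P0 _ (or_introl erefl)) // addr0.
    by rewrite omegaDl omegaxx add0r.
  - move=> p [Pp|->]; first by rewrite omegaDl yP // (P0 _ (or_introl erefl)) // addr0 fP.
    by rewrite omegaDl omegaxx add0r omegaC ey [RHS]omegaC ef.
  - by rewrite omegaDr omegaxx addr0 omegaC ey oppr_eq0 oner_eq0.
  - by rewrite omegaDl yf addr0 ef oner_eq0.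
have CBA : transv_prod (C *m (B *m A)).
  apply: ih; first by lia.
    by do 2!(apply: SpM => //; try exact: transv_prod_Sp).
  move=> p [j]; rewrite lS ltnS leq_eqVlt -!mulmxA => /orP[/eqP ji|jl] hp.
    have {}ji : j = i by exact: val_inj.
    by case: hp => ->; rewrite ji ?Be; [rewrite CQ //; right|rewrite -/y Cy].
  have Pp : pairs l p by exists j.
  by rewrite AP // BP // CQ //; left.
have -> : A = invmx B *m (invmx C *m (C *m (B *m A))).
  by rewrite !mulKmx // ?Sp_unit //; exact: transv_prod_Sp.
by apply: transv_prodM; [exact: transv_prodV|apply: transv_prodM => //; exact: transv_prodV].
Qed.

(** Conjugation by an A that takes v to 2 v; the transvection is quadratic in v. *)
Lemma transv_scale v t : v != 0 ->
  exists2 A, Sp K g A & A *m transv v t *m invmx A = transv v (4%:R * t).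
Proof.
move=> v0.
have v20 : 2%:R *: v != 0 by rewrite scaler_eq0 negb_or char2.
have P0 (x : 'cV[K]_n) p : pairs 0 p -> omega x p = 0 by case.
have [A hA [Av _]] := transv_transitive v0 v20 (P0 v) (P0 _).
exists A; first exact: transv_prod_Sp.
rewrite transv_conj ?Av; last exact: transv_prod_Sp.
rewrite /transv linearZ /= -!scalemxAl -scalemxAr scalerA -scalemxAl !scalerA.
by congr (_ + _ *: _); ring.
Qed.

End Transvections.

(** * Polynomial functions on Sp *)

Section PolyFun.
Variables (R : comNzRingType) (n : nat).

(** Polynomial functions as a closure property, so that polynomiality of a matrix expression is
    proved by following its formula. *)
Inductive polyfun : ('M[R]_n -> R) -> Prop :=
| PolyfunCst c : polyfun (fun=> c)
| PolyfunCoord i j : polyfun (fun A => A i j)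
| PolyfunD p q : polyfun p -> polyfun q -> polyfun (fun A => p A + q A)
| PolyfunM p q : polyfun p -> polyfun q -> polyfun (fun A => p A * q A).

Lemma polyfun_sum (I : Type) (r : seq I) (P : pred I) (F : I -> 'M[R]_n -> R) :
  (forall i, P i -> polyfun (F i)) -> polyfun (fun A => \sum_(i <- r | P i) F i A).
Proof.
move=> h; elim: r => [|i r ih].
  by rewrite (_ : (fun _ => _) = fun=> 0); [constructor|apply/funext => A; rewrite big_nil].
have [Pi|Pi] := boolP (P i).
  rewrite (_ : (fun _ => _) = fun A => F i A + \sum_(j <- r | P j) F j A).
    by constructor => //; exact: h.
  by apply/funext => A; rewrite big_cons Pi.
rewrite (_ : (fun _ => _) = fun A => \sum_(j <- r | P j) F j A) //.
by apply/funext => A; rewrite big_cons (negbTE Pi).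
Qed.

Lemma polyfun_prod (I : Type) (r : seq I) (F : I -> 'M[R]_n -> R) :
  (forall i, polyfun (F i)) -> polyfun (fun A => \prod_(i <- r) F i A).
Proof.
move=> h; elim: r => [|i r ih].
  by rewrite (_ : (fun _ => _) = fun=> 1); [constructor|apply/funext => A; rewrite big_nil].
rewrite (_ : (fun _ => _) = fun A => F i A * \prod_(j <- r) F j A); first by constructor.
by apply/funext => A; rewrite big_cons.
Qed.

Lemma polyfun_mulmxl k l m (F : 'M[R]_n -> 'M[R]_(l, m)) (B : 'M[R]_(k, l)) :
  (forall i j, polyfun (fun A => F A i j)) ->
  forall i j, polyfun (fun A => (B *m F A) i j).
Proof.
move=> h i j; rewrite (_ : (fun _ => _) = fun A => \sum_k B i k * F A k j).
  by apply: polyfun_sum => a _; constructor => //; constructor.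
by apply/funext => A; rewrite mxE.
Qed.

Lemma polyfun_mulmxr k l m (F : 'M[R]_n -> 'M[R]_(l, m)) (B : 'M[R]_(m, k)) :
  (forall i j, polyfun (fun A => F A i j)) ->
  forall i j, polyfun (fun A => (F A *m B) i j).
Proof.
move=> h i j; rewrite (_ : (fun _ => _) = fun A => \sum_k F A i k * B k j).
  by apply: polyfun_sum => a _; constructor => //; constructor.
by apply/funext => A; rewrite mxE.
Qed.

Definition polycurve k l (M : R -> 'M[R]_(k, l)) :=
  forall i j, exists P : {poly R}, forall t, M t i j = P.[t].

Lemma polyfun_curve p (M : R -> 'M[R]_n) : polyfun p -> polycurve M ->
  exists P : {poly R}, forall t, p (M t) = P.[t].
Proof.
move=> hp hM; elim: hp => [c|i j|{}p q _ [P hP] _ [Q hQ]|{}p q _ [P hP] _ [Q hQ]].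
- by exists c%:P => t; rewrite hornerC.
- exact: hM.
- by exists (P + Q) => t; rewrite hornerD hP hQ.
- by exists (P * Q) => t; rewrite hornerM hP hQ.
Qed.

Lemma polycurve_sum (I : finType) (F : I -> R -> R) :
  (forall i, exists P : {poly R}, forall t, F i t = P.[t]) ->
  exists P : {poly R}, forall t, \sum_i F i t = P.[t].
Proof.
move=> h; elim: (index_enum I) => [|i r [P hP]].
  by exists 0 => t; rewrite big_nil horner0.
have [Q hQ] := h i; exists (Q + P) => t.
by rewrite big_cons hornerD hP hQ.
Qed.

Lemma polycurveM k l m (M : R -> 'M[R]_(k, l)) (N : R -> 'M[R]_(l, m)) :
  polycurve M -> polycurve N -> polycurve (fun t => M t *m N t).
Proof.
move=> hM hN i j.
have [P hP] : exists P : {poly R}, forall t, \sum_a M t i a * N t a j = P.[t].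
  apply: (polycurve_sum (F := fun a t => M t i a * N t a j)) => a.
  have [P hP] := hM i a; have [Q hQ] := hN a j.
  by exists (P * Q) => t; rewrite hornerM hP hQ.
by exists P => t; rewrite mxE.
Qed.

Lemma polycurve_cst k l (A : 'M[R]_(k, l)) : polycurve (fun=> A).
Proof. by move=> i j; exists (A i j)%:P => t; rewrite hornerC. Qed.

End PolyFun.

Lemma transv_polycurve (K : fieldType) (g : nat) (v : 'cV[K]_(g + g)) :
  polycurve (fun t => transv v t).
Proof.
move=> i j; exists ((1%:M i j)%:P + ((v *m v^T *m symplectic_form K g) i j)%:P * 'X) => t.
by rewrite !hornerE !mxE mulrC.
Qed.

Lemma poly_nonroot (R : numFieldType) (P : {poly R}) :
  P != 0 -> exists n : nat, P.[n%:R] != 0.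
Proof.
move=> P0; apply: contrapT => h.
have r : all (root P) [seq i%:R | i <- iota 0 (size P)].
  apply/allP => _ /mapP[i _ ->]; apply/rootP/eqP; rewrite -[_ == _]negbK.
  by apply/negP => hi; apply: h; exists i.
have u : uniq [seq i%:R : R | i <- iota 0 (size P)].
  rewrite map_inj_uniq ?iota_uniq // => i j /eqP; rewrite eqr_nat => /eqP //.
by have := max_poly_roots P0 r u; rewrite size_map size_iota ltnn.
Qed.

Lemma poly_eq_nat (R : numFieldType) (P Q : {poly R}) :
  (forall n : nat, P.[n%:R] = Q.[n%:R]) -> P = Q.
Proof.
move=> h; apply/eqP; rewrite -subr_eq0; apply/negP => /negP /poly_nonroot[n].
by rewrite hornerD hornerN h subrr eqxx.
Qed.

Section Irreducible.
Variables (R : numFieldType) (g : nat).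
Local Notation n := (g + g)%N.

Lemma char2_num : 2%:R != 0 :> R. Proof. by rewrite pnatr_eq0. Qed.

(* Points of [Sp] are joined by chains of transvection curves, along which
   polynomial functions are univariate polynomials. *)
Lemma Sp_irreducible (p q : 'M[R]_n -> R) : polyfun p -> polyfun q ->
  (forall A, Sp R g A -> p A * q A = 0) ->
  (forall A, Sp R g A -> p A = 0) \/ (forall A, Sp R g A -> q A = 0).
Proof.
move=> hp hq pq; apply: contrapT => /not_orP[/existsNP[a /not_implyP[aS pa]] /existsNP[b /not_implyP[bS qb]]].
have {bS} cT : transv_prod (invmx a *m b).
  by apply: Sp_transv_prod; [exact: char2_num|apply: SpM => //; exact: SpV].
have : q (a *m (invmx a *m b)) <> 0 by rewrite mulKVmx ?Sp_unit.
move: (invmx a *m b) cT => c cT {b qb}.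
elim: cT a aS pa => [|v s {}c _ ih] a aS pa qc.
  by move/eqP: (pq a aS); rewrite mulf_eq0 mulmx1 in qc *; move=> /orP[] /eqP.
have ca : polycurve (fun t => a *m transv v t).
  by apply: polycurveM; [exact: polycurve_cst|exact: transv_polycurve].
have [P hP] := polyfun_curve hp ca.
have [Q hQ] := polyfun_curve hq (polycurveM ca (polycurve_cst c)).
have P0 : P != 0.
  by apply/eqP => e; apply: pa; have := hP 0; rewrite transv0 mulmx1 e horner0.
have Q0 : Q != 0.
  by apply/eqP => e; apply: qc; have := hQ s; rewrite e horner0 -mulmxA.
(* At such a parameter m both p (a T) and q (a T c) are nonzero, so a T replaces a and the chain is
   one transvection shorter. *)
have [m] := poly_nonroot (mulf_neq0 P0 Q0); rewrite hornerM mulf_eq0 negb_or -hP -hQ.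
move=> /andP[/eqP h1 /eqP h2]; apply: (ih (a *m transv v m%:R)) => //.
by apply: SpM => //; exact/transv_Sp/char2_num.
Qed.

Lemma Sp_irreducible_prod (I : Type) (r : seq I) (F : I -> 'M[R]_n -> R) :
  (forall i, polyfun (F i)) ->
  (forall A, Sp R g A -> \prod_(i <- r) F i A = 0) ->
  exists i, List.In i r /\ forall A, Sp R g A -> F i A = 0.
Proof.
move=> h; elim: r => [|i r ih] e.
  have := e _ (@Sp1 _ _); rewrite big_nil => /eqP; by rewrite oner_eq0.
have [|h1|h1] := Sp_irreducible (h i) (polyfun_prod r h).
- by move=> A hA; have := e A hA; rewrite big_cons.
- by exists i; split=> //; left.
- by have [j [jr hj]] := ih h1; exists j; split=> //; right.
Qed.

Definition zdense (D : set 'M[R]_n) := forall p, polyfun p ->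
  (forall A, D A -> p A = 0) -> forall A, Sp R g A -> p A = 0.

End Irreducible.

Section ComplexZariski.
Import -(notations) mpoly.

(** A real polynomial function is the restriction of a complex polynomial, and real symplectic
    matrices are complex symplectic. *)
Lemma zariski_dense_zdense (R : realType) (g : nat) (G : set 'M[int]_(g + g)) :
  zariski_dense_in_Sp R G ->
  zdense [set map_mx (fun m : int => m%:~R : R) A | A in G].
Proof.
move=> hG p hp pG.
have [P hP] : exists P : mpoly.mpoly ((g + g) * (g + g)) (complex R), forall A,
    mpoly.meval (mxvec (map_mx (real_complex R) A) ord0) P = real_complex R (p A).
  elim: hp {pG} => [c|i j|{}p q _ [P hP] _ [Q hQ]|{}p q _ [P hP] _ [Q hQ]].
  - by exists (mpoly.mpolyC _ (real_complex R c)) => A; rewrite mpoly.mevalC.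
  - exists (mpoly.mpolyX _ (mpoly.mnm1 (mxvec_index i j))) => A.
    by rewrite mpoly.mevalXU mxvecE mxE.
  - by exists (P + Q) => A; rewrite mpoly.mevalD hP hQ rmorphD.
  - by exists (P * Q) => A; rewrite mpoly.mevalM hP hQ rmorphM.
move=> A hA.
have : Sp (complex R) g (map_mx (real_complex R) A).
  have := congr1 (map_mx (real_complex R)) hA.
  rewrite !map_mxM -map_trmx /Sp /=.
  by rewrite /symplectic_form map_block_mx map_mxN !raddf0 !map_mx1.
move/(hG P) => h; have : real_complex R (p A) = 0.
  rewrite -hP; apply: h => B hB.
  have -> : map_mx (fun m : int => m%:~R) B =
      map_mx (real_complex R) (map_mx (fun m : int => m%:~R) B).
    by apply/matrixP => i j; rewrite !mxE rmorph_int.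
  by rewrite hP pG ?rmorph0 //; exists B.
by move=> [].
Qed.

End ComplexZariski.

(** * Tensor powers and Pluecker coordinates *)

Section TensorPower.
Variable (R : comNzRingType) (r : nat).
Local Notation idx N := {ffun 'I_r -> 'I_N}.

(** The r-th tensor power in the basis of r-tuples. It stands in for the exterior power, which sits
    in it as the antisymmetric vectors. *)
Definition tens p q (A : 'M[R]_(p, q)) : 'M[R]_(#|idx p|, #|idx q|) :=
  \matrix_(a, b) \prod_(k < r) A ((enum_val a : idx p) k) ((enum_val b : idx q) k).

Lemma sum_idx p (F : idx p -> R) :
  \sum_(c < #|idx p|) F (enum_val c) = \sum_f F f.
Proof. by rewrite [RHS](reindex _ (onW_bij _ (@enum_val_bij _))). Qed.

Lemma tensM p q m (A : 'M[R]_(p, q)) (B : 'M[R]_(q, m)) :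
  tens (A *m B) = tens A *m tens B.
Proof.
apply/matrixP => a b; rewrite !mxE.
under eq_bigr do rewrite mxE.
rewrite bigA_distr_bigA /= -sum_idx; apply: eq_bigr => c _.
by rewrite !mxE -big_split.
Qed.

Lemma tens1 p : tens (1%:M : 'M[R]_p) = 1%:M.
Proof.
apply/matrixP => a b; rewrite !mxE; case: eqP => [->|ab].
  by rewrite big1 // => k _; rewrite mxE eqxx.
have [k ak] : exists k, (enum_val a : idx p) k != (enum_val b : idx p) k.
  apply: contrapT => h; apply: ab; apply: enum_val_inj; apply/ffunP => k.
  by apply/eqP; rewrite -[_ == _]negbK; apply/negP => hk; apply: h; exists k.
by rewrite (bigD1 k) //= mxE (negbTE ak) mul0r.
Qed.

Lemma polyfun_tens n p q (F : 'M[R]_n -> 'M[R]_(p, q)) :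
  (forall i j, polyfun (fun A => F A i j)) ->
  forall i j, polyfun (fun A => tens (F A) i j).
Proof.
move=> h i j; rewrite (_ : (fun _ => _) = fun A => \prod_(k < r) F A ((enum_val i : idx p) k) ((enum_val j : idx q) k)).
  exact: (polyfun_prod _ (F := fun k A => F A ((enum_val i : idx p) k) ((enum_val j : idx q) k))).
by apply/funext => A; rewrite mxE.
Qed.

(* The vector of maximal minors, i.e. the Pluecker coordinates of the row space
   of [B], indexed by all (not only increasing) choices of columns. *)
Definition minors N (B : 'M[R]_(r, N)) : 'rV[R]_(#|idx N|) :=
  \row_c \det (colsub (enum_val c : idx N) B).

(** Multilinear expansion of the determinant in its columns. Keeping all tuples, also unsorted ones,
    avoids any factor r!. *)
Lemma minors_mulr N m (B : 'M[R]_(r, N)) (A : 'M[R]_(N, m)) :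
  minors (B *m A) = minors B *m tens A.
Proof.
apply/rowP => c; rewrite !mxE.
transitivity (\sum_(f : idx N) \det (colsub f B) * \prod_k A (f k) ((enum_val c : idx m) k)).
  rewrite /determinant; under [RHS]eq_bigr do rewrite mulr_suml.
  rewrite [RHS]exchange_big /=; apply: eq_bigr => s _.
  under eq_bigr do rewrite !mxE.
  rewrite bigA_distr_bigA /= mulr_sumr.
  rewrite (reindex (fun f : idx N => [ffun k => f (s k)])) /=; last first.
    exists (fun f : idx N => [ffun k => f (s^-1%g k)]) => f _; apply/ffunP => k;
      by rewrite !ffunE ?permK ?permKV.
  apply: eq_bigr => f _; rewrite -mulrA; congr (_ * _).
  under eq_bigr do rewrite ffunE.
  rewrite big_split /=; congr (_ * _); first by apply: eq_bigr => k _; rewrite mxE.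
  by rewrite [RHS](reindex_inj (@perm_inj _ s)).
by rewrite -sum_idx; apply: eq_bigr => f _; rewrite !mxE.
Qed.

Lemma minors_mull N (G : 'M[R]_r) (B : 'M[R]_(r, N)) :
  minors (G *m B) = \det G *: minors B.
Proof.
apply/rowP => c; rewrite !mxE -det_mulmx; congr (\det _).
by apply/matrixP => i j; rewrite !mxE; apply: eq_bigr => k _; rewrite mxE.
Qed.

(** Cramer's rule: every entry of this product is again a maximal minor of B. *)
Lemma adj_colsub N (B : 'M[R]_(r, N)) (c : idx N) i j :
  (\adj (colsub c B) *m B) i j =
  \det (colsub ([ffun k => if k == i then j else c k] : idx N) B).
Proof.
rewrite (expand_det_col _ i) mxE; apply: eq_bigr => k _.
rewrite !mxE ffunE eqxx mulrC; congr (_ * _); rewrite /cofactor; congr (_ * \det _).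
apply/matrixP => a b; rewrite !mxE ffunE.
by rewrite eq_sym (negbTE (neq_lift _ _)).
Qed.

End TensorPower.

Lemma minors_free (F : fieldType) r N (B : 'M[F]_(r, N)) : row_free B ->
  exists c : {ffun 'I_r -> 'I_N}, \det (colsub c B) != 0.
Proof.
move=> Bf; have Bt : row_full B^T by rewrite /row_full mxrank_tr.
exists [ffun k => fullrankfun Bt k].
have := fullrowsub_unit Bt; rewrite unitmxE unitfE -det_tr.
suff -> : colsub [ffun k => fullrankfun Bt k] B = (rowsub (fullrankfun Bt) B^T)^T by [].
by apply/matrixP => i j; rewrite !mxE ffunE.
Qed.

Lemma minors_neq0 (F : fieldType) r N (B : 'M[F]_(r, N)) : row_free B ->
  minors B != 0.
Proof.
move=> /minors_free[c]; apply: contraNneq => /rowP/(_ (enum_rank c)).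
by rewrite !mxE enum_rankK => ->.
Qed.

(** By [adj_colsub] the minors determine the product of B with the adjugate of a maximal square
    block, and B' is recovered from that product. *)
Lemma minors_inj (F : fieldType) r N (B B' : 'M[F]_(r, N)) : row_free B ->
  minors B' = minors B -> (B' <= B)%MS.
Proof.
move=> /minors_free[c c0] e.
have E (f : {ffun 'I_r -> 'I_N}) : \det (colsub f B') = \det (colsub f B).
  by have /rowP/(_ (enum_rank f)) := e; rewrite !mxE enum_rankK.
have adjE : \adj (colsub c B') *m B' = \adj (colsub c B) *m B.
  by apply/matrixP => i j; rewrite !adj_colsub E.
have -> : B' = (\det (colsub c B))^-1 *: (colsub c B' *m \adj (colsub c B)) *m B.
  rewrite -scalemxAl -mulmxA -adjE mulmxA mul_mx_adj mul_scalar_mx E scalerA.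
  by rewrite mulVf // scale1r.
exact: submxMl.
Qed.

(** * Ultralimits and invariant forms *)

Lemma ex_ultra_nat : exists U : set_system nat, UltraFilter U /\ (\oo : set_system nat) `<=` U.
Proof. by apply: ultraFilterLemma. Qed.

Definition ultra_nat : set_system nat := projT1 (cid ex_ultra_nat).

Lemma ultra_nat_ultra : UltraFilter ultra_nat.
Proof. by have [] := projT2 (cid ex_ultra_nat). Qed.

#[global] Instance ultra_nat_proper : ProperFilter ultra_nat.
Proof. exact: (@ultra_proper _ _ ultra_nat_ultra). Qed.

Lemma ultra_nat_oo A : (\oo : set_system nat) A -> ultra_nat A.
Proof. by have [_] := projT2 (cid ex_ultra_nat); apply. Qed.

Section UltraLimit.
Variable R : realType.

Lemma bounded_ultra_cvg (u : nat -> R) K : (forall k, `|u k| <= K) ->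
  exists l : R, u @ ultra_nat --> l.
Proof.
move=> uK.
have PF : ProperFilter (u @ ultra_nat) by exact: fmap_proper_filter.
have uF : (u @ ultra_nat) `[-K, K]%classic.
  by apply: (@filterS _ ultra_nat _ setT); [move=> k _ /=; rewrite in_itv /= -ler_norml|exact: filterT].
have [l [_ lc]] := @segment_compact R (- K) K _ PF uF.
exists l => V lV.
have [//|h] := in_ultra_setVsetC (u @^-1` V) ultra_nat_ultra.
by have [x []] := lc (~` V) V h lV.
Qed.

Lemma ultra_cvg_le (u v : nat -> R) (a b : R) : u @ ultra_nat --> a -> v @ ultra_nat --> b ->
  (forall k, u k <= v k) -> a <= b.
Proof. by move=> ua vb uv; apply: (ler_cvg_to ua vb); exact: nearW. Qed.

Lemma ultra_cvg_unique (u : nat -> R) (a b : R) :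
  u @ ultra_nat --> a -> u @ ultra_nat --> b -> a = b.
Proof.
by move=> ua ub; apply/eqP; rewrite eq_le (ultra_cvg_le ua ub) ?(ultra_cvg_le ub ua).
Qed.

Lemma ultra_cvg_cst (a : R) : (fun=> a) @ ultra_nat --> a.
Proof. exact: cvg_cst. Qed.

Lemma ultra_cvg_invn : (fun k : nat => k.+1%:R^-1 : R) @ ultra_nat --> (0 : R).
Proof.
move=> V /(@cvg_harmonic R V); exact: ultra_nat_oo.
Qed.

Lemma ultra_cvg_polyfun n (p : 'M[R]_n -> R) (M : nat -> 'M[R]_n) (L : 'M[R]_n) :
  polyfun p -> (forall i j, (fun k => M k i j) @ ultra_nat --> L i j) ->
  (fun k => p (M k)) @ ultra_nat --> p L.
Proof.
move=> hp hM; elim: hp => [c|i j|{}p q _ hP _ hQ|{}p q _ hP _ hQ].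
- exact: cvg_cst.
- exact: hM.
- exact: cvgD.
- exact: cvgM.
Qed.

Lemma bounded_ultra_mx n (M : nat -> 'M[R]_n) K :
  (forall k i j, `|M k i j| <= K) ->
  exists L : 'M[R]_n, forall i j, (fun k => M k i j) @ ultra_nat --> L i j.
Proof.
move=> MK.
have h (ij : 'I_n * 'I_n) : exists l : R, (fun k => M k ij.1 ij.2) @ ultra_nat --> l.
  by apply: (@bounded_ultra_cvg _ K) => k.
have [f hf] := choice h.
by exists (\matrix_(i, j) f (i, j)) => i j; rewrite mxE; exact: (hf (i, j)).
Qed.

End UltraLimit.

Section SquareNorm.
Variable R : realFieldType.

(** Squared Hilbert-Schmidt norm; the square keeps it polynomial in the entries. *)
Definition sqn m n (A : 'M[R]_(m, n)) : R := \sum_i \sum_j A i j ^+ 2.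

Lemma sqn_ge0 m n (A : 'M[R]_(m, n)) : 0 <= sqn A.
Proof. by apply: sumr_ge0 => i _; apply: sumr_ge0 => j _; exact: sqr_ge0. Qed.

Lemma sqn_eq0 m n (A : 'M[R]_(m, n)) : sqn A = 0 -> A = 0.
Proof.
move=> h; apply/matrixP => i j; rewrite mxE.
have := @psumr_eq0P _ _ _ _ (fun i _ => sumr_ge0 _ (fun j _ => sqr_ge0 (A i j))) h i isT.
move=> /(psumr_eq0P (fun j _ => sqr_ge0 (A i j)))/(_ j isT)/eqP.
by rewrite sqrf_eq0 => /eqP.
Qed.

Lemma sqn0 m n : sqn (0 : 'M[R]_(m, n)) = 0.
Proof. by rewrite /sqn big1 // => i _; rewrite big1 // => j _; rewrite mxE expr0n. Qed.

Lemma sqn_entry m n (A : 'M[R]_(m, n)) i j : A i j ^+ 2 <= sqn A.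
Proof.
rewrite /sqn (bigD1 i) //= (bigD1 j) //= -addrA lerDl addr_ge0 //.
  by apply: sumr_ge0 => k _; exact: sqr_ge0.
by apply: sumr_ge0 => k _; apply: sumr_ge0 => l _; exact: sqr_ge0.
Qed.

Lemma cauchy_schwarz (I : finType) (a b : I -> R) :
  (\sum_i a i * b i) ^+ 2 <= (\sum_i a i ^+ 2) * (\sum_i b i ^+ 2).
Proof.
suff : 0 <= \sum_i \sum_j (a i * b j - a j * b i) ^+ 2.
  have -> : \sum_i \sum_j (a i * b j - a j * b i) ^+ 2 =
    2%:R * ((\sum_i a i ^+ 2) * (\sum_i b i ^+ 2) - (\sum_i a i * b i) ^+ 2).
    rewrite expr2 !big_distrlr /= -sumrB mulr_sumr.
    have -> : \sum_i \sum_j (a i * b j - a j * b i) ^+ 2 =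
      \sum_i \sum_j (a i ^+ 2 * b j ^+ 2 - a i * b i * (a j * b j)) +
      \sum_i \sum_j (a j ^+ 2 * b i ^+ 2 - a i * b i * (a j * b j)).
      rewrite -big_split; apply: eq_bigr => i _; rewrite -big_split; apply: eq_bigr => j _ /=.
      ring.
    rewrite [X in _ + X]exchange_big /= -big_split; apply: eq_bigr => i _ /=.
    rewrite -sumrB mulrDl mul1r; congr (_ + _); apply: eq_bigr => j _; ring.
  by rewrite pmulr_rge0 // subr_ge0.
by apply: sumr_ge0 => i _; apply: sumr_ge0 => j _; exact: sqr_ge0.
Qed.

Lemma sqnM m n p (A : 'M[R]_(m, n)) (B : 'M[R]_(n, p)) :
  sqn (A *m B) <= sqn A * sqn B.
Proof.
have -> : sqn B = \sum_j \sum_k B k j ^+ 2 by rewrite /sqn exchange_big.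
rewrite /sqn mulr_suml; apply: ler_sum => i _; rewrite mulr_sumr.
by apply: ler_sum => j _; rewrite mxE; exact: cauchy_schwarz.
Qed.

Lemma sqn_tr m n (A : 'M[R]_(m, n)) : sqn A^T = sqn A.
Proof.
by rewrite /sqn exchange_big; apply: eq_bigr => i _; apply: eq_bigr => j _; rewrite mxE.
Qed.

Lemma sqnZ m n a (A : 'M[R]_(m, n)) : sqn (a *: A) = a ^+ 2 * sqn A.
Proof.
rewrite /sqn mulr_sumr; apply: eq_bigr => i _; rewrite mulr_sumr.
by apply: eq_bigr => j _; rewrite mxE exprMn.
Qed.

Lemma sqn_parallelogram m n (A B : 'M[R]_(m, n)) :
  sqn (A + B) + sqn (A - B) = 2%:R * sqn A + 2%:R * sqn B.
Proof.
rewrite /sqn !mulr_sumr -!big_split; apply: eq_bigr => i _ /=.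
rewrite !mulr_sumr -!big_split; apply: eq_bigr => j _ /=.
by rewrite !mxE; ring.
Qed.

Lemma sqn_row n (x : 'rV[R]_n) : sqn x = (x *m x^T) ord0 ord0.
Proof. by rewrite /sqn big_ord1 mxE; apply: eq_bigr => j _; rewrite mxE expr2. Qed.

Lemma sqnD_le m n (A B : 'M[R]_(m, n)) : sqn (A + B) <= 2%:R * (sqn A + sqn B).
Proof.
have := sqn_parallelogram A B; have := sqn_ge0 (A - B); rewrite mulrDr => ? <-.
by rewrite lerDl.
Qed.

Lemma sqn_polyfun n : polyfun (@sqn n n).
Proof.
apply: (@polyfun_sum _ _ _ _ _ (fun i (A : 'M[R]_n) => \sum_j A i j ^+ 2)) => i _.
apply: (@polyfun_sum _ _ _ _ _ (fun j (A : 'M[R]_n) => A i j ^+ 2)) => j _.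
rewrite (_ : (fun _ => _) = fun A : 'M[R]_n => A i j * A i j); first by do !constructor.
by apply/funext => A; rewrite expr2.
Qed.

End SquareNorm.

Section InvariantForm.
Variables (R : realType) (d : nat) (B : set 'M[R]_d) (K : R).
Hypotheses (B1 : B 1%:M) (BM : forall a b, B a -> B b -> B (a *m b))
  (BV : forall a, B a -> a \in unitmx /\ B (invmx a))
  (BK : forall a, B a -> sqn a <= K).

Let qf (x : 'rV[R]_d) (Q : 'M[R]_d) : R := (x *m Q *m x^T) ord0 ord0.
Let act (b Q : 'M[R]_d) : 'M[R]_d := b *m Q *m b^T.

Let K0 : 0 <= K. Proof. exact: le_trans (sqn_ge0 _) (BK B1). Qed.

Let actM a b Q : act (a *m b) Q = act a (act b Q).
Proof. by rewrite /act trmx_mul !mulmxA. Qed.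

Let act1 Q : act 1%:M Q = Q.
Proof. by rewrite /act trmx1 mul1mx mulmx1. Qed.

Let qf_act x b Q : qf x (act b Q) = qf (x *m b) Q.
Proof. by rewrite /qf /act trmx_mul !mulmxA. Qed.

Let act_lin a Q Q' b : act b (a *: (Q + Q')) = a *: (act b Q + act b Q').
Proof. by rewrite /act -scalemxAr -scalemxAl mulmxDr mulmxDl. Qed.

Let actB Q Q' b : act b (Q - Q') = act b Q - act b Q'.
Proof. by rewrite /act mulmxBr mulmxBl. Qed.

Let sqn_act b Q : B b -> sqn (act b Q) <= K ^+ 2 * sqn Q.
Proof.
move=> hb; apply: le_trans (sqnM _ _) _; rewrite sqn_tr.
apply: le_trans (ler_wpM2r (sqn_ge0 _) (sqnM _ _)) _.
rewrite mulrAC expr2; apply: (ler_wpM2r (sqn_ge0 _)).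
by apply: ler_pM; rewrite ?sqn_ge0 ?BK.
Qed.

Let sqn_act_ge b Q : B b -> sqn Q <= K ^+ 2 * sqn (act b Q).
Proof.
move=> hb; have [bU bV] := BV hb.
by have := sqn_act (act b Q) bV; rewrite -actM mulVmx // act1.
Qed.

(** A lower bound for the standard form along the orbit, since |x|^2 <= K |x b|^2; the added 1 keeps
    it positive when K = 0. *)
Let c0 : R := (K + 1)^-1.

Let c0_gt0 : 0 < c0. Proof. by rewrite invr_gt0 ltr_wpDl. Qed.

(** Positivity with one constant along the whole orbit: an invariant convex condition that survives
    limits. *)
Let pos (Q : 'M[R]_d) := forall b x, B b -> c0 * sqn x <= qf (x *m b) Q.

Let pos_act b Q : B b -> pos Q -> pos (act b Q).
Proof. by move=> hb hQ a x ha; rewrite qf_act -mulmxA; apply: hQ; exact: BM. Qed.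

Let pos1 : pos 1%:M.
Proof.
move=> b x hb; rewrite /qf mulmx1 -sqn_row ler_pdivrMl ?ltr_wpDl //.
have [bU bV] := BV hb.
have := sqnM (x *m b) (invmx b); rewrite mulmxK // => h; apply: (le_trans h).
rewrite mulrC; apply: (ler_wpM2r (sqn_ge0 _)).
by apply: le_trans (BK bV) _; rewrite lerDl.
Qed.

Let pos_mid Q Q' : pos Q -> pos Q' -> pos (2^-1 *: (Q + Q')).
Proof.
move=> hQ hQ' b x hb; rewrite /qf -scalemxAr -scalemxAl mulmxDr mulmxDl !mxE.
by have := hQ b x hb; have := hQ' b x hb; rewrite /qf !mxE; lra.
Qed.

Let size_le (Q : 'M[R]_d) (v : R) := forall b, B b -> sqn (act b Q) <= v.

Let V : set R := [set v | exists2 Q, pos Q & size_le Q v].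

Let V_inf : has_inf V.
Proof.
split; first by exists (K ^+ 2 * sqn (1%:M : 'M[R]_d)), 1%:M => // b /sqn_act.
by exists 0 => v [Q _ /(_ _ B1)]; apply: le_trans; exact: sqn_ge0.
Qed.

(** The midpoint competes for the infimum too, and by the parallelogram law each point of its orbit
    has its squared norm lowered by a quarter of the squared distance. *)
Let near_inf (Q Q' : 'M[R]_d) v : pos Q -> pos Q' -> size_le Q v -> size_le Q' v ->
  sqn (Q - Q') <= 4%:R * K ^+ 2 * (v - inf V).
Proof.
move=> hQ hQ' sQ sQ'.
have h b : B b -> sqn (act b (2^-1 *: (Q + Q'))) <= v - 4^-1 * sqn (act b (Q - Q')).
  move=> hb; rewrite act_lin sqnZ actB.
  have := sqn_parallelogram (act b Q) (act b Q'); have := sQ b hb; have := sQ' b hb.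
  by lra.
have [K00|Kpos] := eqVneq K 0.
  have := sqn_act_ge (Q - Q') B1; rewrite K00 expr0n mul0r => h1.
  by rewrite mulr0 mul0r.
have K2 : 0 < K ^+ 2 by rewrite exprn_gt0 // lt_neqAle eq_sym Kpos.
have hV : V (v - 4^-1 * (sqn (Q - Q') / K ^+ 2)).
  exists (2^-1 *: (Q + Q')); first exact: pos_mid.
  move=> b hb; apply: le_trans (h b hb) _.
  rewrite lerD2l lerN2; apply: ler_wpM2l; first by rewrite invr_ge0.
  by rewrite ler_pdivrMr // mulrC; exact: sqn_act_ge.
have := ge_inf V_inf.2 hV => h1.
rewrite -mulrA mulrCA -ler_pdivrMl //.
by rewrite mulrC; lra.
Qed.

(** Q minimises the largest squared norm on its orbit among the forms in [pos]. By [near_inf] the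
    minimiser is unique, and every b maps it to another minimiser. *)
Lemma invariant_form : exists Q : 'M[R]_d, exists2 c : R, 0 < c &
  (forall b, B b -> b *m Q *m b^T = Q) /\
  (forall x : 'rV[R]_d, c * sqn x <= (x *m Q *m x^T) ord0 ord0).
Proof.
have step (k : nat) : exists Q, pos Q /\ size_le Q (inf V + k.+1%:R^-1).
  have e0 : 0 < k.+1%:R^-1 :> R by rewrite invr_gt0 ltr0n.
  have [v [Q hQ sQ] lv] := inf_adherent e0 V_inf.
  by exists Q; split=> // b hb; apply: le_trans (sQ b hb) _; exact: ltW.
have [q hq] := choice step.
(* From y^2 <= inf V + 1 and y <= y^2 + 1. *)
have qb k i j : `|q k i j| <= inf V + 2.
  have [_ /(_ _ B1)] := hq k; rewrite act1 => h1.
  have h2 := sqn_entry (q k) i j.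
  have h3 : k.+1%:R^-1 <= 1 :> R by rewrite invf_le1 ?ler1n.
  have h4 : `|q k i j| ^+ 2 <= inf V + 1.
    rewrite real_normK ?num_real //; apply: le_trans h2 _; apply: le_trans h1 _.
    by rewrite lerD2l.
  have := normr_ge0 (q k i j); nra.
have [Q hQ] := bounded_ultra_mx qb.
have Qpos : pos Q.
  move=> b x hb; have hp : polyfun (qf (x *m b)).
    apply: (@polyfun_mulmxr _ _ _ _ _ (fun A => x *m b *m A)).
    by apply: (@polyfun_mulmxl _ _ _ _ _ id) => i j; constructor.
  apply: (ultra_cvg_le (@ultra_cvg_cst _ _) (ultra_cvg_polyfun hp hQ)) => k.
  by have [+ _] := hq k; apply.
have Qsize : size_le Q (inf V).
  move=> b hb; have hp : polyfun (fun A => sqn (act b A)).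
    rewrite /sqn; apply: (@polyfun_sum _ _ _ _ _ (fun i (A : 'M[R]_d) => \sum_j (act b A) i j ^+ 2)) => i _.
    apply: (@polyfun_sum _ _ _ _ _ (fun j (A : 'M[R]_d) => (act b A) i j ^+ 2)) => j _.
    have pa : polyfun (fun A => (act b A) i j).
      apply: (@polyfun_mulmxr _ _ _ _ _ (fun A => b *m A)).
      by apply: (@polyfun_mulmxl _ _ _ _ _ id) => i' j'; constructor.
    by rewrite (_ : (fun _ => _) = fun A => (act b A) i j * (act b A) i j) //; constructor.
  rewrite -[inf V]addr0.
  apply: (ultra_cvg_le (ultra_cvg_polyfun hp hQ) (cvgD (@ultra_cvg_cst _ _) (@ultra_cvg_invn R))) => k.
  by have [_ +] := hq k; apply.
exists Q, c0; first exact: c0_gt0.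
split=> [b hb|x]; last by have := Qpos 1%:M x B1; rewrite mulmx1.
apply/eqP; rewrite -subr_eq0; apply/eqP; apply: sqn_eq0; apply/eqP.
rewrite eq_le sqn_ge0 andbT.
have := near_inf (pos_act hb Qpos) Qpos _ Qsize; rewrite subrr mulr0; apply.
by move=> a ha; rewrite -actM; apply: Qsize; exact: BM.
Qed.

End InvariantForm.

(** * Polynomial representations *)

Lemma poly_growth (R : realType) (P : {poly R}) : P != 0 ->
  exists2 e : R, 0 < e & exists N : nat, forall n, (N <= n)%N -> e <= `|P.[n%:R]|.
Proof.
elim/poly_ind: P => [|P c ih]; first by rewrite eqxx.
have [->|P0] := eqVneq P 0.
  rewrite mul0r add0r polyC_eq0 => c0; exists `|c|; first by rewrite normr_gt0.
  by exists 0 => n _; rewrite hornerC.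
move=> _; have [e e0 [N hN]] := ih P0; exists 1 => //.
exists (maxn N (Num.bound ((1 + `|c|) / e))) => n; rewrite geq_max => /andP[nN nb].
rewrite !hornerE -[X in _ <= `|_ + X|]opprK; apply: le_trans (lerB_dist _ _).
rewrite normrN normrM lerBrDr (ger0_norm (ler0n _ _)).
have : (1 + `|c|) / e < n%:R.
  by apply: lt_le_trans (archi_boundP _) _; rewrite ?ler_nat // divr_ge0 // ?ltW // addr_ge0.
rewrite ltr_pdivrMr // => /ltW h; apply: (le_trans h).
by rewrite mulrC; apply: ler_wpM2r => //; exact: hN.
Qed.

Lemma bounded_poly (R : realType) (P : {poly R}) M :
  (forall n : nat, `|P.[n%:R]| <= M) -> exists c, P = c%:P.
Proof.
elim/poly_ind: P => [|P c _] h; first by exists 0; rewrite polyC0.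
have [->|P0] := eqVneq P 0; first by exists c; rewrite mul0r add0r.
have [e e0 [N hN]] := poly_growth P0.
have M0 : 0 <= M by exact: le_trans (normr_ge0 _) (h 0%N).
pose n := maxn N (Num.bound ((M + `|c| + 1) / e)).
have := h n; rewrite !hornerE -[X in `|_ + X|]opprK => /(le_trans (lerB_dist _ _)).
rewrite normrN normrM lerBlDr (ger0_norm (ler0n _ _)).
have : (M + `|c| + 1) / e < n%:R.
  apply: lt_le_trans (archi_boundP _) _; rewrite ?ler_nat ?leq_maxr //.
  by apply: divr_ge0; [rewrite !addr_ge0|exact: ltW].
rewrite ltr_pdivrMr // => h1 h2.
have h3 : n%:R * e <= `|P.[n%:R]| * n%:R.
  by rewrite mulrC; apply: ler_wpM2r => //; apply: hN; exact: leq_maxl.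
by have := lt_le_trans h1 (le_trans h3 h2); rewrite ltNge lerDl ler01.
Qed.

Lemma polycurve_det (R : comNzRingType) n (M : R -> 'M[R]_n) :
  polycurve M -> exists P : {poly R}, forall t, \det (M t) = P.[t].
Proof.
move=> hM; have [F hF] := choice (fun ij : 'I_n * 'I_n => hM ij.1 ij.2).
exists (\det (\matrix_(i, j) F (i, j))) => t.
rewrite -[RHS]/(horner_eval t _) -det_map_mx; congr (\det _).
by apply/matrixP => i j; rewrite !mxE; exact: (hF (i, j)).
Qed.

Section PolyRep.
Variables (R : realType) (g : nat).
Local Notation n := (g + g)%N.
Local Notation G := (Sp R g).

Definition polyrep k (rho : 'M[R]_n -> 'M[R]_k) :=
  [/\ forall i j, polyfun (fun A => rho A i j), rho 1%:M = 1%:M &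
      forall A B, G A -> G B -> rho (A *m B) = rho A *m rho B].

Section Rep.
Variables (k : nat) (rho : 'M[R]_n -> 'M[R]_k).
Hypothesis hrho : polyrep rho.

Lemma polyrepV A : G A -> rho A *m rho (invmx A) = 1%:M.
Proof.
have [_ r1 rM] := hrho; move=> hA.
by rewrite -rM ?mulmxV ?Sp_unit //; exact: SpV.
Qed.

Lemma polyrepVl A : G A -> rho (invmx A) *m rho A = 1%:M.
Proof.
have [_ r1 rM] := hrho; move=> hA.
by rewrite -rM ?mulVmx ?Sp_unit //; exact: SpV.
Qed.

Lemma polyrep_transv v : polycurve (fun t => rho (transv v t)).
Proof.
have [rp _ _] := hrho => i j.
exact: (polyfun_curve (rp i j) (@transv_polycurve _ _ v)).
Qed.

Lemma polyrep_transvD v s t :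
  rho (transv v (s + t)) = rho (transv v s) *m rho (transv v t).
Proof.
have [_ _ rM] := hrho; have c2 := char2_num R.
by rewrite -rM ?transvD //; exact: transv_Sp.
Qed.

Lemma polyrep_fix m (x : 'M[R]_(m, k)) :
  (forall v t, x *m rho (transv v t) = x) -> forall A, G A -> x *m rho A = x.
Proof.
have [_ r1 rM] := hrho; have c2 := char2_num R.
move=> h A /(Sp_transv_prod c2); elim=> [|v t B hB ih]; first by rewrite r1 mulmx1.
by rewrite rM ?mulmxA ?h //; [exact: transv_Sp|exact: transv_prod_Sp].
Qed.

(** Along a transvection the determinant is a polynomial P with P(t) P(-t) = 1: a unit, hence the
    constant P(0) = 1. *)
Lemma polyrep_det A : G A -> \det (rho A) = 1.
Proof.
have [_ r1 rM] := hrho; have c2 := char2_num R.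
move=> /(Sp_transv_prod c2); elim=> [|v t B hB ih]; first by rewrite r1 det1.
rewrite rM ?det_mulmx ?ih ?mulr1; [|exact: transv_Sp|exact: transv_prod_Sp].
have [P hP] := polycurve_det (polyrep_transv v).
rewrite hP; have P1 : P.[0] = 1 by rewrite -hP transv0 r1 det1.
have e : P * (P \Po (- 'X)) = 1.
  apply: poly_eq_nat => m; rewrite hornerM horner_comp !hornerE -!hP -det_mulmx.
  by rewrite -polyrep_transvD subrr transv0 r1 det1.
have U : P \is a GRing.unit by apply/unitrP; exists (P \Po (- 'X)); rewrite mulrC e.
move: U; rewrite poly_unitE => /andP[/eqP s1 _].
have [c Pc] : exists c, P = c%:P by exists P`_0; apply: size1_polyC; rewrite s1.
by rewrite Pc hornerC in P1; rewrite Pc hornerC P1.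
Qed.

End Rep.

(* The restriction of [rho] to the row space of [L]. *)
Definition subrep k (rho : 'M[R]_n -> 'M[R]_k) d (L : 'M[R]_(d, k)) A :=
  L *m rho A *m pinvmx L.

Section SubRep.
Variables (k : nat) (rho : 'M[R]_n -> 'M[R]_k) (d : nat) (L : 'M[R]_(d, k)).
Hypotheses (hrho : polyrep rho) (Lf : row_free L)
  (Linv : forall A, G A -> (L *m rho A <= L)%MS).

Lemma subrepE A : G A -> subrep rho L A *m L = L *m rho A.
Proof. by move=> hA; rewrite /subrep mulmxKpV // Linv. Qed.

Lemma subrep_polyrep : polyrep (subrep rho L).
Proof.
have [rp r1 rM] := hrho; split.
- apply: (@polyfun_mulmxr _ _ _ _ _ (fun A => L *m rho A)).
  exact: (@polyfun_mulmxl _ _ _ _ _ rho).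
- by rewrite /subrep r1 mulmx1 mulmxVp.
move=> A B hA hB; apply: (row_free_inj Lf).
rewrite /= -(mulmxA (subrep rho L A)) (subrepE hB) (mulmxA (subrep rho L A)) (subrepE hA) -mulmxA -rM // subrepE //.
exact: SpM.
Qed.

End SubRep.

Lemma ex_max_subspace k (P : 'rV[R]_k -> Prop) :
  P 0 -> (forall a u v, P u -> P v -> P (a *: u + v)) ->
  exists F : 'M[R]_k, forall u, (u <= F)%MS <-> P u.
Proof.
move=> P0 PL.
pose Q (F : 'M[R]_k) := forall u : 'rV_k, (u <= F)%MS -> P u.
have ex : exists r, `[< exists2 F, Q F & \rank F = r >].
  exists 0%N; apply/asboolP; exists 0; last exact: mxrank0.
  by move=> u; rewrite submx0 => /eqP ->.
have ub r : `[< exists2 F, Q F & \rank F = r >] -> (r <= k)%N.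
  by move=> /asboolP[F _ <-]; exact: rank_leq_row.
have [r /asboolP[F QF Fr] rmax] := ex_maxnP ex ub.
exists F => u; split=> [|Pu]; first exact: QF.
have QFu : Q (F + <<u>>)%MS.
  move=> w /sub_addsmxP[[a b] /= ->].
  have : (b *m <<u>> <= u)%MS by rewrite -(genmxE u) submxMl.
  move=> /sub_rVP[c ->]; rewrite addrC; apply: PL => //.
  by apply: QF; exact: submxMl.
have h : (\rank (F + <<u>>)%MS <= \rank F)%N by rewrite Fr; apply: rmax; apply/asboolP; exists (F + <<u>>)%MS.
have [_ e] := mxrank_leqif_sup (addsmxSl F <<u>>%MS).
have : ((F + <<u>>)%MS <= F)%MS by rewrite -e eqn_leq h mxrankS // addsmxSl.
by apply: submx_trans; apply: submx_trans (addsmxSr _ _); rewrite genmxE.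
Qed.

Section Fixed.
Variables (k : nat) (rho : 'M[R]_n -> 'M[R]_k).
Hypothesis hrho : polyrep rho.

Let fixd (u : 'rV[R]_k) := forall A, G A -> u *m rho A = u.

(* [A |-> u rho(A) - u] is a homomorphism to a vector group, hence trivial on
   transvections as [T_v(4t)] is conjugate to [T_v(t)]. *)
Lemma fixed_mod_fixed u : (forall A, G A -> fixd (u *m rho A - u)) -> fixd u.
Proof.
have [_ r1 rM] := hrho; have c2 := char2_num R.
move=> h; pose d A := u *m rho A - u.
have dM A B : G A -> G B -> d (A *m B) = d A + d B.
  move=> hA hB; rewrite /d rM // mulmxA.
  have := h A hA B hB; rewrite mulmxBl => /eqP; rewrite subr_eq => /eqP ->.
  by rewrite addrA.
have d1 : d 1%:M = 0 by rewrite /d r1 mulmx1 subrr.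
have dV A : G A -> d (invmx A) = - d A.
  move=> hA; apply/eqP; rewrite -addr_eq0 -dM //; last exact: SpV.
  by rewrite mulVmx ?Sp_unit // d1.
have dT v t : d (transv v t) = 0.
  have [->|v0] := eqVneq v 0.
    by rewrite /transv !mul0mx scaler0 addr0 d1.
  have tS s : G (transv v s) by exact: transv_Sp.
  have [A hA e] := transv_scale c2 t v0.
  have : d (transv v (4%:R * t)) = d (transv v t).
    have hV := SpV hA.
    rewrite -e dM ?dM ?dV //; last exact: SpM.
    by rewrite addrAC subrr add0r.
  have -> : 4%:R * t = t + t + t + t by ring.
  rewrite -!transvD // !dM; do ?[exact: tS|apply: SpM].
  move=> /eqP; rewrite -subr_eq0 addrK => /eqP h3.
  have : 3%:R *: d (transv v t) = 0.
    by rewrite scaler_nat -h3 !mulrS mulr0n addr0 addrA.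
  by move=> /eqP; rewrite scaler_eq0 pnatr_eq0 /= => /eqP.
move=> A hA; apply: (polyrep_fix hrho) => // v t.
by apply/eqP; rewrite -subr_eq0; apply/eqP; exact: dT.
Qed.

(** C projects onto the quotient by the fixed vectors; [fixed_mod_fixed] keeps the quotient free of
    new ones. *)
Lemma quotient_polyrep : exists m (C : 'M[R]_(k, m)) (sigma : 'M[R]_n -> 'M[R]_m),
  [/\ polyrep sigma, forall A, G A -> C *m sigma A = rho A *m C,
     forall u : 'rV[R]_k, u *m C = 0 -> fixd u &
     forall y : 'rV[R]_m, (forall A, G A -> y *m sigma A = y) -> y = 0].
Proof.
have [rp r1 rM] := hrho.
have [F hF] : exists F : 'M[R]_k, forall u, (u <= F)%MS <-> fixd u.
  apply: ex_max_subspace => [A _|a u v hu hv A hA]; first by rewrite mul0mx.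
  by rewrite mulmxDl -scalemxAl hu // hv.
pose C := col_base (cokermx F); pose D := pinvmx C.
have DC : D *m C = 1%:M by apply: mulVpmx; exact: col_base_full.
have C0 p (u : 'M[R]_(p, k)) : u *m C = 0 -> (u <= F)%MS.
  by move=> uC; rewrite submxE -{1}(mulmx_base (cokermx F)) mulmxA uC mul0mx.
have CF p (u : 'M[R]_(p, k)) : (u <= F)%MS -> u *m C = 0.
  rewrite submxE => /eqP; rewrite -{1}(mulmx_base (cokermx F)) mulmxA => h.
  by apply: (row_free_inj (row_base_free (cokermx F))); rewrite h mul0mx.
have Cfix p (u : 'M[R]_(p, k)) A : G A -> u *m C = 0 -> u *m rho A = u.
  move=> hA uC; apply/row_matrixP => i; rewrite row_mul.
  by apply: (proj1 (hF (row i u))) => //; apply: C0; rewrite -row_mul uC row0.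
pose sigma A := D *m rho A *m C.
have CS A : G A -> C *m sigma A = rho A *m C.
  move=> hA; have e : (1%:M - C *m D) *m C = 0.
    by rewrite mulmxBl mul1mx -mulmxA DC mulmx1 subrr.
  have : (1%:M - C *m D) *m rho A *m C = 0 by rewrite Cfix // e.
  rewrite !mulmxBl mul1mx => /eqP; rewrite subr_eq0 => /eqP ->.
  by rewrite /sigma !mulmxA.
exists _, C, sigma; split=> //.
- split.
  + apply: (@polyfun_mulmxr _ _ _ _ _ (fun A => D *m rho A)).
    exact: (@polyfun_mulmxl _ _ _ _ _ rho).
  + by rewrite /sigma r1 mulmx1.
  + move=> A B hA hB; rewrite {1}/sigma rM // -!mulmxA -CS //.
    by rewrite /sigma !mulmxA.
- by move=> u /C0 /hF.
move=> y hy; pose x := y *m D.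
have xC : x *m C = y by rewrite /x -mulmxA DC mulmx1.
have : fixd x.
  apply: fixed_mod_fixed => A hA; apply/hF; apply: C0.
  by rewrite mulmxBl -mulmxA -CS // mulmxA xC hy // subrr.
by move=> /hF /CF; rewrite xC.
Qed.

End Fixed.

(* A bounded image lies in a compact group, which is an algebraic condition; but
   a bounded one-parameter group of polynomial matrices is trivial. *)
Lemma bounded_polyrep_trivial k (rho : 'M[R]_n -> 'M[R]_k) (D : set 'M[R]_n) (K : R) :
  polyrep rho -> D `<=` G -> zdense D -> D 1%:M ->
  (forall A B, D A -> D B -> D (A *m B)) -> (forall A, D A -> D (invmx A)) ->
  (forall A, D A -> sqn (rho A) <= K) ->
  forall A, G A -> rho A = 1%:M.
Proof.
move=> hrho DG Dd D1 DM DV DK; have [rp r1 rM] := hrho.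
pose B : set 'M[R]_k := [set rho A | A in D].
have [Q [c c0 [QB Qc]]] : exists Q : 'M[R]_k, exists2 c : R, 0 < c &
  (forall b, B b -> b *m Q *m b^T = Q) /\
  (forall x : 'rV[R]_k, c * sqn x <= (x *m Q *m x^T) ord0 ord0).
  apply: (@invariant_form _ _ B K).
  - by exists 1%:M.
  - by move=> _ _ [A hA <-] [A' hA' <-]; exists (A *m A'); [exact: DM|apply: rM; exact: DG].
  - move=> _ [A hA <-]; have U := polyrepV hrho (DG _ hA).
    have [Ur _] := mulmx1_unit U; split=> //; exists (invmx A); first exact: DV.
    by apply: (can_inj (mulKmx Ur)); rewrite mulmxV // U.
  - by move=> _ [A hA <-]; exact: DK.
have QG A : G A -> rho A *m Q *m (rho A)^T = Q.
  move=> hA; apply/matrixP => i j; apply/eqP; rewrite -subr_eq0; apply/eqP.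
  pose p A := (rho A *m Q *m (rho A)^T) i j + (- Q i j).
  rewrite -[LHS]/(p A); apply: (Dd p) => //.
    constructor; last by constructor.
    rewrite (_ : (fun _ => _) = fun A => \sum_l (rho A *m Q) i l * rho A j l).
      apply: polyfun_sum => l _; constructor => //.
      exact: (@polyfun_mulmxr _ _ _ _ _ rho).
    by apply/funext => A'; rewrite mxE; apply: eq_bigr => l _; rewrite [_^T l j]mxE.
  by move=> A' hA'; rewrite /p QB ?subrr //; exists A'.
move=> A hA; rewrite -[LHS]mul1mx; apply: (polyrep_fix hrho) => // v t.
rewrite mul1mx; apply/matrixP => i j.
have [P hP] := polyrep_transv hrho v i j.
have [a e] : exists a, P = a%:P.
  (* Row i of the image of a transvection has Q-norm Q i i, which bounds the square y^2 of the
     entry; then y <= y^2 + 1. *)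
  apply: (@bounded_poly _ _ (c^-1 * Q i i + 1)) => m; rewrite -hP.
  have tS : G (transv v m%:R) by apply: transv_Sp; exact: char2_num.
  have := Qc (row i (rho (transv v m%:R))).
  have -> : row i (rho (transv v m%:R)) *m Q *m (row i (rho (transv v m%:R)))^T =
      const_mx (Q i i).
    have := congr1 (fun M : 'M[R]_k => M i i) (QG _ tS) => <-.
    apply/matrixP => a b; rewrite !ord1 !mxE; apply: eq_bigr => l _.
    by rewrite -row_mul !mxE.
  rewrite mxE mulrC -ler_pdivlMr // [_ / c]mulrC => h.
  have h2 := le_trans (sqn_entry (row i (rho (transv v m%:R))) ord0 j) h.
  rewrite mxE in h2; move: h2; rewrite -[_ ^+ 2]real_normK ?num_real //.
  set y := `|_|; have y0 : 0 <= y by exact: normr_ge0.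
  by nra.
by rewrite hP e hornerC -(hornerC a 0) -e -hP transv0 r1.
Qed.

End PolyRep.

(** * Finitely additive means on projective space *)

Section Cones.
Variables (R : realType) (k : nat).
Implicit Types u v x y : 'rV[R]_k.

(** A set of lines, encoded as a set of vectors stable under scaling. *)
Definition cone (A : set 'rV[R]_k) := forall c u, c != 0 -> A u -> A (c *: u).

(* The projective neighbourhood of the row space of [L], of squared size [e]. *)
Definition cnbhs p (L : 'M[R]_(p, k)) (e : R) : set 'rV[R]_k :=
  [set u | u != 0 /\ exists x, (x <= L)%MS /\ sqn (u - x) < e * sqn u].

Lemma sqn_gt0 m n (u : 'M[R]_(m, n)) : (0 < sqn u) = (u != 0).
Proof.
rewrite lt_neqAle sqn_ge0 andbT eq_sym; congr (~~ _); apply/eqP/eqP => [|->].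
  exact: sqn_eq0.
exact: sqn0.
Qed.

Lemma cnbhs_cone p (L : 'M[R]_(p, k)) e : cone (cnbhs L e).
Proof.
move=> c u c0 [u0 [x [xL h]]]; split; first by rewrite scaler_eq0 negb_or c0.
exists (c *: x); split; first exact: scalemx_sub.
by rewrite -scalerBr !sqnZ mulrCA ltr_pM2l // exprn_even_gt0.
Qed.

Lemma cnbhsS p q (L : 'M[R]_(p, k)) (L' : 'M[R]_(q, k)) e e' :
  (L <= L')%MS -> e <= e' -> cnbhs L e `<=` cnbhs L' e'.
Proof.
move=> LL' ee' u [u0 [x [xL h]]]; split=> //; exists x; split.
  exact: submx_trans xL LL'.
by apply: lt_le_trans h _; apply: ler_wpM2r => //; exact: sqn_ge0.
Qed.

Lemma dist_kernel p q (A : 'M[R]_(p, q)) : exists2 C : R, 0 < C &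
  forall x : 'rV_p, exists2 z : 'rV_p, z *m A = 0 & sqn (x - z) <= C * sqn (x *m A).
Proof.
exists (sqn (pinvmx A) + 1); first by rewrite ltr_wpDl // sqn_ge0.
move=> x; exists (x - x *m A *m pinvmx A).
  by rewrite mulmxBl mulmxKpV ?submxMl // subrr.
rewrite opprB addrC subrK; apply: le_trans (sqnM _ _) _.
by rewrite mulrC; apply: ler_wpM2r; rewrite ?sqn_ge0 // lerDl.
Qed.

Lemma cnbhs_cap p q (L : 'M[R]_(p, k)) (L' : 'M[R]_(q, k)) e : 0 < e ->
  exists2 d : R, 0 < d & cnbhs L d `&` cnbhs L' d `<=` cnbhs (L :&: L')%MS e.
Proof.
move=> e0; have [C C0 hC] := dist_kernel (L *m cokermx L').
set sL := sqn L; set sK := sqn (cokermx L').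
have sL0 : 0 <= sL by exact: sqn_ge0.
have sK0 : 0 <= sK by exact: sqn_ge0.
pose D := C * sL * sK; have D0 : 0 <= D by rewrite !mulr_ge0 // ltW.
(* The squared distance from u to the intersection is at most 2 |u - x|^2 + 4 D (|u - x|^2 + |u -
   y|^2), less than (2 + 8 D) d |u|^2. *)
exists (e / (2 + 8 * D)); first by rewrite divr_gt0 //; nra.
move=> u [[u0 [x [xL hx]]] [_ [y [yL hy]]]]; split=> //.
have [a xa] := submxP xL.
have [b bA hb] := hC a.
have zL : (b *m L <= L)%MS by exact: submxMl.
have zL' : (b *m L <= L')%MS by rewrite submxE -mulmxA bA.
exists (b *m L); split; first by rewrite sub_capmx zL.
have h1 : sqn (x - y) <= 2 * (sqn (u - x) + sqn (u - y)).
  have -> : x - y = (u - y) - (u - x) by rewrite opprB [RHS]addrC subrKA.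
  have := sqn_parallelogram (u - y) (u - x).
  have := sqn_ge0 ((u - y) + (u - x)); lra.
have h2 : sqn (a *m (L *m cokermx L')) <= sqn (x - y) * sK.
  have -> : a *m (L *m cokermx L') = (x - y) *m cokermx L'.
    have /eqP yL0 : y *m cokermx L' == 0 by rewrite -submxE.
    by rewrite mulmxBl yL0 subr0 mulmxA -xa.
  exact: sqnM.
have h3 : sqn (x - b *m L) <= sqn (a - b) * sL.
  by rewrite xa -mulmxBl; exact: sqnM.
have h4 : sqn (u - b *m L) <= 2 * (sqn (u - x) + sqn (x - b *m L)).
  by have := sqnD_le (u - x) (x - b *m L); rewrite subrKA.
have su : 0 < sqn u by rewrite sqn_gt0.
have h5 : sqn (x - b *m L) <= D * sqn (x - y).
  apply: (le_trans h3).
  have -> : D * sqn (x - y) = C * (sqn (x - y) * sK) * sL by rewrite /D; ring.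
  apply: ler_wpM2r => //; apply: le_trans hb _.
  by apply: ler_wpM2l => //; exact: ltW.
set E := e / (2 + 8 * D) in hx hy.
have hE : E * (2 + 8 * D) = e by rewrite /E divfK // gt_eqF //; nra.
have sx := sqn_ge0 (u - x); have sy := sqn_ge0 (u - y).
have h6 : sqn (u - b *m L) <= 2 * sqn (u - x) + 4 * D * (sqn (u - x) + sqn (u - y)).
  by have := ler_wpM2l D0 h1; lra.
apply: (le_lt_trans h6).
rewrite -hE.
have h7 : 4 * D * (sqn (u - x) + sqn (u - y)) <= 4 * D * (2 * E * sqn u).
  by apply: ler_wpM2l; [rewrite mulr_ge0|lra].
by lra.
Qed.

End Cones.

Section Mean.
Variables (T : Type) (R : realType) (M : set T -> R).

Definition fa_prob := [/\ forall A, 0 <= M A, M setT = 1 &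
  forall A B, A `&` B = set0 -> M (A `|` B) = M A + M B].

Hypothesis hM : fa_prob.

Lemma fa_prob0 : M set0 = 0.
Proof.
have [_ _ MU] := hM; have := MU set0 set0 (setI0 _); rewrite setU0 => /eqP.
by rewrite -subr_eq0 opprD addNKr oppr_eq0 => /eqP.
Qed.

Lemma fa_probUI A B : M (A `|` B) = M A + M B - M (A `&` B).
Proof.
have [_ _ MU] := hM.
have -> : A `|` B = A `|` (B `\` A).
  by rewrite predeqE => x; have := pselect (A x); rewrite /setU /setD /=; tauto.
rewrite MU ?setDIK //.
have : M B = M (B `\` A) + M (A `&` B).
  rewrite -MU; last by rewrite predeqE => x; rewrite /setI /setD /set0 /=; tauto.
  congr M; rewrite predeqE => x.
  by have := pselect (A x); rewrite /setU /setI /setD /=; tauto.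
by move=> ->; rewrite addrA addrK.
Qed.

Lemma fa_prob_mono A B : A `<=` B -> M A <= M B.
Proof.
have [M0 _ MU] := hM; move=> AB.
have -> : B = A `|` (B `\` A) by rewrite setDUK.
by rewrite MU ?setDIK // lerDl.
Qed.

Lemma fa_probU_le A B : M (A `|` B) <= M A + M B.
Proof. by have [M0 _ _] := hM; rewrite fa_probUI gerBl. Qed.

Lemma fa_prob_le1 A : M A <= 1.
Proof. by have [_ <- _] := hM; exact: fa_prob_mono. Qed.

End Mean.

Section Estimates.
Variable R : realFieldType.

(** Arithmetic for [bounded_on_charged], with U = |u|^2, q = |a tau|^2, and d1, d2 the squared
    distances of u and of x to z L: if u is far from the kernel directions, then a tau is not
    small. *)
Lemma kernel_estimate (kap C1 b e1 eps U q ux d1 d2 : R) : 0 < 4 * C1 * b + 1 -> 0 < U ->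
  kap * (4 * C1 * b + 1) = e1 -> 0 < kap -> eps <= e1 / 4 -> ux < eps * U -> 0 <= q ->
  e1 * U <= d1 -> d1 <= 2 * (ux + d2) -> d2 <= C1 * q * b -> kap * U <= q.
Proof.
move=> kd U0 hk kap0 he hx q0 h1 h2 h3.
have h5 : eps * U <= e1 / 4 * U by apply: ler_wpM2r => //; exact: ltW.
have h7 : e1 * U <= q * (4 * C1 * b + 1) by lra.
by rewrite -(ler_pM2r kd) mulrAC hk.
Qed.

(** Here S is the squared scale of the matrix, dT = |T m - tau|^2, sa = |a|^2, aL = |a tau L|^2, and
    y, w, wy are the squared norms of the approximation, of the image of u and of their
    difference. *)
Lemma contraction_estimate (e2 kap b b' zeta del r S U eps ux wy dT sa q aL y w : R) :
  0 < e2 -> 0 < kap -> 0 <= b -> 0 <= b' -> 0 < S -> 0 < U -> 0 <= r -> 0 < del ->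
  0 < eps -> 0 <= dT -> 0 <= sa ->
  zeta * (2 * (b' + 1) * (1 + e2)) = e2 * kap -> del * (2 * (8 * b' * b + 1)) = zeta ->
  eps * (4 * (r + 1)) <= zeta * S -> ux < eps * U -> dT < del -> kap * U <= q ->
  wy <= 2 * (ux * r + S * (sa * dT * b)) -> sa <= 4 * U * b' -> q <= aL * (b' + 1) ->
  y = S * aL -> 0 <= w -> 0 <= wy -> y <= 2 * (w + wy) -> wy <= e2 * w /\ 0 < w.
Proof.
move=> e20 kap0 b0 b'0 S0 U0 r0 del0 eps0 dT0 sa0 hz hd he hx hT hq hwy hsa hqa -> w0 wy0 hy.
have b1 : 0 < b' + 1 by rewrite ltr_wpDl.
have h12 : S * (kap * U) <= S * aL * (b' + 1).
  by rewrite -mulrA ler_pM2l //; exact: le_trans hq hqa.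
have h13 : wy <= zeta * S * U.
  have g1 : ux * r <= eps * U * r by apply: ler_wpM2r => //; exact: ltW.
  have g2 : sa * dT * b <= 4 * U * b' * del * b.
    by apply: ler_wpM2r => //; apply: ler_pM => //; exact: ltW.
  have g4 : eps * (4 * (r + 1)) * U <= zeta * S * U by apply: ler_wpM2r => //; exact: ltW.
  have g5 : 0 <= eps * U by rewrite mulr_ge0 // ltW.
  have g6 : S * (sa * dT * b) <= S * (4 * U * b' * del * b) by rewrite ler_pM2l.
  have g7 : S * (4 * U * b' * del * b) * 4 <= zeta * S * U.
    by rewrite -hd; have := mulr_ge0 (mulr_ge0 (ltW del0) (ltW S0)) (ltW U0); lra.
  by lra.
have h14 : (1 + e2) * wy * (2 * (b' + 1)) <= e2 * (S * (kap * U)).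
  have -> : e2 * (S * (kap * U)) = zeta * (2 * (b' + 1) * (1 + e2)) * S * U.
    by rewrite hz; ring.
  have p0 : 0 <= (1 + e2) * (2 * (b' + 1)) by rewrite !mulr_ge0 ?ltW // ltr_wpDl.
  by have := ler_wpM2l p0 h13; lra.
have sy : 0 < S * aL.
  have : 0 < S * aL * (b' + 1) by apply: lt_le_trans h12; rewrite !mulr_gt0.
  by rewrite pmulr_lgt0.
have h15 : (1 + e2) * wy * 2 <= e2 * (S * aL).
  by rewrite -(ler_pM2r b1); have := ler_wpM2l (ltW e20) h12; lra.
have h16 : wy <= e2 * w by have := ler_wpM2l (ltW e20) hy; lra.
split=> //; rewrite lt_neqAle w0 andbT; apply/eqP => w00.
by rewrite -w00 mulr0 in h16; rewrite -w00 in hy; lra.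
Qed.

End Estimates.

(** * Furstenberg's argument for a finitely additive invariant mean *)

Section InvariantMean.
Variables (R : realType) (g k : nat) (rho : 'M[R]_(g + g) -> 'M[R]_k)
  (D : set 'M[R]_(g + g)) (M : set 'rV[R]_k -> R).
Local Notation G := (Sp R g).
Hypotheses (hrho : polyrep rho) (DG : D `<=` G) (Dd : zdense D) (D1 : D 1%:M)
  (DM : forall A B, D A -> D B -> D (A *m B)) (DV : forall A, D A -> D (invmx A)).
Hypotheses (hM : fa_prob M) (M0 : M [set 0] = 0)
  (Minv : forall A C, D A -> cone C -> M [set u | C (u *m rho A)] = M C).

(** The mass of L is read off its neighborhoods: M is only finitely additive and may vanish on the
    subspace itself. *)
Let charged p (L : 'M[R]_(p, k)) (c : R) := forall e, 0 < e -> c <= M (cnbhs L e).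

Let null p (L : 'M[R]_(p, k)) := forall c, 0 < c -> exists2 e, 0 < e & M (cnbhs L e) < c.

Let null_charged p (L : 'M[R]_(p, k)) : null L \/ exists2 c, 0 < c & charged L c.
Proof.
have [h|h] := pselect (null L); first by left.
right; move: h => /existsNP[c /not_implyP[c0 h]]; exists c => // e e0.
by rewrite leNgt; apply/negP => h'; apply: h; exists e.
Qed.

Let charged_sub p q (L : 'M[R]_(p, k)) (L' : 'M[R]_(q, k)) c :
  (L <= L')%MS -> charged L c -> charged L' c.
Proof.
move=> LL' h e e0; apply: le_trans (h e e0) _; apply: (fa_prob_mono hM).
exact: cnbhsS.
Qed.

Let charged_act p (L : 'M[R]_(p, k)) c A : D A -> charged L c -> charged (L *m rho A) c.
Proof.
move=> hA h e e0.
set s := sqn (rho A); set s' := sqn (rho (invmx A)).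
have s0 : 0 <= s by exact: sqn_ge0.
have s'0 : 0 <= s' by exact: sqn_ge0.
(* The action changes the ratio of |u - x|^2 to |u|^2 by a factor at most s s'; the added 1 rules
   out division by zero and gives the strict inequality. *)
have E0 : 0 < e / (s * s' + 1) by rewrite divr_gt0 // ltr_wpDl // mulr_ge0.
have [rp r1 rM] := hrho; have AG := DG hA.
have uE (u : 'rV[R]_k) : u = u *m rho A *m rho (invmx A).
  by rewrite -mulmxA polyrepV // mulmx1.
apply: le_trans (h _ E0) _; rewrite -(Minv hA (@cnbhs_cone _ _ _ (L *m rho A) e)).
apply: (fa_prob_mono hM) => u [u0 [x [xL hx]]].
split; first by apply: contraNneq u0 => e1; rewrite (uE u) e1 mul0mx.
exists (x *m rho A); split; first exact: submxMr.
rewrite -mulmxBl; apply: le_lt_trans (sqnM _ _) _.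
have h1 : sqn u <= sqn (u *m rho A) * s' by rewrite {1}(uE u); exact: sqnM.
have su : 0 < sqn u by rewrite sqn_gt0.
have su' : 0 < sqn (u *m rho A).
  by rewrite sqn_gt0; apply: contraNneq u0 => e1; rewrite (uE u) e1 mul0mx.
set E := e / (s * s' + 1) in hx E0.
have hE : E * (s * s' + 1) = e by rewrite /E divfK // gt_eqF // ltr_wpDl // mulr_ge0.
have h2 : sqn (u - x) * s <= E * sqn u * s by apply: ler_wpM2r => //; exact: ltW.
have h3 : E * sqn u * s <= E * (sqn (u *m rho A) * s') * s.
  by apply: ler_wpM2r => //; apply: ler_wpM2l => //; exact: ltW.
have h4 : 0 < E * sqn (u *m rho A) by exact: mulr_gt0.
rewrite -hE; apply: (le_lt_trans h2); apply: (le_lt_trans h3).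
have -> : E * (sqn (u *m rho A) * s') * s = E * sqn (u *m rho A) * (s * s') by ring.
have -> : E * (s * s' + 1) * sqn (u *m rho A) = E * sqn (u *m rho A) * (s * s') + E * sqn (u *m rho A).
  by ring.
by rewrite ltrDl.
Qed.

Let charged_full : charged (1%:M : 'M[R]_k) 1.
Proof.
move=> e e0; have [Mge M1 MU] := hM.
have -> : cnbhs (1%:M : 'M[R]_k) e = ~` [set 0].
  rewrite predeqE => u; split=> [[/eqP u0 _]|/eqP u0]; first exact: u0.
  split=> //; exists u; split; first exact: submx1.
  by rewrite subrr sqn0 mulr_gt0 // sqn_gt0.
by have := MU [set 0] (~` [set 0]) (setICr _); rewrite setUCr M1 M0 add0r => ->.
Qed.

Let charged_rank0 (L : 'M[R]_k) c : 0 < c -> charged L c -> \rank L != 0%N.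
Proof.
move=> c0 h; apply/eqP => /eqP; rewrite mxrank_eq0 => /eqP L0.
have := h 1 ltr01; rewrite leNgt; have -> : cnbhs L 1 = set0.
  rewrite predeqE => u; split=> // -[u0 [x []]]; rewrite L0 submx0 => /eqP ->.
  by rewrite subr0 mul1r ltxx.
by rewrite fa_prob0 // c0.
Qed.

(* The subspaces of minimal dimension carrying mass are essentially disjoint. *)
Let few_charged d c (s : seq 'M[R]_k) :
  (forall L : 'M[R]_k, (\rank L < d)%N -> null L) ->
  (forall L, L \in s -> \rank L = d /\ charged L c) ->
  pairwise (fun L L' => ~~ (L == L')%MS) s ->
  (size s)%:R * c <= 1.
Proof.
move=> small hs ps.
pose U (s : seq 'M[R]_k) e := [set u | exists2 L, L \in s & cnbhs L e u].
have cap (L : 'M[R]_k) (r : seq 'M[R]_k) : \rank L = d -> (forall L', L' \in r -> \rank L' = d) ->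
   all (fun L' => ~~ (L == L')%MS) r -> forall eta, 0 < eta -> exists2 e0, 0 < e0 &
   forall e, 0 < e -> e <= e0 -> M (cnbhs L e `&` U r e) <= eta.
  move=> Ld; elim: r => [|L' r ih] /= rd.
    move=> _ eta eta0; exists 1 => // e e0 e1.
    rewrite (_ : _ `&` _ = set0) ?fa_prob0 ?ltW //.
    by rewrite predeqE => u; split=> // -[_ []].
  move=> /andP[LL' ar] eta eta0.
  have h2 : 0 < eta / 2 by rewrite divr_gt0.
  have rd' X : X \in r -> \rank X = d by move=> Xr; apply: rd; rewrite inE Xr orbT.
  have [e1 e10 he1] := ih rd' ar _ h2.
  have nc : null (L :&: L')%MS.
    apply: small; rewrite ltn_neqAle -{2}Ld mxrankS ?capmxSl // andbT.
    apply: contra LL' => /eqP e; have L'd : \rank L' = d by apply: rd; rewrite inE eqxx.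
    have [_] := mxrank_leqif_sup (capmxSl L L'); rewrite e Ld eqxx => /esym h.
    have [_] := mxrank_leqif_sup (capmxSr L L'); rewrite e L'd eqxx => /esym h'.
    by rewrite (submx_trans h (capmxSr _ _)) (submx_trans h' (capmxSl _ _)).
  have [e2 e20 he2] := nc _ h2.
  have [e3 e30 he3] := cnbhs_cap L L' e20.
  exists (Num.min e1 e3); first by rewrite lt_min e10.
  move=> e e0; rewrite le_min => /andP[ee1 ee3].
  have -> : eta = eta / 2 + eta / 2 by lra.
  apply: le_trans (lerD (ltW he2) (he1 e e0 ee1)).
  apply: le_trans (fa_probU_le hM _ _); apply: (fa_prob_mono hM) => u [uL [X]].
  rewrite inE => /orP[/eqP -> uX|Xr uX]; last by right; split=> //; exists X.
  by left; apply: he3; split; [exact: cnbhsS uL|exact: cnbhsS uX].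
have main : forall eta, 0 < eta -> exists2 e0, 0 < e0 &
   forall e, 0 < e -> e <= e0 -> (size s)%:R * c - eta <= M (U s e).
  elim: s hs ps => [|L r ih] hs /=.
    move=> _ eta eta0; exists 1 => // e _ _; have [Mge _ _] := hM.
    by apply: le_trans (Mge _); rewrite mul0r sub0r oppr_le0 ltW.
  move=> /andP[aL pr] eta eta0.
  have h2 : 0 < eta / 2 by rewrite divr_gt0.
  have [Ld Lc] := hs L (mem_head _ _).
  have rs X : X \in r -> \rank X = d /\ charged X c by move=> Xr; apply: hs; rewrite inE Xr orbT.
  have [e1 e10 he1] := ih rs pr _ h2.
  have [e2 e20 he2] := cap L r Ld (fun X Xr => (rs X Xr).1) aL _ h2.
  exists (Num.min e1 e2); first by rewrite lt_min e10.
  move=> e e0; rewrite le_min => /andP[ee1 ee2].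
  have -> : U (L :: r) e = cnbhs L e `|` U r e.
    rewrite predeqE => u; split=> [[X]|[uL|[X Xr uX]]].
    - by rewrite inE => /orP[/eqP ->|Xr uX]; [left|right; exists X].
    - by exists L; rewrite ?mem_head.
    - by exists X; rewrite ?inE ?Xr ?orbT.
  rewrite fa_probUI // -natr1 mulrDl mul1r.
  by have := Lc e e0; have := he1 e e0 ee1; have := he2 e e0 ee2; lra.
rewrite leNgt; apply/negP => h.
have h0 : 0 < ((size s)%:R * c - 1) / 2 by rewrite divr_gt0 // subr_gt0.
have [e e0 /(_ e e0 (lexx _)) h1] := main _ h0.
by have := fa_prob_le1 hM (U s e); lra.
Qed.

(** All translates carry mass c, so [few_charged] bounds the number of distinct ones by 1/c; r is a
    longest list of elements with distinct translates. *)
Let finite_orbit d c (L : 'M[R]_k) : 0 < c ->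
  (forall L : 'M[R]_k, (\rank L < d)%N -> null L) -> \rank L = d -> charged L c ->
  exists2 r : seq 'M[R]_(g + g), (forall A, A \in r -> D A) &
    forall A, D A -> exists2 B, B \in r & (L *m rho A == L *m rho B)%MS.
Proof.
move=> c0 small Ld Lc.
pose ok (r : seq 'M[R]_(g + g)) := (forall A, A \in r -> D A) /\
  pairwise (fun A B => ~~ (L *m rho A == L *m rho B)%MS) r.
have okb r : ok r -> (size r)%:R * c <= 1.
  move=> [rD pr]; rewrite -(size_map (fun A => L *m rho A)); apply: (few_charged (d := d)) => //.
    move=> _ /mapP[A Ar ->]; have hA := rD A Ar; split; last exact: charged_act.
    have [Ur _] := mulmx1_unit (polyrepV hrho (DG hA)).
    by rewrite mxrankMfree // row_free_unit.
  by rewrite pairwise_map.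
have ex : exists m, `[< exists2 r, ok r & size r = m >].
  by exists 0%N; apply/asboolP; exists [::].
have ub m : `[< exists2 r, ok r & size r = m >] -> (m <= Num.bound (c^-1))%N.
  move=> /asboolP[r /okb h <-]; rewrite -(ler_nat R).
  apply: le_trans (ltW (archi_boundP _)); last by rewrite invr_ge0 ltW.
  by rewrite -[c^-1]mul1r ler_pdivlMr.
have [m /asboolP[r [rD pr] rm] mmax] := ex_maxnP ex ub.
exists r => // A hA; apply: contrapT => h.
have okA : ok (A :: r).
  split=> [B|]; first by rewrite inE => /orP[/eqP ->|/rD].
  rewrite /= pr andbT; apply/allP => B Br; apply/negP => e; apply: h.
  by exists B.
have := mmax (size r).+1; rewrite -rm ltnn => h1.
by have : false by apply: h1; apply/asboolP; exists (A :: r).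
Qed.

(** For L of least dimension, membership of L rho(A) in its finite orbit is the vanishing of a
    product of polynomials on D, hence on Sp. By irreducibility a single factor vanishes: all
    translates lie in one L rho(B), which is L by A = 1 and dimension. *)
Lemma charged_invariant : exists2 c, 0 < c & exists2 L : 'M[R]_k, charged L c &
  (\rank L != 0%N) /\ (forall L' : 'M[R]_k, (\rank L' < \rank L)%N -> null L') /\
  (forall A, G A -> (L *m rho A <= L)%MS).
Proof.
have ex : exists d, `[< exists2 L : 'M[R]_k, \rank L = d & exists2 c, 0 < c & charged L c >].
  by exists k; apply/asboolP; exists 1%:M; [exact: mxrank1|exists 1].
have [d /asboolP[L Ld [c c0 Lc]] dmin] := ex_minnP ex.
have small (L' : 'M[R]_k) : (\rank L' < d)%N -> null L'.
  move=> L'd; case: (null_charged L') => // -[c' c'0 h].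
  have := dmin (\rank L'); rewrite leqNgt L'd => h1.
  by have : false by apply: h1; apply/asboolP; exists L' => //; exists c'.
exists c => //; exists L => //; split; first exact: charged_rank0 Lc.
rewrite Ld; split=> //.
have [rp r1 rM] := hrho.
have [r rD hr] := finite_orbit c0 small Ld Lc.
pose F B A := sqn (L *m rho A *m cokermx (L *m rho B)).
have pF B : polyfun (F B).
  apply: (@polyfun_sum _ _ _ _ _ (fun i A => \sum_j (L *m rho A *m cokermx (L *m rho B)) i j ^+ 2)) => i _.
  apply: (@polyfun_sum _ _ _ _ _ (fun j A => (L *m rho A *m cokermx (L *m rho B)) i j ^+ 2)) => j _.
  have p1 : polyfun (fun A => (L *m rho A *m cokermx (L *m rho B)) i j).
    apply: (@polyfun_mulmxr _ _ _ _ _ (fun A => L *m rho A)).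
    exact: (@polyfun_mulmxl _ _ _ _ _ rho).
  have -> : (fun A => (L *m rho A *m cokermx (L *m rho B)) i j ^+ 2) = fun A =>
     (L *m rho A *m cokermx (L *m rho B)) i j * (L *m rho A *m cokermx (L *m rho B)) i j.
    by apply/funext => A; rewrite expr2.
  by constructor.
have prod0 A : G A -> \prod_(B <- r) F B A = 0.
  apply: (Dd (polyfun_prod r pF)) => {}A hA.
  have [B Br /andP[h _]] := hr A hA.
  rewrite (big_rem B) //= /F; move: h; rewrite submxE => /eqP ->.
  by rewrite sqn0 mul0r.
have [B [_ hB]] := Sp_irreducible_prod pF prod0.
have LB A : G A -> (L *m rho A <= L *m rho B)%MS.
  by move=> hA; rewrite submxE; apply/eqP; apply: sqn_eq0; exact: hB.
have LBL : (L *m rho B <= L)%MS.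
  have h : (L <= L *m rho B)%MS by have := LB 1%:M (@Sp1 _ _); rewrite r1 mulmx1.
  have [h1 h2] := mxrank_leqif_sup h; rewrite -h2 eqn_leq h1.
  exact: mxrankM_maxl.
by move=> A hA; exact: submx_trans (LB A hA) LBL.
Qed.

Let null_genmx p (L : 'M[R]_(p, k)) : null <<L>>%MS -> null L.
Proof.
move=> h c c0; have [e e0 he] := h c c0; exists e => //.
apply: le_lt_trans he; apply: (fa_prob_mono hM); apply: cnbhsS => //.
by rewrite genmxE.
Qed.

(* Furstenberg's argument: a limit [tau] of the normalised matrices is singular
   and squeezes the mass of [L] near its kernel and its image. *)
Let bounded_on_charged c d (L : 'M[R]_(d, k)) (sigma : 'M[R]_(g + g) -> 'M[R]_d) :
  0 < c -> charged L c -> row_free L ->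
  (forall L' : 'M[R]_k, (\rank L' < d)%N -> null L') ->
  polyrep sigma -> (forall A, G A -> sigma A *m L = L *m rho A) -> (0 < d)%N ->
  exists K, forall A, D A -> sqn (sigma A) <= K.
Proof.
move=> c0 Lc Lf small hs sL d0; apply: contrapT => unb.
have step (m : nat) : exists A, D A /\ m.+1%:R < sqn (sigma A).
  apply: contrapT => h; apply: unb; exists m.+1%:R => A hA.
  by rewrite leNgt; apply/negP => hA'; apply: h; exists A.
have [A hA] := choice step.
pose s m := Num.sqrt (sqn (sigma (A m))).
have s2 m : s m ^+ 2 = sqn (sigma (A m)) by rewrite sqr_sqrtr // sqn_ge0.
have s2gt m : m.+1%:R < s m ^+ 2 by rewrite s2; have [] := hA m.
have s2pos m : 0 < s m ^+ 2 by apply: lt_trans (s2gt m); rewrite ltr0n.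
have s0 m : s m != 0 by have := s2pos m; rewrite exprn_even_gt0.
pose T m := (s m)^-1 *: sigma (A m).
have sT m : sqn (T m) = 1 by rewrite /T sqnZ -s2 exprVn mulVf // expf_neq0.
(* Since [sigma] has determinant 1, rescaling by the unbounded norms drives the determinant to 0:
   the limit [tau] is singular, yet nonzero because its norm is 1. *)
have dT m : (\det (T m)) ^+ 2 <= m.+1%:R^-1.
  rewrite /T detZ (polyrep_det hs) ?mulr1; last by apply: DG; have [] := hA m.
  rewrite -exprM mulnC exprM exprVn.
  have q0 : 0 <= (s m ^+ 2)^-1 by rewrite invr_ge0 ltW.
  have q1 : (s m ^+ 2)^-1 <= m.+1%:R^-1 by rewrite lef_pV2 ?posrE ?ltr0n // ltW.
  have q2 : (s m ^+ 2)^-1 <= 1 by apply: le_trans q1 _; rewrite invf_le1 ?ler1n.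
  apply: le_trans q1; rewrite -(prednK d0) exprS ler_piMr //.
  exact: exprn_ile1.
have [tau htau] : exists L : 'M[R]_d, forall i j, (fun m => T m i j) @ ultra_nat --> L i j.
  apply: (@bounded_ultra_mx _ _ _ 1) => m i j.
  have := sqn_entry (T m) i j; rewrite sT -[_ ^+ 2]real_normK ?num_real //.
  by rewrite expr_le1.
have tau1 : sqn tau = 1.
  apply: (ultra_cvg_unique (ultra_cvg_polyfun (@sqn_polyfun R d) htau)).
  by rewrite (_ : (fun _ => _) = fun=> 1); [exact: ultra_cvg_cst|apply/funext => m].
have pdet : polyfun (fun X : 'M[R]_d => \det X * \det X).
  have pd : polyfun (fun X : 'M[R]_d => \det X).
    apply: (@polyfun_sum _ _ _ _ _ (fun (p : 'S_d) (X : 'M[R]_d) => (-1) ^+ p * \prod_i X i (p i))) => p _.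
    constructor; first by constructor.
    by apply: (polyfun_prod _ (F := fun i (X : 'M[R]_d) => X i (p i))) => i; constructor.
  by constructor.
have tau0 : \det tau = 0.
  have h : \det tau * \det tau <= 0.
    apply: (ultra_cvg_le (ultra_cvg_polyfun pdet htau) (@ultra_cvg_invn R)) => m.
    by rewrite -expr2; exact: dT.
  by apply/eqP; rewrite -sqrf_eq0 eq_le expr2 h -expr2 sqr_ge0.
have rk : (0 < \rank tau < d)%N.
  rewrite lt0n mxrank_eq0 -sqn_gt0 tau1 ltr01 /= ltn_neqAle rank_leq_row andbT.
  apply/negP => /eqP e; have : row_free tau by rewrite /row_free e.
  by rewrite row_free_unit unitmxE unitfE tau0 eqxx.
have c3 : 0 < c / 3%:R by rewrite divr_gt0.
have [e1 e10 he1] : exists2 e, 0 < e & M (cnbhs (kermx tau *m L) e) < c / 3%:R.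
  have h : null (kermx tau *m L).
    apply: null_genmx; apply: small; rewrite genmxE mxrankMfree // mxrank_ker.
    by have /andP[] := rk; lia.
  exact: h.
have [e2 e20 he2] : exists2 e, 0 < e & M (cnbhs (tau *m L) (2 * e)) < c / 3%:R.
  have h : null (tau *m L).
    by apply: null_genmx; apply: small; rewrite genmxE mxrankMfree //; have /andP[] := rk.
  have [e e0 he] := h _ c3.
  by exists (e / 2); [rewrite divr_gt0|rewrite mulrC divfK].
have [C1 C10 hC1] := dist_kernel tau.
set b := sqn L; set b' := sqn (pinvmx L).
have b0 : 0 <= b by exact: sqn_ge0.
have b'0 : 0 <= b' by exact: sqn_ge0.
have kd : 0 < 4 * C1 * b + 1 by rewrite ltr_wpDl // !mulr_ge0 // ltW.
(* The constants [kap], [zeta] and [del] are solved from the equations assumed in [kernel_estimate]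
   and [contraction_estimate]. *)
have [kap kap0 hk] : exists2 kap, 0 < kap & kap * (4 * C1 * b + 1) = e1.
  by exists (e1 / (4 * C1 * b + 1)); [rewrite divr_gt0|rewrite divfK // gt_eqF].
have zd : 0 < 2 * (b' + 1) * (1 + e2) by rewrite !mulr_gt0 // ltr_wpDl // ltW.
have [zeta zeta0 hz] : exists2 zeta, 0 < zeta & zeta * (2 * (b' + 1) * (1 + e2)) = e2 * kap.
  exists (e2 * kap / (2 * (b' + 1) * (1 + e2))); first by rewrite divr_gt0 // mulr_gt0.
  by rewrite divfK // gt_eqF.
have dd : 0 < 2 * (8 * b' * b + 1) by rewrite mulr_gt0 // ltr_wpDl // !mulr_ge0.
have [del del0 hd] : exists2 del, 0 < del & del * (2 * (8 * b' * b + 1)) = zeta.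
  by exists (zeta / (2 * (8 * b' * b + 1))); [rewrite divr_gt0|rewrite divfK // gt_eqF].
have [m hm] : exists m, sqn (T m - tau) < del.
  have pq : polyfun (fun X : 'M[R]_d => sqn (X - tau)).
    apply: (@polyfun_sum _ _ _ _ _ (fun i (X : 'M[R]_d) => \sum_j (X - tau) i j ^+ 2)) => i _.
    apply: (@polyfun_sum _ _ _ _ _ (fun j (X : 'M[R]_d) => (X - tau) i j ^+ 2)) => j _.
    rewrite (_ : (fun _ => _) = fun X : 'M[R]_d => (X i j + - tau i j) * (X i j + - tau i j)).
      by do !constructor.
    by apply/funext => X; rewrite expr2 !mxE.
  apply: contrapT => h.
  have : del <= sqn (tau - tau).
    apply: (ultra_cvg_le (@ultra_cvg_cst _ _) (ultra_cvg_polyfun pq htau)) => m.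
    by rewrite leNgt; apply/negP => h'; apply: h; exists m.
  by rewrite subrr sqn0 leNgt del0.
have [DA sA] := hA m.
set S := s m ^+ 2; have S0 : 0 < S by exact: s2pos.
set r := sqn (rho (A m)); have r0 : 0 <= r by exact: sqn_ge0.
have rd : 0 < 4 * (r + 1) by rewrite mulr_gt0 // ltr_wpDl.
(* This scale comes last, as it depends on m through r and S; that is allowed because L keeps mass c
   at every scale. *)
have [eps eps0 [eps1 eps2 eps3]] : exists2 eps, 0 < eps &
    [/\ eps <= 1, eps <= e1 / 4 & eps * (4 * (r + 1)) <= zeta * S].
  exists (Num.min (Num.min 1 (e1 / 4)) (zeta * S / (4 * (r + 1)))).
    by rewrite !lt_min ltr01 !divr_gt0 // mulr_gt0.
  by rewrite -ler_pdivlMr // !ge_min !lexx !orbT.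
(* With u close to x = a L: unless u is near the kernel directions, a tau is large enough for y = s
   (a tau L) to dominate the error in u rho(A m). *)
have sub : cnbhs L eps `<=` cnbhs (kermx tau *m L) e1 `|`
    [set u | cnbhs (tau *m L) (2 * e2) (u *m rho (A m))].
  move=> u [u0 [x [xL hx]]].
  have [h|h] := pselect (cnbhs (kermx tau *m L) e1 u); [by left|right].
  have [a xa] := submxP xL.
  set U := sqn u in hx; have U0 : 0 < U by rewrite /U sqn_gt0.
  have [z za hza] := hC1 a.
  have h1 : e1 * U <= sqn (u - z *m L).
    rewrite leNgt; apply/negP => h1; apply: h; split=> //.
    by exists (z *m L); split=> //; apply: submxMr; apply/sub_kermxP.
  have h2 : sqn (u - z *m L) <= 2 * (sqn (u - x) + sqn (x - z *m L)).
    by have := sqnD_le (u - x) (x - z *m L); rewrite subrKA.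
  have h3 : sqn (x - z *m L) <= C1 * sqn (a *m tau) * b.
    rewrite xa -mulmxBl; apply: le_trans (sqnM _ _) _.
    by apply: ler_wpM2r.
  set q := sqn (a *m tau) in hza h3; have q0 : 0 <= q by exact: sqn_ge0.
  have h4 : kap * U <= q.
    exact: (kernel_estimate kd U0 hk kap0 eps2 hx q0 h1 h2 h3).
  pose w := u *m rho (A m); pose y := s m *: (a *m tau *m L).
  have wy : w - y = (u - x) *m rho (A m) + s m *: (a *m (T m - tau) *m L).
    have hx' : x *m rho (A m) = s m *: (a *m T m *m L).
      rewrite xa -(mulmxA a L) -(sL _ (DG DA)).
      by rewrite /T -!scalemxAr -scalemxAl scalerA divff // scale1r mulmxA.
    by rewrite mulmxBl hx' mulmxBr mulmxBl scalerBr addrA subrK.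
  have h8 : sqn (w - y) <= 2 * (sqn (u - x) * r + S * (sqn a * sqn (T m - tau) * b)).
    rewrite wy; apply: le_trans (sqnD_le _ _) _; rewrite ler_pM2l //.
    apply: lerD; first exact: sqnM.
    rewrite sqnZ ler_pM2l //; apply: le_trans (sqnM _ _) _.
    by apply: ler_wpM2r => //; exact: sqnM.
  have aE (v : 'rV[R]_d) : v = v *m L *m pinvmx L by rewrite -mulmxA mulmxVp // mulmx1.
  have h9 : sqn a <= 4 * U * b'.
    rewrite {1}(aE a) -xa; apply: le_trans (sqnM _ _) _; apply: ler_wpM2r => //.
    have := sqnD_le (x - u) u; rewrite subrK => h9; apply: (le_trans h9).
    have -> : sqn (x - u) = sqn (u - x) by rewrite -opprB -scaleN1r sqnZ sqrrN expr1n mul1r.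
    have : eps * U <= U by rewrite ler_piMl // ltW.
    by rewrite -/U; lra.
  have h10 : q <= sqn (a *m tau *m L) * (b' + 1).
    rewrite /q {1}(aE (a *m tau)); apply: le_trans (sqnM _ _) _.
    by rewrite ler_wpM2l ?sqn_ge0 // lerDl.
  have h11 : sqn y = S * sqn (a *m tau *m L) by rewrite sqnZ.
  have sw : sqn y <= 2 * (sqn w + sqn (w - y)).
    have := sqnD_le w (y - w); rewrite addrC subrK.
    by have -> : sqn (y - w) = sqn (w - y) by rewrite -opprB -scaleN1r sqnZ sqrrN expr1n mul1r.
  have [h16 w0] := contraction_estimate e20 kap0 b0 b'0 S0 U0 r0 del0 eps0 (sqn_ge0 _)
    (sqn_ge0 _) hz hd eps3 hx hm h4 h8 h9 h10 h11 (sqn_ge0 _) (sqn_ge0 _) sw.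
  split; first by rewrite -sqn_gt0.
  exists y; split; first by apply: scalemx_sub; rewrite -mulmxA submxMl.
  rewrite -/w; apply: (le_lt_trans h16); rewrite (ltr_pM2r w0).
  by rewrite ltr_pMl // ltr1n.
(* The two covering sets have mass below c/3 each, the second one by invariance of M, against mass
   at least c for the neighborhood of L. *)
have := fa_prob_mono hM sub; have := Lc eps eps0.
have := fa_probU_le hM (cnbhs (kermx tau *m L) e1) [set u | cnbhs (tau *m L) (2 * e2) (u *m rho (A m))].
rewrite (Minv DA (@cnbhs_cone _ _ _ (tau *m L) (2 * e2))).
by lra.
Qed.

(** On the invariant subspace carrying mass the representation is bounded on D, hence trivial, so
    every row of its basis is fixed. *)
Lemma invariant_mean_fixed : exists2 y : 'rV[R]_k, y != 0 & forall A, G A -> y *m rho A = y.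
Proof.
have [c c0 [L Lc [L0 [small Linv]]]] := charged_invariant.
pose B := row_base L.
have Bf : row_free B := row_base_free L.
have Binv A : G A -> (B *m rho A <= B)%MS.
  move=> hA; apply: submx_trans (submxMr _ _) _; first by rewrite eq_row_base.
  by apply: submx_trans (Linv A hA) _; rewrite eq_row_base.
have hs := subrep_polyrep hrho Bf Binv.
have sB A : G A -> subrep rho B A *m B = B *m rho A by exact: subrepE.
have Bc : charged B c by apply: charged_sub Lc; rewrite eq_row_base.
have [K hK] := bounded_on_charged c0 Bc Bf small hs sB (ltac:(by rewrite lt0n)).
have triv := bounded_polyrep_trivial hs DG Dd D1 DM DV hK.
have d0 : (0 < \rank L)%N by rewrite lt0n.
exists (row (Ordinal d0) B).
  apply/eqP; rewrite rowE => h.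
  have := row_free_inj Bf (etrans h (esym (mul0mx _ B))) => /matrixP/(_ ord0 (Ordinal d0)).
  by rewrite !mxE !eqxx => /eqP; rewrite oner_eq0.
by move=> A hA; rewrite -row_mul -sB // triv // mul1mx.
Qed.

End InvariantMean.

(** * Spectral gap *)

Section Gap.
Variables (R : realType) (Y : choiceType).

(** Finitely supported functions stand for l^2, so that all sums are finite. *)
Definition fsupp (f : Y -> R) := exists A : {fset Y}, forall y, y \notin A -> f y = 0.

Definition total (f : Y -> R) : R := \sum_(y \in [set: Y]) f y.

Lemma totalE (A : {fset Y}) f : (forall y, y \notin A -> f y = 0) ->
  total f = \sum_(y <- A) f y.
Proof. by move=> h; rewrite /total; exact: fsbigTE. Qed.

Lemma fsupp2 f h : fsupp f -> fsupp h -> exists A : {fset Y},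
  (forall y, y \notin A -> f y = 0) /\ (forall y, y \notin A -> h y = 0).
Proof.
move=> [A hA] [B hB]; exists (A `|` B)%fset.
by split=> y; rewrite in_fsetU negb_or => /andP[yA yB]; [exact: hA|exact: hB].
Qed.

Lemma fsupp0 : fsupp (fun=> 0).
Proof. by exists fset0. Qed.

Lemma fsuppD f h : fsupp f -> fsupp h -> fsupp (fun y => f y + h y).
Proof.
move=> hf hh; have [A [h1 h2]] := fsupp2 hf hh.
by exists A => y yA; rewrite h1 // h2 // addr0.
Qed.

Lemma fsuppM f h : fsupp f -> fsupp (fun y => f y * h y).
Proof. by move=> [A hA]; exists A => y yA; rewrite hA // mul0r. Qed.

Lemma fsuppMl f h : fsupp f -> fsupp (fun y => h y * f y).
Proof. by move=> [A hA]; exists A => y yA; rewrite hA // mulr0. Qed.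

Lemma fsuppX2 f : fsupp f -> fsupp (fun y => f y ^+ 2).
Proof. by move=> [A hA]; exists A => y yA; rewrite hA // expr0n. Qed.

Lemma fsupp_sum (I : Type) (r : seq I) (F : I -> Y -> R) :
  (forall i, fsupp (F i)) -> fsupp (fun y => \sum_(i <- r) F i y).
Proof.
move=> h; elim: r => [|i r ih].
  by have [A hA] := fsupp0; exists A => y _; rewrite big_nil.
have [A hA] := fsuppD (h i) ih; exists A => y yA.
by rewrite big_cons hA.
Qed.

Lemma fsupp_comp (t s : Y -> Y) f : cancel t s -> fsupp f -> fsupp (fun y => f (t y)).
Proof.
move=> ts [A hA]; exists [fset s y | y in A]%fset => y yA; apply: hA.
by apply: contra yA => tA; apply/imfsetP; exists (t y) => //=; rewrite ts.
Qed.

Lemma eq_total f h : f =1 h -> total f = total h.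
Proof. by move=> /funext ->. Qed.

Lemma totalD f h : fsupp f -> fsupp h -> total (fun y => f y + h y) = total f + total h.
Proof.
move=> hf hh; have [A [h1 h2]] := fsupp2 hf hh.
rewrite (totalE h1) (totalE h2) (@totalE A) ?big_split // => y yA.
by rewrite h1 // h2 // addr0.
Qed.

Lemma totalZ a f : fsupp f -> total (fun y => a * f y) = a * total f.
Proof.
move=> [A hA]; rewrite (totalE hA) (@totalE A) ?mulr_sumr // => y yA.
by rewrite hA // mulr0.
Qed.

Lemma total_sum (I : Type) (r : seq I) (F : I -> Y -> R) :
  (forall i, fsupp (F i)) ->
  total (fun y => \sum_(i <- r) F i y) = \sum_(i <- r) total (F i).
Proof.
move=> h; elim: r => [|i r ih].
  by rewrite big_nil (@totalE fset0) => [|y _]; rewrite big_nil.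
rewrite big_cons -ih -totalD //; last exact: fsupp_sum.
by apply: eq_total => y; rewrite big_cons.
Qed.

Lemma total_le f h : fsupp f -> fsupp h -> (forall y, f y <= h y) -> total f <= total h.
Proof.
move=> hf hh le; have [A [h1 h2]] := fsupp2 hf hh.
by rewrite (totalE h1) (totalE h2); exact: ler_sum.
Qed.

Lemma total_ge0 f : (forall y, 0 <= f y) -> 0 <= total f.
Proof. by move=> h; exact: fsumr_ge0. Qed.

Lemma total_comp (t s : Y -> Y) f : cancel t s -> cancel s t ->
  total (fun y => f (t y)) = total f.
Proof. by move=> ts st; rewrite /total [RHS](reindex_fsbigT t) //; exists s. Qed.

Lemma total_delta (y0 : Y) (f : Y -> R) : total (fun y => (y == y0)%:R * f y) = f y0.
Proof.
rewrite (@totalE [fset y0]%fset) => [|y]; last first.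
  by rewrite in_fset1 => /negbTE ->; rewrite mul0r.
by rewrite big_seq_fset1 eqxx mul1r.
Qed.

Variables (I : finType) (t s : I -> Y -> Y).
Hypotheses (tK : forall i, cancel (t i) (s i)) (sK : forall i, cancel (s i) (t i)).

Let N : R := #|I|%:R.

Lemma sum_sqr_diff (a : I -> R) :
  \sum_i \sum_j (a i - a j) ^+ 2 = 2 * N * (\sum_i a i ^+ 2) - 2 * (\sum_i a i) ^+ 2.
Proof.
have -> : \sum_i \sum_j (a i - a j) ^+ 2 =
   \sum_(i : I) \sum_(j : I) a i ^+ 2 + \sum_(i : I) \sum_(j : I) a j ^+ 2
   - 2 * \sum_i \sum_j a i * a j.
  rewrite mulr_sumr -big_split -sumrB; apply: eq_bigr => i _ /=.
  rewrite mulr_sumr -big_split -sumrB; apply: eq_bigr => j _ /=; ring.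
rewrite [X in _ + X - _]exchange_big /= -big_distrlr /= expr2.
have -> : \sum_i \sum_(j : I) a i ^+ 2 = N * \sum_i a i ^+ 2.
  by rewrite mulr_sumr; apply: eq_bigr => i _; rewrite sumr_const -mulr_natl.
by ring.
Qed.

(** The t i preserve the l^2 norm, so the failure of contraction for the summed translates is
    exactly their mutual closeness. *)
Lemma total_sqr_diff f : fsupp f ->
  \sum_i \sum_j total (fun y => (f (t i y) - f (t j y)) ^+ 2) =
  2 * N ^+ 2 * total (fun y => f y ^+ 2) -
  2 * total (fun y => (\sum_i f (t i y)) ^+ 2).
Proof.
move=> hf.
have ft i : fsupp (fun y => f (t i y)) by apply: fsupp_comp hf.
have fN i : fsupp (fun y => - f (t i y)).
  by have [A hA] := ft i; exists A => y yA; rewrite hA // oppr0.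
have f2 i j : fsupp (fun y => (f (t i y) - f (t j y)) ^+ 2).
  by apply: fsuppX2; exact: fsuppD.
have fs : fsupp (fun y => (\sum_i f (t i y)) ^+ 2) by apply: fsuppX2; exact: fsupp_sum.
transitivity (total (fun y => \sum_i \sum_j (f (t i y) - f (t j y)) ^+ 2)).
  rewrite total_sum => [|i]; last exact: fsupp_sum.
  by apply: eq_bigr => i _; rewrite total_sum.
transitivity (total (fun y => 2 * N * (\sum_i f (t i y) ^+ 2) + (- 2) * (\sum_i f (t i y)) ^+ 2)).
  by apply: eq_total => y; rewrite sum_sqr_diff mulNr.
have fss : fsupp (fun y => \sum_i f (t i y) ^+ 2).
  by apply: fsupp_sum => i; exact: fsuppX2.
rewrite totalD; [|exact: fsuppMl|exact: fsuppMl].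
rewrite !totalZ // mulNr; congr (_ - _).
rewrite total_sum => [|i]; last exact: fsuppX2.
rewrite (eq_bigr (fun=> total (fun y => f y ^+ 2))) => [|i _]; last first.
  exact: (total_comp (fun y => f y ^+ 2) (tK i) (sK i)).
by rewrite sumr_const -mulr_natl -/N; ring.
Qed.

Definition ind (A : set Y) (y : Y) : R := (`[< A y >])%:R.

Lemma ind01 A y : 0 <= ind A y <= 1.
Proof. by rewrite /ind; case: asbool; rewrite ?lexx ?ler01. Qed.

(** The product (a - b)(a + b) is split by the weighted AM-GM inequality. The free weight l plays
    the role of the square roots in Cauchy-Schwarz. *)
Lemma almost_invariant f A i j (l : R) : fsupp f -> 0 < l ->
  `|total (fun y => f y ^+ 2 * ind A (s i y)) - total (fun y => f y ^+ 2 * ind A (s j y))|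
  <= (l * total (fun y => (f (t i y) - f (t j y)) ^+ 2) + l^-1 * (4 * total (fun y => f y ^+ 2))) / 2.
Proof.
move=> hf l0.
have ft i' : fsupp (fun y => f (t i' y)) by apply: fsupp_comp hf.
have fN i' : fsupp (fun y => - f (t i' y)).
  by have [B hB] := ft i'; exists B => y yB; rewrite hB // oppr0.
have E i' : total (fun y => f y ^+ 2 * ind A (s i' y)) = total (fun y => f (t i' y) ^+ 2 * ind A y).
  rewrite -(total_comp (fun y => f y ^+ 2 * ind A (s i' y)) (tK i') (sK i')).
  by apply: eq_total => y; rewrite tK.
have F i' : total (fun y => f (t i' y) ^+ 2) = total (fun y => f y ^+ 2).
  exact: (total_comp (fun y => f y ^+ 2) (tK i') (sK i')).
have S1 i' : fsupp (fun y => f (t i' y) ^+ 2) by exact: fsuppX2.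
have S2 : fsupp (fun y => (f (t i y) - f (t j y)) ^+ 2) by apply: fsuppX2; exact: fsuppD.
pose h y := 2^-1 * (l * (f (t i y) - f (t j y)) ^+ 2 + l^-1 * (2 * f (t i y) ^+ 2 + 2 * f (t j y) ^+ 2)).
have hh : fsupp h.
  by apply: fsuppMl; apply: fsuppD; apply: fsuppMl => //; apply: fsuppD; exact: fsuppMl.
have Th : total h = (l * total (fun y => (f (t i y) - f (t j y)) ^+ 2) + l^-1 * (4 * total (fun y => f y ^+ 2))) / 2.
  rewrite /h totalZ; last first.
    by apply: fsuppD; apply: fsuppMl => //; apply: fsuppD; exact: fsuppMl.
  rewrite totalD; [|exact: fsuppMl|by apply: fsuppMl; apply: fsuppD; exact: fsuppMl].
  rewrite !totalZ //; last by apply: fsuppD; exact: fsuppMl.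
  rewrite totalD; [|exact: fsuppMl|exact: fsuppMl].
  by rewrite !totalZ // !F mulrC; congr (_ / 2); ring.
rewrite !E -Th.
have key i' j' y : (f (t i' y) ^+ 2 * ind A y) - f (t j' y) ^+ 2 * ind A y <=
   2^-1 * (l * (f (t i' y) - f (t j' y)) ^+ 2 + l^-1 * (2 * f (t i' y) ^+ 2 + 2 * f (t j' y) ^+ 2)).
  set a := f _; set b := f _; rewrite -mulrBl.
  have amgm : a ^+ 2 - b ^+ 2 <= 2^-1 * (l * (a - b) ^+ 2 + l^-1 * (2 * a ^+ 2 + 2 * b ^+ 2)).
    have q1 : 0 <= l * ((a - b) - l^-1 * (a + b)) ^+ 2 by rewrite mulr_ge0 ?sqr_ge0 // ltW.
    have q2 : l * ((a - b) - l^-1 * (a + b)) ^+ 2 = l * (a - b) ^+ 2 - 2 * (a ^+ 2 - b ^+ 2) + l^-1 * (a + b) ^+ 2.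
      by field; rewrite gt_eqF.
    have q3 : l^-1 * (a + b) ^+ 2 <= l^-1 * (2 * a ^+ 2 + 2 * b ^+ 2).
      by rewrite ler_pM2l ?invr_gt0 //; have := sqr_ge0 (a - b); rewrite !sqrrD sqrrN; lra.
    by lra.
  have nn : 0 <= 2^-1 * (l * (a - b) ^+ 2 + l^-1 * (2 * a ^+ 2 + 2 * b ^+ 2)).
    have il : 0 <= l^-1 by rewrite invr_ge0 ltW.
    have a2 := sqr_ge0 a; have b2 := sqr_ge0 b; have ab2 := sqr_ge0 (a - b).
    have p1 := mulr_ge0 (ltW l0) ab2.
    have p2 : 0 <= l^-1 * (2 * a ^+ 2 + 2 * b ^+ 2) by apply: mulr_ge0 => //; lra.
    by lra.
  by rewrite /ind; case: asbool; rewrite ?mulr1 ?mulr0.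
have T1 : fsupp (fun y => f (t i y) ^+ 2 * ind A y) by exact: fsuppM.
have T2 : fsupp (fun y => f (t j y) ^+ 2 * ind A y) by exact: fsuppM.
rewrite ler_norml; apply/andP; split.
  rewrite lerNl opprB lerBlDr -totalD //; apply: total_le => //; first exact: fsuppD.
  move=> y; rewrite -lerBlDr; apply: le_trans (key j i y) _.
  rewrite /h; have -> : (f (t j y) - f (t i y)) ^+ 2 = (f (t i y) - f (t j y)) ^+ 2 by ring.
  by rewrite (addrC (2 * f (t j y) ^+ 2)).
rewrite lerBlDr -totalD //; apply: total_le => //; first exact: fsuppD.
by move=> y; rewrite -lerBlDr; exact: key.
Qed.

Variable (i0 : I) (Y0 : set Y).

(** Without a gap, the probabilities with densities f_k^2 converge along the ultrafilter. Translates
    are compared only with each other, so M is the same after s i as after s j, which says nothing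
    of M itself. *)
Theorem l2_gap :
  ~ (exists M : set Y -> R, [/\ fa_prob M, M (~` Y0) = 0 &
       forall i j A, M [set y | A (s i y)] = M [set y | A (s j y)]]) ->
  exists2 r : R, 0 < r < 1 & forall f, fsupp f -> (forall y, ~ Y0 y -> f y = 0) ->
    total (fun y => (\sum_i f (t i y)) ^+ 2) <= r * N ^+ 2 * total (fun y => f y ^+ 2).
Proof.
move=> noM; apply: contrapT => nogap; apply: noM.
have N0 : 0 < N by rewrite ltr0n; apply/card_gt0P; exists i0.
have step (k : nat) : exists f, [/\ fsupp f, (forall y, ~ Y0 y -> f y = 0),
   total (fun y => f y ^+ 2) = 1 & forall i j,
   total (fun y => (f (t i y) - f (t j y)) ^+ 2) <= 2 * N ^+ 2 * k.+1%:R^-1].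
  (* The shift by 2 keeps r positive at k = 0. *)
  pose r : R := 1 - k.+2%:R^-1.
  have k1 : k.+2%:R^-1 < 1 :> R by rewrite invf_lt1 ?ltr1n.
  have r01 : 0 < r < 1.
    by rewrite subr_gt0 k1 /= ltrBlDr ltrDl invr_gt0 ltr0n.
  have [f [hf f0 big]] : exists f, [/\ fsupp f, (forall y, ~ Y0 y -> f y = 0) &
      r * N ^+ 2 * total (fun y => f y ^+ 2) < total (fun y => (\sum_i f (t i y)) ^+ 2)].
    apply: contrapT => h; apply: nogap; exists r => // f hf f0.
    by rewrite leNgt; apply/negP => h'; apply: h; exists f.
  have d0 i j : 0 <= total (fun y => (f (t i y) - f (t j y)) ^+ 2).
    by apply: total_ge0 => y; exact: sqr_ge0.
  have e := total_sqr_diff hf.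
  have e0 : 0 <= \sum_i \sum_j total (fun y => (f (t i y) - f (t j y)) ^+ 2).
    by apply: sumr_ge0 => i _; apply: sumr_ge0.
  set Q := total (fun y => f y ^+ 2) in big e.
  have Qge : 0 <= Q by apply: total_ge0 => y; exact: sqr_ge0.
  have Q0 : 0 < Q.
    rewrite lt_neqAle Qge andbT; apply/eqP => Q0.
    by move: big; rewrite -Q0 mulr0 => big; rewrite -Q0 mulr0 in e; lra.
  exists (fun y => (Num.sqrt Q)^-1 * f y).
  have sq : (Num.sqrt Q)^-1 ^+ 2 = Q^-1 by rewrite exprVn sqr_sqrtr.
  split.
  - exact: fsuppMl.
  - by move=> y /f0 ->; rewrite mulr0.
  - transitivity (total (fun y => Q^-1 * f y ^+ 2)).
      by apply: eq_total => y; rewrite exprMn sq.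
    by rewrite totalZ; [rewrite mulVf ?gt_eqF|exact: fsuppX2].
  move=> i j.
  have -> : total (fun y => ((Num.sqrt Q)^-1 * f (t i y) - (Num.sqrt Q)^-1 * f (t j y)) ^+ 2) =
      Q^-1 * total (fun y => (f (t i y) - f (t j y)) ^+ 2).
    transitivity (total (fun y => Q^-1 * (f (t i y) - f (t j y)) ^+ 2)).
      by apply: eq_total => y; rewrite -mulrBr exprMn sq.
    rewrite totalZ //; apply: fsuppX2; apply: fsuppD; first exact: fsupp_comp hf.
    have [B hB] := fsupp_comp (tK j) hf; by exists B => y yB; rewrite hB // oppr0.
  rewrite ler_pdivrMl //.
  have le1 : total (fun y => (f (t i y) - f (t j y)) ^+ 2) <=
     \sum_i \sum_j total (fun y => (f (t i y) - f (t j y)) ^+ 2).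
    rewrite [leRHS](bigD1 i) //= (bigD1 j) //= -addrA lerDl addr_ge0 //.
      exact: sumr_ge0.
    by apply: sumr_ge0 => i' _; exact: sumr_ge0.
  apply: (le_trans le1); rewrite e.
  have -> : 2 * N ^+ 2 * Q - 2 * total (fun y => (\sum_i f (t i y)) ^+ 2) =
     2 * (N ^+ 2 * Q - total (fun y => (\sum_i f (t i y)) ^+ 2)) by ring.
  have h1 : N ^+ 2 * Q - total (fun y => (\sum_i f (t i y)) ^+ 2) <= k.+2%:R^-1 * (N ^+ 2 * Q).
    by move: (ltW big); rewrite /r mulrBl mul1r mulrBl -(mulrA k.+2%:R^-1) lerBlDr lerBlDl addrC.
  have h2 : k.+2%:R^-1 * (N ^+ 2 * Q) <= k.+1%:R^-1 * (N ^+ 2 * Q).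
    apply: ler_wpM2r; first by rewrite mulr_ge0 // sqr_ge0.
    by rewrite lef_pV2 ?posrE ?ltr0n // ler_nat.
  have -> : Q * (2 * N ^+ 2 * k.+1%:R^-1) = 2 * (k.+1%:R^-1 * (N ^+ 2 * Q)) by ring.
  by rewrite ler_pM2l // (le_trans h1).
have [f hf] := choice step.
pose m A k := total (fun y => f k y ^+ 2 * ind A y).
have Sf k A : fsupp (fun y => f k y ^+ 2 * ind A y).
  by have [h _ _ _] := hf k; apply: fsuppM; exact: fsuppX2.
have m01 A k : 0 <= m A k <= 1.
  have [h _ h1 _] := hf k; rewrite /m total_ge0 => [|y] /=; last first.
    by rewrite mulr_ge0 ?sqr_ge0 //; have /andP[] := ind01 A y.
  rewrite -h1; apply: total_le => // [|y]; first exact: fsuppX2.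
  by rewrite ler_piMr ?sqr_ge0 //; have /andP[] := ind01 A y.
have mc A : exists l : R, m A @ ultra_nat --> l.
  apply: (@bounded_ultra_cvg _ _ 1) => k.
  by have /andP[h1 h2] := m01 A k; rewrite ger0_norm.
have [M hM] := choice mc.
exists M; split.
- split.
  + move=> A; apply: (ultra_cvg_le (@ultra_cvg_cst _ _) (hM A)) => k.
    by have /andP[] := m01 A k.
  + apply: (ultra_cvg_unique (hM setT)).
    rewrite (_ : m setT = fun=> 1); first exact: ultra_cvg_cst.
    apply/funext => k; have [_ _ h1 _] := hf k; rewrite -h1 /m.
    by apply: eq_total => y; rewrite /ind asboolT // mulr1.
  + move=> A B AB; apply: (ultra_cvg_unique (hM (A `|` B))).
    rewrite (_ : m (A `|` B) = fun k => m A k + m B k); first exact: cvgD.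
    apply/funext => k; rewrite /m -totalD //; apply: eq_total => y.
    rewrite -mulrDr; congr (_ * _); rewrite /ind -natrD; congr (_%:R).
    have : ~ (A y /\ B y) by move=> h; have : (A `&` B) y by []; rewrite AB.
    by case: asboolP => [[]|]; do 2!case: asboolP => //=; rewrite /setU /=; tauto.
- apply: (ultra_cvg_unique (hM _)).
  rewrite (_ : m _ = fun=> 0); first exact: ultra_cvg_cst.
  apply/funext => k; have [_ h _ _] := hf k; rewrite /m (@totalE fset0) ?big_nil // => y _.
  rewrite /ind; case: asboolP => [/h ->|_]; last by rewrite mulr0.
  by rewrite expr0n mul0r.
move=> i j A; apply/eqP; rewrite -subr_eq0 -normr_le0.
(* For fixed l the term with 1/(k + 1) vanishes in the limit and 2 / l remains. *)
have bd (l : R) : 0 < l -> `|M [set y | A (s i y)] - M [set y | A (s j y)]| <= 2 / l.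
  move=> l0.
  have c1 : (fun k => `|m [set y | A (s i y)] k - m [set y | A (s j y)] k|) @ ultra_nat -->
     `|M [set y | A (s i y)] - M [set y | A (s j y)]|.
    by apply: cvg_norm; apply: cvgB; exact: hM.
  have c2 : (fun k : nat => l * N ^+ 2 * k.+1%:R^-1 + 2 / l) @ ultra_nat --> (l * N ^+ 2 * 0 + 2 / l).
    apply: cvgD; last exact: ultra_cvg_cst.
    by apply: cvgM; [exact: ultra_cvg_cst|exact: ultra_cvg_invn].
  rewrite mulr0 add0r in c2; apply: (ultra_cvg_le c1 c2) => k.
  have [h _ h1 h2] := hf k.
  apply: le_trans (almost_invariant A i j h l0) _.
  have h3 := ler_wpM2l (ltW l0) (h2 i j).
  have -> : l * N ^+ 2 * k.+1%:R^-1 + 2 / l =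
    (l * (2 * N ^+ 2 * k.+1%:R^-1) + l^-1 * (4 * 1)) / 2.
    by move: (k.+1%:R^-1) (l^-1) => x z; field.
  by rewrite h1 ler_pM2r ?invr_gt0 // lerD2r.
rewrite leNgt; apply/negP => pos.
set d := `|_| in bd pos.
(* With l = 4 / d the bound reads d <= d / 2. *)
have d4 : 0 < 4 / d by rewrite divr_gt0.
have := bd (4 / d) d4.
rewrite invf_div mulrCA; have : 0 < d by []; lra.
Qed.

End Gap.

(** * Action on subspaces *)

Lemma polyfun_mull (R : comNzRingType) n (B : 'M[R]_n) p :
  polyfun p -> polyfun (fun A => p (B *m A)).
Proof.
elim=> [c|i j|{}p q _ hp _ hq|{}p q _ hp _ hq]; [by constructor| |by constructor|by constructor].
by apply: (@polyfun_mulmxl _ _ _ _ _ id) => i' j'; constructor.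
Qed.

Section Generators.
Variables (R : realType) (g : nat) (Gamma : set 'M[int]_(g + g))
  (S : {fset 'M[int]_(g + g)}).
Hypotheses (GammaSp : subgroup_of_SpZ Gamma) (S_sym : symmetric_set S)
  (S_gen : generated_by Gamma S) (Gamma_dense : zariski_dense_in_Sp R Gamma).
Local Notation G := (Sp R g).

Definition realmx (A : 'M[int]_(g + g)) : 'M[R]_(g + g) := map_mx (fun m : int => m%:~R) A.

Lemma realmxM A B : realmx (A *m B) = realmx A *m realmx B.
Proof. exact: (map_mxM (intmul (1 : R))). Qed.

Lemma realmx1 : realmx 1%:M = 1%:M.
Proof. exact: (map_mx1 (intmul (1 : R))). Qed.

Lemma realmx_Sp A : Sp int g A -> G (realmx A).
Proof.
move=> hA; have := congr1 (map_mx (intmul (1 : R))) hA.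
rewrite !map_mxM -map_trmx /Sp /=.
by rewrite /symplectic_form map_block_mx map_mxN !raddf0 !map_mx1.
Qed.

Lemma realmxV A : Sp int g A -> realmx (invmx A) = invmx (realmx A).
Proof.
move=> hA; have rU := Sp_unit (realmx_Sp hA); apply: (can_inj (mulKmx rU)).
by rewrite -realmxM (mulmxV (Sp_unit hA)) realmx1 mulmxV.
Qed.

Lemma gen_SpZ (i : S) : Sp int g (val i).
Proof. by have [sub _ _ _] := GammaSp; have [inG _] := S_gen; apply/sub/inG/valP. Qed.

Definition step (i : S) : 'M[R]_(g + g) := realmx (val i).

Lemma step_Sp i : G (step i).
Proof. exact/realmx_Sp/gen_SpZ. Qed.

Lemma step_inv i : exists j, step j = invmx (step i).
Proof. by exists [` S_sym (valP i)]%fset; rewrite /step /= realmxV //; exact: gen_SpZ. Qed.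

Definition seq_prod (l : seq S) : 'M[int]_(g + g) := foldr (fun i A => val i *m A) 1%:M l.

Lemma seq_prod_cat l l' : seq_prod (l ++ l') = seq_prod l *m seq_prod l'.
Proof. by elim: l => [|i l ih] /=; rewrite ?mul1mx // ih mulmxA. Qed.

Lemma seq_prod_Sp l : Sp int g (seq_prod l).
Proof.
elim: l => [|i l ih] /=; first by rewrite /Sp /= trmx1 mul1mx mulmx1.
rewrite /Sp /= trmx_mul -!mulmxA (mulmxA _ (val i)) (mulmxA (val i)^T).
by rewrite (mulmxA (val i)^T) (gen_SpZ i : _ *m _ *m _ = _) mulmxA.
Qed.

Lemma Gamma_seq_prod A : Gamma A -> exists l, A = seq_prod l.
Proof.
have [_ Smin] := S_gen; apply: (Smin [set A | exists l, A = seq_prod l]).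
  split.
  - by move=> _ [l ->]; exact: seq_prod_Sp.
  - by exists [::].
  - by move=> _ _ [l ->] [l' ->]; exists (l ++ l'); rewrite seq_prod_cat.
  move=> _ [l ->]; elim: l => [|i l [l' ih]]; first by exists [::]; rewrite /= invmx1.
  exists (l' ++ [:: [` S_sym (valP i)]%fset]); rewrite seq_prod_cat -ih /= mulmx1.
  have iU := Sp_unit (gen_SpZ i); have lU := Sp_unit (seq_prod_Sp l).
  have U : val i *m seq_prod l \in unitmx by exact: Sp_unit (seq_prod_Sp (i :: l)).
  apply: (can_inj (mulKmx U)); rewrite mulmxV // -mulmxA (mulmxA (seq_prod l)) mulmxV //.
  by rewrite mul1mx mulmxV.
by move=> A' hA; exists [:: [` hA]%fset]; rewrite /= mulmx1.
Qed.

(* If [p] vanishes on the words of even length and [i0] is a generator, then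
   [A |-> p A * p (i0 A)] vanishes on [Gamma], so one of the factors vanishes. *)
Lemma even_zdense (D : set 'M[R]_(g + g)) (i0 : S) : D 1%:M ->
  (forall A B, D A -> D B -> D (A *m B)) -> (forall i j, D (step i *m step j)) ->
  zdense D.
Proof.
move=> D1 DM DS p hp pD.
have ev m : forall l : seq S, size l = m.*2 -> D (realmx (seq_prod l)).
  elim: m => [|m ih] [|i [|j l]] //=; first by rewrite realmx1.
  by move=> [e]; rewrite mulmxA !realmxM; apply: DM; [exact: DS|exact: ih].
have ev' l : ~~ odd (size l) -> D (realmx (seq_prod l)).
  by move=> e; apply: (ev (size l)./2); rewrite -[LHS]odd_double_half (negbTE e).
have h A : G A -> p A * p (step i0 *m A) = 0.
  apply: (zariski_dense_zdense Gamma_dense (p := fun A => p A * p (step i0 *m A))).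
    by constructor => //; exact: polyfun_mull.
  move=> _ [B /Gamma_seq_prod[l ->] <-].
  have [hl|hl] := boolP (odd (size l)); last by rewrite pD ?mul0r //; exact: ev'.
  rewrite -[map_mx _ _]/(realmx _) (pD (_ *m _)) ?mulr0 //.
  by rewrite /step -realmxM; apply: (ev' (i0 :: l)); rewrite /= hl.
have [//|h1 A hA] := Sp_irreducible hp (polyfun_mull (step i0) hp) h.
have iS := step_Sp i0.
have := h1 (invmx (step i0) *m A); rewrite mulKVmx ?Sp_unit //; apply.
by apply: SpM => //; exact: SpV.
Qed.

End Generators.

Section SubspaceAction.
Variables (R : realType) (g k : nat) (rho : 'M[R]_(g + g) -> 'M[R]_k).
Local Notation G := (Sp R g).
Hypothesis hrho : polyrep rho.

(** Matrices normalised by [genmx], so that equal row spaces are equal elements of a choice type. *)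
Definition subspace := {U : 'M[R]_k | <<U>>%MS == U}.

Lemma genmx_subspace (U : 'M[R]_k) : <<<<U>>>>%MS == <<U>>%MS.
Proof. by rewrite genmx_id. Qed.

Definition mksub (U : 'M[R]_k) : subspace :=
  exist (fun U : 'M[R]_k => <<U>>%MS == U) <<U>>%MS (genmx_subspace U).

Definition sact (A : 'M[R]_(g + g)) (U : subspace) : subspace := mksub (val U *m rho A).

Lemma subspace_eqP (U V : subspace) : (val U :=: val V)%MS -> U = V.
Proof.
move=> /eq_genmx e; apply: val_inj.
by rewrite -(eqP (valP U)) -(eqP (valP V)).
Qed.

Lemma sactE A U : (val (sact A U) :=: val U *m rho A)%MS.
Proof. exact: genmxE. Qed.

Lemma sactM A B U : G A -> G B -> sact B (sact A U) = sact (A *m B) U.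
Proof.
have [_ _ rM] := hrho; move=> hA hB; apply: subspace_eqP.
apply: eqmx_trans (sactE _ _) _; apply: eqmx_trans _ (eqmx_sym (sactE _ _)).
by rewrite rM // mulmxA; apply: eqmxMr; exact: sactE.
Qed.

Lemma sact1 U : sact 1%:M U = U.
Proof.
have [_ r1 _] := hrho; apply: subspace_eqP.
by apply: eqmx_trans (sactE _ _) _; rewrite r1 mulmx1.
Qed.

Lemma sactK A : G A -> cancel (sact A) (sact (invmx A)).
Proof.
by move=> hA U; rewrite sactM ?mulmxV ?Sp_unit ?sact1 //; exact: SpV.
Qed.

Lemma sactVK A : G A -> cancel (sact (invmx A)) (sact A).
Proof.
by move=> hA U; rewrite sactM ?mulVmx ?Sp_unit ?sact1 //; exact: SpV.
Qed.

Lemma sact_rank A U : G A -> \rank (val (sact A U)) = \rank (val U).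
Proof.
move=> hA; rewrite sactE mxrankMfree // row_free_unit.
by have [] := mulmx1_unit (polyrepV hrho hA).
Qed.

Definition invariant (U : subspace) := forall A, G A -> (val U *m rho A <= val U)%MS.

Lemma invariant_act A U : G A -> invariant U -> invariant (sact A U).
Proof.
have [_ _ rM] := hrho; move=> hA hU B hB.
rewrite sactE (eqmxMr _ (sactE A U)).
have -> : val U *m rho A *m rho B = val U *m rho (A *m B *m invmx A) *m rho A.
  have hAB := SpM hA hB; have hC := SpM hAB (SpV hA).
  by rewrite -!(mulmxA (val U)) -(rM _ _ hA hB) -(rM _ _ hC hA) mulmxKV // Sp_unit.
apply: submxMr; apply: hU; apply: SpM; [exact: SpM|exact: SpV].
Qed.

Lemma invariant_actE A U : G A -> invariant (sact A U) <-> invariant U.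
Proof.
move=> hA; split; last exact: invariant_act.
by rewrite -{2}(sactK hA U); apply: invariant_act; exact: SpV.
Qed.

Definition moved (r : nat) : set subspace :=
  [set U | \rank (val U) = r /\ ~ invariant U].

Lemma moved_act r A U : G A -> moved r (sact A U) <-> moved r U.
Proof.
by move=> hA; rewrite /moved /= sact_rank //; have := invariant_actE U hA; tauto.
Qed.

(** The mean is transported by [Phi] to vectors of a representation without nonzero fixed vectors,
    where [invariant_mean_fixed] would produce one. *)
Lemma no_mean_on_moved r (D : set 'M[R]_(g + g)) (M : set subspace -> R) :
  D `<=` G -> zdense D -> D 1%:M ->
  (forall A B, D A -> D B -> D (A *m B)) -> (forall A, D A -> D (invmx A)) ->
  fa_prob M -> M (~` moved r) = 0 ->
  ~ (forall A C, D A -> M [set U | C (sact A U)] = M C).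
Proof.
move=> DG Dd D1 DM DV hM M0 Minv; have [rp r1 rM] := hrho.
have hB (U : subspace) : exists B : 'M[R]_(r, k), \rank (val U) = r -> row_free B /\ (B :=: val U)%MS.
  have [<-|ne] := eqVneq (\rank (val U)) r; last by exists 0 => e; rewrite e eqxx in ne.
  by exists (row_base (val U)) => _; split; [exact: row_base_free|exact: eq_row_base].
have [B {}hB] := choice hB.
have ht : polyrep (fun A => tens r (rho A)).
  split; [exact: polyfun_tens|by rewrite r1 tens1|].
  by move=> A A' hA hA'; rewrite rM // tensM.
have [m [C [sigma [hs CS Cfix sfix]]]] := quotient_polyrep ht.
(* The Pluecker vector modulo fixed vectors. The basis [B U] is arbitrary, so only its line is
   meaningful, as is enough on cones; the value 0 is taken on a set of mass zero. *)
pose Phi U : 'rV[R]_m := if `[< moved r U >] then minors (B U) *m C else 0.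
(* A Pluecker vector killed by C is fixed, and then U is invariant by [minors_inj]. *)
have Phi0 U : moved r U -> Phi U != 0.
  move=> hU; rewrite /Phi asboolT //; apply/eqP => /Cfix h; have [Ur nU] := hU.
  have [Bf BU] := hB U Ur.
  apply: nU => A hA; rewrite -(eqmxMr _ BU) -BU.
  by apply: minors_inj => //; rewrite minors_mulr h.
have PhiA A U : G A -> exists2 c, c != 0 & Phi (sact A U) = c *: (Phi U *m sigma A).
  move=> hA; have [hU|hU] := pselect (moved r U); last first.
    exists 1; first exact: oner_neq0.
    by rewrite /Phi !asboolF ?mul0mx ?scaler0 //; rewrite moved_act.
  have hU' : moved r (sact A U) by rewrite moved_act.
  rewrite /Phi !asboolT //.
  have [Bf BU] := hB U hU.1; have [Bf' BU'] := hB _ hU'.1.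
  have /submxP[Q e] : (B (sact A U) <= B U *m rho A)%MS.
    by rewrite BU' sactE (eqmxMr _ BU).
  exists (\det Q); last first.
    by rewrite e minors_mull minors_mulr -!scalemxAl -!mulmxA CS.
  apply/eqP => Q0; have := minors_neq0 Bf'.
  by rewrite e minors_mull Q0 scale0r eqxx.
have [y y0 yfix] : exists2 y : 'rV[R]_m, y != 0 & forall A, G A -> y *m sigma A = y.
  apply: (@invariant_mean_fixed _ _ _ sigma D (fun X => M (Phi @^-1` X))) => //.
  - have [Mge M1 MU] := hM; split=> // X Y XY; rewrite preimage_setU MU //.
    by rewrite -preimage_setI XY preimage_set0.
  - apply/eqP; rewrite eq_le; have [Mge _ _] := hM; rewrite Mge andbT -M0.
    apply: (fa_prob_mono hM) => U /= h hU; have := Phi0 U hU.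
    by rewrite h eqxx.
  move=> A X hA cX; rewrite -[RHS](Minv A _ hA); congr M.
  rewrite predeqE => U /=; have [c c0 ->] := PhiA A U (DG _ hA).
  split=> [h|h]; first exact: cX.
  by have := cX c^-1 _ (invr_neq0 c0) h; rewrite scalerA mulVf // scale1r.
by move: y0; rewrite (sfix y yfix) eqxx.
Qed.

End SubspaceAction.

(** * Random walks *)

Section Walk.
Variables (R : realType) (g : nat) (Gamma : set 'M[int]_(g + g))
  (S : {fset 'M[int]_(g + g)}).
Hypotheses (GammaSp : subgroup_of_SpZ Gamma) (S_sym : symmetric_set S)
  (S_gen : generated_by Gamma S) (Gamma_dense : zariski_dense_in_Sp R Gamma).
Variable i0 : S.
Local Notation G := (Sp R g).
Local Notation step := (@step R g S).

Local Notation N := (#|{: S}|%:R : R).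

Let N0 : 0 < N. Proof. by rewrite ltr0n; apply/card_gt0P; exists i0. Qed.

Let stepG i : G (step i). Proof. exact: step_Sp GammaSp S_gen i. Qed.

(** The expectation at the product of m uniform letters, by recursion on the first letter;
    [sum_words] ties it to the counting of [words]. *)
Fixpoint expect (m : nat) (h : 'M[R]_(g + g) -> R) : R :=
  if m is m'.+1 then N^-1 * \sum_(i : S) expect m' (fun A => h (step i *m A)) else h 1%:M.

Lemma expect_le m h h' : (forall A, G A -> h A <= h' A) -> expect m h <= expect m h'.
Proof.
elim: m h h' => [|m ih] h h' le /=; first by apply: le; exact: Sp1.
rewrite ler_pM2l ?invr_gt0 //; apply: ler_sum => i _; apply: ih => A hA.
by apply: le; exact: SpM.
Qed.

Lemma eq_expect m h h' : (forall A, G A -> h A = h' A) -> expect m h = expect m h'.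
Proof.
by move=> e; apply/eqP; rewrite eq_le !expect_le // => A hA; rewrite e.
Qed.

Lemma expect_cst m c : expect m (fun=> c) = c.
Proof.
elim: m => [//|m ih] /=; under eq_bigr do rewrite ih.
by rewrite sumr_const -[c *+ _]mulr_natl mulrA mulVf ?mul1r // gt_eqF.
Qed.

Lemma expectD m h h' : expect m (fun A => h A + h' A) = expect m h + expect m h'.
Proof.
elim: m h h' => [//|m ih] h h' /=; rewrite -mulrDr -big_split; congr (_ * _).
by apply: eq_bigr => i _; exact: ih.
Qed.

Lemma expectZ m c h : expect m (fun A => c * h A) = c * expect m h.
Proof.
elim: m h => [//|m ih] h /=; rewrite mulrCA; congr (_ * _); rewrite mulr_sumr.
by apply: eq_bigr => i _; exact: ih.
Qed.

Lemma expect_sum m (I : Type) (r : seq I) (F : I -> 'M[R]_(g + g) -> R) :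
  expect m (fun A => \sum_(i <- r) F i A) = \sum_(i <- r) expect m (F i).
Proof.
elim: r => [|i r ih].
  by rewrite big_nil -[RHS](expect_cst m 0); apply: eq_expect => A _; rewrite big_nil.
by rewrite big_cons -ih -expectD; apply: eq_expect => A _; rewrite big_cons.
Qed.

Lemma expect_add k m h :
  expect (k + m) h = expect k (fun A => expect m (fun B => h (A *m B))).
Proof.
elim: k h => [|k ih] h /=; first by apply: eq_expect => B _; rewrite mul1mx.
congr (_ * _); apply: eq_bigr => i _; rewrite ih; apply: eq_expect => A _.
by apply: eq_expect => B _; rewrite mulmxA.
Qed.

Lemma expect_swap k m (h : 'M[R]_(g + g) -> 'M[R]_(g + g) -> R) :
  expect k (fun A => expect m (h A)) = expect m (fun B => expect k (h^~ B)).
Proof.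
elim: k h => [//|k ih] h /=; rewrite [RHS]expectZ expect_sum; congr (_ * _).
by apply: eq_bigr => i _; rewrite ih.
Qed.

Lemma expect_sqr m h : expect m h ^+ 2 <= expect m (fun A => h A ^+ 2).
Proof.
set c := expect m h.
have : 0 <= expect m (fun A => (h A - c) ^+ 2).
  by rewrite -(expect_cst m 0); apply: expect_le => A _; exact: sqr_ge0.
rewrite (@eq_expect _ _ (fun A => h A ^+ 2 + ((- 2 * c) * h A + c ^+ 2))); last first.
  by move=> A _; ring.
by rewrite !expectD expectZ expect_cst -/c; lra.
Qed.

Definition indic (P : Prop) : R := (`[< P >])%:R.

Lemma indic_ge0 P : 0 <= indic P. Proof. exact: ler0n. Qed.

Lemma indic_sqr P : indic P ^+ 2 = indic P.
Proof. by rewrite /indic; case: asbool; rewrite ?expr1n ?expr0n. Qed.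

Section Subspaces.
Variables (k : nat) (rho : 'M[R]_(g + g) -> 'M[R]_k).
Hypothesis hrho : polyrep rho.
Local Notation subspace := (@subspace R k).
Local Notation sact := (@sact R g k rho).

Lemma moved_gap r : exists2 t : R, 0 < t < 1 & forall f : subspace -> R, fsupp f ->
  (forall U, ~ moved rho r U -> f U = 0) ->
  total (fun U => (\sum_(i : S) f (sact (step i) U)) ^+ 2) <=
    t * N ^+ 2 * total (fun U => f U ^+ 2).
Proof.
have K1 i : cancel (sact (step i)) (sact (invmx (step i))) by exact: sactK.
have K2 i : cancel (sact (invmx (step i))) (sact (step i)) by exact: sactVK.
apply: (l2_gap K1 K2 i0) => -[M [hM M0 Minv]].
(* The stabiliser of M. From [l2_gap] it is known to contain only products of two generators, hence
   the appeal to [even_zdense]. *)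
pose D := [set A | G A /\ forall C, M [set U | C (sact A U)] = M C].
have D1 : D 1%:M.
  by split=> [|C]; [exact: Sp1|congr M; rewrite predeqE => U /=; rewrite sact1].
have DM A B : D A -> D B -> D (A *m B).
  move=> [hA h] [hB h']; split=> [|C]; first exact: SpM.
  rewrite -(h' C) -(h [set U | C (sact B U)]); congr M; rewrite predeqE => U /=.
  by rewrite sactM.
have DV A : D A -> D (invmx A).
  move=> [hA h]; split=> [|C]; first exact: SpV.
  rewrite -(h [set U | C (sact (invmx A) U)]); congr M; rewrite predeqE => U /=.
  by rewrite sactK.
have DS i j : D (step i *m step j).
  split=> [|C]; first exact: SpM.
  (* By symmetry of S, a product of two generators is also an inverse generator times a generator,
     the shape in which M is compared. *)
  have [i' e] := step_inv R GammaSp S_sym S_gen i.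
  have e' : step i = invmx (step i') by rewrite e invmxK.
  rewrite e'; have -> : [set U | C (sact (invmx (step i') *m step j) U)] =
      [set U | [set V | C (sact (step j) V)] (sact (invmx (step i')) U)].
    by rewrite predeqE => U /=; rewrite sactM //; exact: SpV.
  rewrite (Minv i' j); congr M; rewrite predeqE => U /=.
  by rewrite sactVK.
apply: (no_mean_on_moved hrho _ _ D1 DM DV hM M0).
- by move=> A [].
- exact: (even_zdense GammaSp S_sym S_gen Gamma_dense i0 D1 DM DS).
- by move=> A C [_]; apply.
Qed.

Let hit (m : nat) (U V : subspace) : R := expect m (fun B => indic (sact B V = U)).

Let hitS m U V : hit m.+1 U V = N^-1 * \sum_i hit m U (sact (step i) V).
Proof.
congr (_ * _); apply: eq_bigr => i _; apply: eq_expect => A hA.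
by rewrite sactM.
Qed.

Let hit_fsupp m U : fsupp (hit m U).
Proof.
elim: m => [|m ih].
  exists [fset U]%fset => V; rewrite in_fset1 /hit /= sact1 // /indic => VU.
  by rewrite asboolF //; apply/eqP.
rewrite (_ : hit m.+1 U = fun V => N^-1 * \sum_i hit m U (sact (step i) V)); last first.
  by apply/funext => V; rewrite hitS.
apply: fsuppMl; apply: fsupp_sum => i; apply: fsupp_comp ih; exact: sactK.
Qed.

Let hit_moved r m U V : moved rho r U -> ~ moved rho r V -> hit m U V = 0.
Proof.
move=> hU hV; rewrite /hit -(expect_cst m 0); apply: eq_expect => B hB.
by rewrite /indic asboolF // => e; apply: hV; rewrite -(moved_act hrho _ _ hB) e.
Qed.

(** For each B exactly one V is brought to U, namely the translate by the inverse of B. *)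
Let total_hit m U f : total (fun V => hit m U V * f V) =
  expect m (fun B => f (sact (invmx B) U)).
Proof.
elim: m f => [|m ih] f.
  rewrite /= invmx1 sact1 // -(total_delta U f); apply: eq_total => V.
  rewrite /hit /= sact1 // /indic; congr (_%:R * _).
  by congr nat_of_bool; apply/asboolP/eqP.
have fs i : fsupp (fun V => hit m U (sact (step i) V) * f V).
  by apply: fsuppM; apply: fsupp_comp (hit_fsupp m U); exact: sactK.
transitivity (total (fun V => N^-1 * \sum_i hit m U (sact (step i) V) * f V)).
  by apply: eq_total => V; rewrite hitS -mulrA mulr_suml.
rewrite totalZ; last exact: fsupp_sum.
rewrite total_sum //=; congr (_ * _); apply: eq_bigr => i _.
rewrite -(total_comp _ (sactVK hrho (stepG i)) (sactK hrho (stepG i))).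
transitivity (total (fun V => hit m U V * f (sact (invmx (step i)) V))).
  by apply: eq_total => V; rewrite sactVK.
rewrite ih; apply: eq_expect => A hA; congr f.
rewrite sactM //; try exact: SpV.
congr sact; have U1 := Sp_unit (SpM (stepG i) hA).
by apply: (can_inj (mulKmx U1)); rewrite mulmxV // -mulmxA mulKVmx ?mulmxV ?Sp_unit.
Qed.

(** The collision probability is the squared l^2 norm of [hit m U]. Each further letter averages
    translates of this function, supported on [moved r], and costs a factor t by the gap. *)
Lemma collision r : exists2 t : R, 0 < t < 1 & forall U m, moved rho r U ->
  expect m (fun B => expect m (fun B' =>
    indic (sact (invmx B) U = sact (invmx B') U))) <= t ^+ m.
Proof.
have [t t01 ht] := moved_gap r; have /andP[t0 t1] := t01; exists t => // U m hU.
have -> : expect m (fun B => expect m (fun B' =>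
    indic (sact (invmx B) U = sact (invmx B') U))) = total (fun V => hit m U V ^+ 2).
  transitivity (total (fun V => hit m U V * hit m U V)); last first.
    by apply: eq_total => V; rewrite expr2.
  rewrite total_hit; apply: eq_expect => B hB; apply: eq_expect => B' hB'.
  rewrite /indic; congr (_%:R); congr nat_of_bool; apply/asboolP/asboolP => [->|e].
    by rewrite sactVK.
  by rewrite -[in RHS]e sactK.
elim: m => [|m ih].
  rewrite expr0 le_eqVlt; apply/orP; left; apply/eqP.
  transitivity (total (fun V => (V == U)%:R * (fun=> 1 : R) V)); last exact: total_delta.
  apply: eq_total => V; rewrite /hit /= sact1 // indic_sqr mulr1 /indic; congr (_%:R).
  by congr nat_of_bool; apply/asboolP/eqP.
have fs : fsupp (fun V => (\sum_i hit m U (sact (step i) V)) ^+ 2).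
  apply: fsuppX2; apply: fsupp_sum => i; apply: fsupp_comp (hit_fsupp m U); exact: sactK.
have -> : total (fun V => hit m.+1 U V ^+ 2) =
    N ^- 2 * total (fun V => (\sum_i hit m U (sact (step i) V)) ^+ 2).
  by rewrite -totalZ //; apply: eq_total => V; rewrite hitS exprMn exprVn.
have := ht (hit m U) (hit_fsupp m U) (fun V => @hit_moved r m U V hU).
move=> h; rewrite ler_pdivrMl ?exprn_gt0 // (exprS t); apply: le_trans h _.
by rewrite (mulrC t) -mulrA ler_pM2l ?exprn_gt0 // ler_pM2l.
Qed.

Variable v : 'rV[R]_k.

Definition sub_prob m (U : subspace) := expect m (fun A => indic (v *m rho A <= val U)%MS).

(** If the whole orbit of v lay in U, the probability would be 1 for every m; the condition must be
    carried through the induction. *)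
Definition escapes (U : 'M[R]_k) := ~ forall A, G A -> (v *m rho A <= U)%MS.

Let sub_prob_invariant m U : escapes (val U) -> invariant rho U -> sub_prob m U = 0.
Proof.
have [_ _ rM] := hrho; move=> pU iU; rewrite /sub_prob -(expect_cst m 0).
apply: eq_expect => A hA; rewrite /indic asboolF // => h; apply: pU => B hB.
have -> : v *m rho B = v *m rho A *m rho (invmx A *m B).
  by rewrite -mulmxA -rM ?mulKVmx ?Sp_unit //; apply: SpM => //; exact: SpV.
apply: submx_trans (submxMr _ h) _; apply: iU; apply: SpM => //; exact: SpV.
Qed.

Let sub_sact A B (U : subspace) : G A -> G B ->
  (v *m rho (A *m B) <= val U)%MS = (v *m rho A <= val (sact (invmx B) U))%MS.
Proof.
have [_ _ rM] := hrho; move=> hA hB; rewrite sactE rM // mulmxA.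
have e := polyrepV hrho hB; have e' := polyrepVl hrho hB.
apply/idP/idP => h; first by rewrite -[v *m _]mulmx1 -e mulmxA; exact: submxMr.
by rewrite -[val U]mulmx1 -e' mulmxA; exact: submxMr.
Qed.

Let escapes_sact B (U : subspace) : G B -> escapes (val U) -> escapes (val (sact (invmx B) U)).
Proof.
move=> hB pU h; apply: pU => A hA.
have hAB : G (A *m invmx B) by apply: SpM => //; exact: SpV.
by have := h _ hAB; rewrite -sub_sact // mulmxKV // Sp_unit.
Qed.

Let sub_prob_sqr r c (U : subspace) a m : 0 <= c ->
  (forall V : subspace, (\rank (val V) <= r)%N -> escapes (val V) -> sub_prob a V <= c) ->
  \rank (val U) = r.+1 -> escapes (val U) ->
  sub_prob (a + m) U ^+ 2 <= expect m (fun B => expect m (fun B' =>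
    indic (sact (invmx B) U = sact (invmx B') U))) + c.
Proof.
move=> c0 hc Ur pU.
pose q A B := indic (v *m rho A <= val (sact (invmx B) U))%MS.
have -> : sub_prob (a + m) U = expect a (fun A => expect m (q A)).
  rewrite /sub_prob expect_add; apply: eq_expect => A hA; apply: eq_expect => B hB.
  by rewrite /q sub_sact.
apply: le_trans (expect_sqr _ _) _.
have -> : expect a (fun A => expect m (q A) ^+ 2) =
    expect m (fun B => expect m (fun B' => expect a (fun A => q A B * q A B'))).
  transitivity (expect a (fun A => expect m (fun B => expect m (fun B' => q A B * q A B')))).
    apply: eq_expect => A _; rewrite expr2 -expectZ; apply: eq_expect => B _.
    by rewrite mulrC -expectZ.
  by rewrite expect_swap; apply: eq_expect => B _; rewrite expect_swap.
rewrite -[X in _ + X](expect_cst m c) -expectD; apply: expect_le => B hB.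
rewrite -[X in _ + X](expect_cst m c) -expectD; apply: expect_le => B' hB'.
set V := sact (invmx B) U; set V' := sact (invmx B') U.
have [e|ne] := pselect (V = V').
  rewrite {1}/indic asboolT // -[X in X <= _]addr0 lerD // -(expect_cst a 1).
  by apply: expect_le => A _; rewrite mulr_ile1 ?indic_ge0 // /indic lern1 leq_b1.
rewrite {1}/indic asboolF // add0r; apply: le_trans (hc (mksub (val V :&: val V')%MS) _ _).
- apply: expect_le => A _; rewrite /q /indic -/V -/V'.
  case: asboolP => h; last by rewrite mul0r ler0n.
  case: asboolP => h'; last by rewrite mulr0 ler0n.
  by rewrite asboolT ?mulr1 //= genmxE sub_capmx h h'.
- have Vr : \rank (val V) = r.+1 by rewrite sact_rank //; exact: SpV.
  have Vr' : \rank (val V') = r.+1 by rewrite sact_rank //; exact: SpV.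
  rewrite /= genmxE -ltnS ltn_neqAle -{2}Vr mxrankS ?capmxSl // andbT.
  apply/eqP => e; apply: ne; apply: subspace_eqP; apply/eqmxP.
  have [_] := mxrank_leqif_sup (capmxSl (val V) (val V')); rewrite e Vr eqxx => /esym h.
  have [_] := mxrank_leqif_sup (capmxSr (val V) (val V')); rewrite e Vr' eqxx => /esym h'.
  by rewrite (submx_trans h (capmxSr _ _)) (submx_trans h' (capmxSl _ _)).
move=> h; apply: (escapes_sact hB pU) => A hA.
by apply: submx_trans (h A hA) _; rewrite /= genmxE capmxSl.
Qed.

Lemma sub_prob_decay r : exists C t : R, [/\ 0 < C, 0 < t < 1 &
  forall (U : subspace) m, (\rank (val U) <= r)%N -> escapes (val U) -> sub_prob m U <= C * t ^+ m].
Proof.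
elim: r => [|r [C [t [C0 /andP[t0 t1] ih]]]].
  exists 1, (2^-1); split=> //; first by apply/andP; split; lra.
  move=> U m; rewrite leqn0 mxrank_eq0 => /eqP U0 pU.
  have iU : invariant rho U by move=> A _; rewrite U0 mul0mx.
  by rewrite sub_prob_invariant // mul1r exprn_ge0 // invr_ge0.
have [t' /andP[t'0 t'1] hcol] := collision r.+1.
pose b := Num.max t t'.
have b0 : 0 < b by rewrite lt_max t0.
have b1 : b < 1 by rewrite gt_max t1.
(* A fourth root: one square root undoes the square in [sub_prob_sqr], the other accounts for only
   half of the letters producing decay. *)
pose s := Num.sqrt (Num.sqrt b).
have s0 : 0 < s by rewrite !sqrtr_gt0.
have s4 : s ^+ 4 = b by rewrite (exprM s 2 2) !sqr_sqrtr // ?sqrtr_ge0 // ltW.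
have s1 : s < 1.
  rewrite ltNge; apply/negP => s1; move: b1; rewrite -s4 ltNge.
  by rewrite exprn_ege1.
have C1 : 1 <= Num.sqrt (1 + C) by rewrite -{1}[1]sqrtr1 ler_sqrt ?lerDl ?ltW // addr_gt0.
have even U m : \rank (val U) = r.+1 -> escapes (val U) -> ~ invariant rho U ->
    sub_prob (m + m) U <= Num.sqrt (1 + C) * s ^+ (2 * m).
  move=> Ur pU nU.
  have p0 : 0 <= sub_prob (m + m) U.
    by rewrite -(expect_cst (m + m) 0); apply: expect_le => A _; exact: indic_ge0.
  have h : sub_prob (m + m) U ^+ 2 <= (1 + C) * b ^+ m.
    apply: le_trans (@sub_prob_sqr r (C * t ^+ m) U m m _ _ Ur pU) _.
    - by rewrite mulr_ge0 // ?exprn_ge0 // ltW.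
    - by move=> V Vr pV; exact: ih.
    rewrite mulrDl mul1r; apply: lerD.
      apply: le_trans (hcol U m _) _; first by [].
      by apply: lerXn2r; rewrite ?nnegrE ?(ltW t'0) ?(ltW b0) // le_max lexx orbT.
    rewrite ler_pM2l //; apply: lerXn2r; rewrite ?nnegrE ?(ltW t0) ?(ltW b0) //.
    by rewrite le_max lexx.
  rewrite -(ler_pXn2r (n := 2)) ?nnegrE // ?mulr_ge0 ?sqrtr_ge0 ?exprn_ge0 ?(ltW s0) //.
  rewrite exprMn sqr_sqrtr; last by rewrite addr_ge0 // ltW.
  by rewrite -exprM mulnAC -[(2 * 2)%N]/4%N exprM s4.
(* The division by s leaves room for one extra letter when m is odd. *)
have small U m : \rank (val U) = r.+1 -> escapes (val U) ->
    sub_prob m U <= Num.sqrt (1 + C) / s * s ^+ m.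
  move=> Ur pU.
  have rhs0 : 0 <= Num.sqrt (1 + C) / s * s ^+ m.
    by rewrite mulr_ge0 ?exprn_ge0 ?divr_ge0 ?sqrtr_ge0 // ltW.
  have [iU|nU] := pselect (invariant rho U); first by rewrite sub_prob_invariant.
  have key V j : \rank (val V) = r.+1 -> escapes (val V) -> ~ invariant rho V ->
      sub_prob (j + j) V <= Num.sqrt (1 + C) / s * s ^+ (j + j).+1.
    move=> Vr pV nV; apply: le_trans (even V j Vr pV nV) _.
    by rewrite exprS mulrA divfK ?gt_eqF // mul2n addnn.
  rewrite -[m]odd_double_half -addnn; case: (odd m); last first.
    rewrite add0n; apply: le_trans (key U _ Ur pU nU) _.
    apply: ler_wpM2l; first by rewrite divr_ge0 ?sqrtr_ge0 // ltW.
    by rewrite exprS ler_piMl ?exprn_ge0 // ltW.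
  (* For odd length, condition on the last letter B: it replaces U by its translate under the
     inverse of B, which has the same rank and is again not invariant. *)
  rewrite add1n -addn1 /sub_prob expect_add expect_swap.
  rewrite addn1 -[X in _ <= X](expect_cst 1); apply: expect_le => B hB.
  apply: le_trans (key (sact (invmx B) U) _ _ _ _).
  - rewrite le_eqVlt; apply/orP; left; apply/eqP; apply: eq_expect => A hA.
    by rewrite sub_sact.
  - by rewrite sact_rank //; exact: SpV.
  - exact: escapes_sact.
  - by rewrite invariant_actE //; exact: SpV.
pose C2 := C + Num.sqrt (1 + C) / s.
pose t2 := Num.max t s.
have q0 : 0 <= Num.sqrt (1 + C) / s by rewrite divr_ge0 ?sqrtr_ge0 // ltW.
exists C2, t2; split.
- by rewrite ltr_pwDl.
- by rewrite lt_max t0 gt_max t1.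
move=> U m; rewrite leq_eqVlt ltnS => /orP[/eqP Ur|Ur] pU.
  apply: le_trans (small U m Ur pU) _; apply: ler_pM; rewrite ?exprn_ge0 ?(ltW s0) //.
    by rewrite lerDr ltW.
  by apply: lerXn2r; rewrite ?nnegrE ?le_max ?(ltW s0) ?lexx ?orbT.
apply: le_trans (ih U m Ur pU) _; apply: ler_pM; rewrite ?exprn_ge0 ?(ltW t0) ?(ltW C0) //.
  by rewrite lerDl.
by apply: lerXn2r; rewrite ?nnegrE ?le_max ?(ltW t0) ?lexx ?orbT.
Qed.

End Subspaces.
End Walk.

(** * Eigenvalue 1 of a random word *)

Section Words.
Variables (R : realType) (g : nat) (S : {fset 'M[int]_(g + g)}).

Lemma word_prodS n (i : S) (w : words S n) :
  word_prod ([ffun k => oapp w i (unlift ord0 k)] : words S n.+1) =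
  val i *m word_prod w.
Proof.
rewrite /word_prod big_ord_recl ffunE unlift_none; congr (_ *m _).
by apply: eq_bigr => k _; rewrite ffunE liftK.
Qed.

Lemma sum_words n (h : 'M[R]_(g + g) -> R) : (0 < #|{: S}|)%N ->
  \sum_(w : words S n) h (realmx R (word_prod w)) = #|{: S}|%:R ^+ n * expect S n h.
Proof.
move=> S0; elim: n h => [|n ih] h.
  rewrite expr0 mul1r (bigD1 [ffun k : 'I_0 => False_rect S (notF (ltn_ord k))]) //=.
  rewrite big1 ?addr0; first by rewrite /word_prod big_ord0 realmx1.
  by move=> w /eqP[]; apply/ffunP => -[].
rewrite (reindex (fun p : S * words S n => [ffun k => oapp p.2 p.1 (unlift ord0 k)])) /=; last first.
  exists (fun w : words S n.+1 => (w ord0, [ffun k => w (lift ord0 k)])) => [[i w]|w] _ /=.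
    by rewrite ffunE unlift_none; congr (_, _); apply/ffunP => k; rewrite !ffunE liftK.
  by apply/ffunP => k; rewrite !ffunE; case: unliftP => [j|] -> //=; rewrite ffunE.
rewrite (eq_bigr (fun p : S * words S n => h (step R p.1 *m realmx R (word_prod p.2)))); last first.
  by move=> p _; rewrite word_prodS realmxM.
rewrite -(pair_bigA _ (fun i w => h (step R i *m realmx R (word_prod w)))) /=.
rewrite exprSr -mulrA mulVKf ?pnatr_eq0 -?lt0n // mulr_sumr.
by apply: eq_bigr => i _; rewrite (ih (fun A => h (step R i *m A))).
Qed.

Lemma counting_prob_words n (P : 'M[R]_(g + g) -> Prop) : (0 < #|{: S}|)%N ->
  counting_prob R [set w : words S n | P (realmx R (word_prod w))] =
  expect S n (fun A => indic R (P A)).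
Proof.
move=> S0; rewrite /counting_prob card_ffun card_ord natrX.
have N0 : #|{: S}|%:R ^+ n != 0 :> R by rewrite expf_neq0 // pnatr_eq0 -lt0n.
apply: (mulIf N0); rewrite divfK // mulrC -sum_words // -sum1_card natr_sum big_mkcond.
by apply: eq_bigr => w _; rewrite inE /indic; case: asbool.
Qed.

End Words.

Lemma counting_prob_le (R : realType) (T : finType) (E F : set T) : E `<=` F ->
  counting_prob R E <= counting_prob R F.
Proof.
move=> EF; rewrite /counting_prob ler_wpM2r ?invr_ge0 ?ler0n // ler_nat.
apply: subset_leq_card; apply/fintype.subsetP => t; rewrite !finset.in_set.
by move=> /asboolP Et; apply/asboolP; exact: EF.
Qed.

Lemma counting_prob_le1 (R : realType) (T : finType) (E : set T) :
  counting_prob R E <= 1.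
Proof.
have [T0|T0] := posnP #|T|; first by rewrite /counting_prob T0 invr0 mulr0 ler01.
by rewrite ler_pdivrMr ?ltr0n // mul1r ler_nat max_card.
Qed.

(** * The condition det(A - 1) = 0 as a subspace condition on an orbit *)

Section FixedVectors.
Variables (R : realType) (g : nat).
Local Notation n := (g + g)%N.

Let rho (A : 'M[R]_n) := tens n (block_mx 1%:M 0 0 A : 'M[R]_(n + n)).

Let rho_polyrep : polyrep rho.
Proof.
split.
- apply: polyfun_tens => i j; rewrite -(@splitK _ _ i) -(@splitK _ _ j).
  case: (fintype.split i) => i'; case: (fintype.split j) => j' /=.
  + rewrite (_ : (fun _ => _) = fun=> (1%:M : 'M[R]_n) i' j'); first by constructor.
    by apply/funext => A; rewrite block_mxEul.
  + rewrite (_ : (fun _ => _) = fun=> 0); first by constructor.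
    by apply/funext => A; rewrite block_mxEur mxE.
  + rewrite (_ : (fun _ => _) = fun=> 0); first by constructor.
    by apply/funext => A; rewrite block_mxEdl mxE.
  rewrite (_ : (fun _ => _) = fun A : 'M[R]_n => A i' j'); first by constructor.
  by apply/funext => A; rewrite block_mxEdr.
- by rewrite /rho -scalar_mx_block tens1.
move=> A B _ _; rewrite /rho -tensM mulmx_block !mulmx0 !mul0mx !mulmx1.
by rewrite !addr0 !add0r.
Qed.

Let v : 'rV[R]_(#|{ffun 'I_n -> 'I_(n + n)}|) := minors (row_mx 1%:M 1%:M).

(** Multiplying [1 | A] by this block column gives A - 1. *)
Let l := tens n (col_mx (- 1%:M) 1%:M : 'M[R]_(n + n, n)).

(** The tuple of all columns in their order, whose minor is the full determinant. *)
Let c0 := enum_rank [ffun i : 'I_n => i].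

Let U := mksub (kermx (col c0 l)).

(* det (A - 1) is a linear form in the maximal minors of [1 | A], and these
   depend linearly on A in a tensor power of [1 (+) A]. *)
Let orbitE (A : 'M[R]_n) : (v *m rho A <= val U)%MS = (\det (A - 1%:M) == 0).
Proof.
rewrite genmxE; rewrite (sameP sub_kermxP eqP).
have e : v *m rho A *m col c0 l = (\det (A - 1%:M))%:M.
  rewrite mulmx_colsub -colEsub /v /rho /l -!minors_mulr.
  rewrite mul_row_block !mulmx0 addr0 add0r !mul1mx.
  rewrite mul_row_col mulmxN !mulmx1 addrC.
  apply/matrixP => i j; rewrite !ord1 !mxE eqxx mulr1n enum_rankK; congr (\det _).
  by apply/matrixP => i' j'; rewrite !mxE ffunE.
rewrite e; apply/eqP/eqP => [/matrixP/(_ ord0 ord0)|->]; last by rewrite raddf0.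
by rewrite !mxE eqxx mulr1n.
Qed.

Lemma fixed_vector_decay (Gamma : set 'M[int]_n) (S : {fset 'M[int]_n}) (i0 : S) :
  subgroup_of_SpZ Gamma -> symmetric_set S -> generated_by Gamma S ->
  zariski_dense_in_Sp R Gamma ->
  exists C t : R, [/\ 0 < C, 0 < t < 1 & forall m,
    expect S m (fun A => indic R (\det (A - 1%:M) = 0)) <= C * t ^+ m].
Proof.
move=> GammaSp S_sym S_gen Gamma_dense.
have [C [t [C0 t01 h]]] :=
  sub_prob_decay GammaSp S_sym S_gen Gamma_dense i0 rho_polyrep v (\rank (val U)).
exists C, t; split=> // m; apply: le_trans (h U m _ _); first 1 last.
- by [].
- move=> pU.
  (* The witness that v escapes: for A = -1 the determinant of A - 1 is a power of -2. *)
  have : Sp R g (- 1%:M).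
    by rewrite /Sp /= (raddfN (@trmx R n n)) /= trmx1 mulNmx mul1mx mulmxN mulmx1 opprK.
  move=> /pU; rewrite orbitE -opprD -scaleN1r detZ.
  rewrite -[1%:M]/(1%:M : 'M[R]_n) -(raddfD (@scalar_mx R n)) det_scalar.
  by rewrite mulf_eq0 !expf_eq0 oppr_eq0 oner_eq0 (_ : 1 + 1 = 2%:R :> R) // pnatr_eq0 !andbF.
rewrite le_eqVlt; apply/orP; left; apply/eqP.
apply: (eq_expect GammaSp S_gen i0) => A _.
by rewrite /indic orbitE; congr (_%:R); congr nat_of_bool; apply/asboolP/asboolP => /eqP.
Qed.

End FixedVectors.

Theorem theorem4p1 (R : realType) (g : nat)
    (Gamma : set 'M[int]_(g + g)) (S : {fset 'M[int]_(g + g)})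
    (GammaSp : subgroup_of_SpZ Gamma)
    (Gamma_dense : zariski_dense_in_Sp R Gamma)
    (S_sym : symmetric_set S) (S_gen : generated_by Gamma S)
    (X : topologicalType) (mu : chain R 2 X) (e : 'I_(g + g) -> chain R 1 X)
    (X_surface : closed_connected_surface R X)
    (X_oriented : fundamental_cycle mu)
    (X_genus : betti1 R X = ((2 * g)%:R)%:E)
    (e_symplectic : symplectic_basis mu e) :
  exists C c : R, 0 < C /\ 0 < c /\
    forall (n : nat) (phi : words S n -> continuousType X X),
      random_gluing mu e phi ->
      counting_prob R [set w | (1 < betti1 R (mapping_torus R X (phi w)))%E]
        <= C * expR (- c * n%:R).
Proof.
(* If S is empty there are no words of positive length, and the probability 0 / 0 evaluates to 0. *)
have [S0|S0] := posnP #|{: S}|.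
  exists 1, 1; do 2!split=> //; case=> [|n] phi _.
    by rewrite mulr0 expR0 mulr1 counting_prob_le1.
  rewrite /counting_prob card_ffun card_ord S0 exp0n // invr0 mulr0 mul1r.
  exact: expR_ge0.
have /card_gt0P[i0 _] := S0.
have [C [t [C0 /andP[t0 t1] bound]]] :=
  fixed_vector_decay i0 GammaSp S_sym S_gen Gamma_dense.
exists C, (- ln t); split=> //; split; first by rewrite oppr_gt0 ln_lt0 ?t0.
move=> n phi gluing; rewrite opprK expRM_natr lnK ?posrE //.
apply: le_trans (bound n); rewrite -(counting_prob_words _ _ S0).
apply: counting_prob_le => w /=.
have [[psi [phiK psiK]] _ monodromy] := gluing w.
have [[x0 _] _ _ X_conn X_eucl] := X_surface.
move=> b_gt1; apply: contrapT => /eqP d0; move: b_gt1; rewrite ltNge => /negP; apply.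
apply: (betti1_mapping_torus_le1 phiK psiK x0 X_conn X_eucl e_symplectic.1 monodromy).
apply: contraNneq d0 => d0.
by rewrite -(realmx1 R g) /realmx -map_mxB det_map_mx d0.
Qed.
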